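(* There exists a two-dimensional linear horseshoe $(f,\Lambda)$ which, for every $r\ge3$, has multiple (at least two distinct) ergodic measures maximizing $r$-neutralized entropy.
   Context: Two-dimensional linear horseshoe: fix $\eta_1,\eta_2>0$ with $\eta_1+\eta_2<1$ and define affine maps $f_1:[0,\eta_1]\times[0,1]\to[0,1]\times[0,\eta_2]$, $f_1(x,y)=(\eta_1^{-1}x,\eta_2y)$, and $f_2:[1-\eta_2,1]\times[0,1]\to[0,1]\times[1-\eta_1,1]$, $f_2(x,y)=(\eta_2^{-1}(x-1+\eta_2),\,1-\eta_1+\eta_1y)$. Let $f$ be the map equal to $f_1$ on the domain of $f_1$ and to $f_2$ on the domain of $f_2$ (these domains are disjoint, as are the images, so $f$ and $f^{-1}$ are well defined on subsets of $[0,1]^2$). $\Lambda$ is the set of points of $[0,1]^2$ at which $f^n$ and $f^{-n}$ are defined for all integers $n$. Let $d$ be the Euclidean distance, $\mathcal M(f,\Lambda)$ the set of $f$-invariant Borel probability measures on $\Lambda$, and for $\nu\in\mathcal M(f,\Lambda)$, $r>0$ let $B(x,n,e^{-nr})=\{y\in\Lambda:d(f^i(y),f^i(x))<e^{-nr},\ 0\le i<n\}$, $h^r_{\nu,d}(f,x)=\limsup_{n\to\infty}-\frac1n\log\nu(B(x,n,e^{-nr}))$ and $h^r_{\nu,d}(f)=\int h^r_{\nu,d}(f,x)\,d\nu$. A measure $\mu\in\mathcal M(f,\Lambda)$ maximizes $r$-neutralized entropy if $h^r_{\mu,d}(f)=\sup\{h^r_{\nu,d}(f):\nu\in\mathcal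 M(f,\Lambda)\}$. *)

(* Defs.v *)
From mathcomp Require Import all_boot all_order all_algebra.
From mathcomp Require Import all_classical all_reals all_analysis.

Set Implicit Arguments.
Unset Strict Implicit.
Unset Printing Implicit Defensive.

Import Order.TTheory GRing.Theory Num.Theory.
Import numFieldNormedType.Exports.

Local Open Scope classical_set_scope.
Local Open Scope ring_scope.

(* R^2 with the product of the Borel sigma-algebras, which is the Borel
   sigma-algebra of R^2. *)
Definition plane (R : realType) : measurableType _ :=
  (R * R)%type.

Definition euclid (R : realType) (p q : R * R) : R :=
  Num.sqrt ((p.1 - q.1) ^+ 2 + (p.2 - q.2) ^+ 2).

Section Horseshoe.
Context {R : realType}.
Variables eta1 eta2 : R.

Definition unit_square : set (R * R) := `[0, 1] `*` `[0, 1].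

Definition hs_dom1 : set (R * R) := `[0, eta1] `*` `[0, 1].
Definition hs_dom2 : set (R * R) := `[1 - eta2, 1] `*` `[0, 1].

Definition hs_map1 (p : R * R) : R * R := (eta1^-1 * p.1, eta2 * p.2).
Definition hs_map2 (p : R * R) : R * R :=
  (eta2^-1 * (p.1 - 1 + eta2), 1 - eta1 + eta1 * p.2).

(* The partial map f is encoded as a total function together with its domain;
   the values of [hs_map] outside [hs_dom] are junk. *)
Definition hs_dom : set (R * R) := hs_dom1 `|` hs_dom2.
Definition hs_map (p : R * R) : R * R :=
  if p \in hs_dom1 then hs_map1 p else hs_map2 p.

(* The domain of the n-th iterate of the partial map f. *)
Definition hs_iter_dom (n : nat) : set (R * R) :=
  [set p | forall i : nat, (i < n)%N -> hs_dom (iter i hs_map p)].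

(* f being injective, f^-n is defined at p iff p is in the image of f^n. *)
Definition horseshoe : set (R * R) :=
  [set p | unit_square p /\
    forall n : nat, hs_iter_dom n p /\ (iter n hs_map @` hs_iter_dom n) p].

End Horseshoe.

(* Borel probability measures on a Borel set L of the ambient space T are
   encoded as probability measures on T giving full mass to L; f only matters
   on L. *)
Section NeutralizedEntropy.
Context {R : realType} {disp : measure_display} {T : measurableType disp}.
Variables (f : T -> T) (L : set T) (d : T -> T -> R).

Definition invariant_measures : set (probability T R) :=
  [set mu | mu L = 1%E /\
    forall A : set T, measurable A -> mu (L `&` f @^-1` A) = mu A].

Definition ergodic (mu : probability T R) : Prop :=
  invariant_measures mu /\
  forall A : set T, measurable A -> A `<=` L -> L `&` f @^-1` A = A ->
    mu A = 0%E \/ mu A = 1%E.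

Definition neutral_ball (r : R) (x : T) (n : nat) : set T :=
  [set y | L y /\ forall i : nat, (i < n)%N ->
    d (iter i f y) (iter i f x) < expR (- (n%:R * r))].

(* [lne] is the logarithm with lne 0 = -oo, so that balls of measure zero
   contribute +oo. *)
Definition local_neutral_entropy (r : R) (nu : probability T R) (x : T) :
    \bar R :=
  limn_esup (fun n => (- (n%:R^-1)%:E * lne (nu (neutral_ball r x n)))%E).

Definition neutral_entropy (r : R) (nu : probability T R) : \bar R :=
  (\int[nu]_(x in L) local_neutral_entropy r nu x)%E.

Definition maximizes_neutral_entropy (r : R) (mu : probability T R) : Prop :=
  invariant_measures mu /\
  neutral_entropy r mu =
    ereal_sup [set neutral_entropy r nu | nu in invariant_measures].

End NeutralizedEntropy.

(* Main.v *)
(** In the coordinates (x, y) the horseshoe is a product of two Cantor sets: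
    the x-coordinate codes the future and the y-coordinate the past of a point,
    and a neutralized ball is, up to o(n) symbols, a cylinder on a window
    [-m, n + k). If the symbol 1 has frequency q, then k ~ n r / lu(q) and
    m ~ n r / ls(q), where lu and ls are the two Lyapunov exponents; hence the
    local neutralized entropy is at most
    F(q) = H(q) (1 + r / lu(q) + r / ls(q)), with H the binary entropy.
    This holds almost everywhere for every invariant measure, without ergodic
    decomposition: the forward and backward frequencies exist and agree by the
    maximal ergodic inequality, and the measure of the cylinder of a typical
    point cannot be much smaller than its Bernoulli(t) weight, for every t
    (Borel-Cantelli). For the Bernoulli(q) measure there is equality. Since
    F(q) = F(1 - q), any maximizer q of F other than 1/2 yields two maximizing
    measures, and F(1/2) < max F as soon as eta1 and eta2 are sufficiently
    asymmetric: here eta1 = exp(-12) and eta2 = 1 - 2 eta1. *)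
Require Import Defs.
From HB Require Import structures.
From mathcomp Require Import all_boot all_order all_algebra.
From mathcomp Require Import all_classical all_reals all_analysis.
From mathcomp Require Import measurable_realfun.
From mathcomp Require Import ring lra zify.

Import Order.TTheory GRing.Theory Num.Theory.
Import numFieldNormedType.Exports.

Local Open Scope classical_set_scope.
Local Open Scope ring_scope.

(** * Coding of an expanding interval map *)

Section Expanding.
Context {R : realType}.
Implicit Types (a b t u v : R) (s : bool).

(** Asymmetry moves the maximum away from 1/2 because of orbits that mostly follow the first branch.
    There the vertical contraction [eta2] is close to 1, so the stable exponent is about as small as
    the entropy, and H(q) r / ls(q) stays of order r although H(q) is tiny. At q = 1/2 both
    exponents are at least half of -ln eta1, and the same terms are only a small multiple of r. The
    obstacle in the upper bound is that the frequency varies with the point and may be 0 or 1, while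
    the exceptional null set must be fixed beforehand. Hence only rational t are used as reference
    weights, and t is moved towards q once the point is given. For the lower bound the Bernoulli
    measure is a product of two self-similar measures, one per coordinate. Future and past digits
    are then independent, cylinders have exactly their Bernoulli weight, and invariance and
    ergodicity reduce to computations on rectangles. *)

Definition unbranch a b t : R := if t <= a then a^-1 * t else b^-1 * (t - 1 + b).

Definition branch a b s t : R := if s then a * t else 1 - b + b * t.

Definition ifs_dom a b : set R := `[0, a] `|` `[1 - b, 1].

(** The parameters [(e1, e2)] describe the x-coordinate under the horseshoe map, and [(e2, e1)] the
    y-coordinate under its inverse; this section serves both. *)
Definition repeller a b : set R :=
  [set t | forall n, ifs_dom a b (iter n (unbranch a b) t)].

Definition digit a b t (i : nat) : bool := iter i (unbranch a b) t <= a.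

Definition ones a b t (n : nat) : nat := \sum_(i < n) digit a b t i.

(** With [(u, v) = (a, b)] this is the length of the basic interval given by the first [n] digits;
    with [(u, v) = (w, 1 - w)] it is the Bernoulli probability of these digits. *)
Definition weight a b u v t (n : nat) : R :=
  \prod_(i < n) (if digit a b t i then u else v).

Definition same_digits a b (n : nat) t t' : Prop :=
  forall i, (i < n)%N -> digit a b t i = digit a b t' i.

Lemma digitS a b t i : digit a b t i.+1 = digit a b (unbranch a b t) i.
Proof. by rewrite /digit iterSr. Qed.

Lemma digitD a b t n i : digit a b t (n + i) = digit a b (iter n (unbranch a b) t) i.
Proof. by rewrite /digit addnC iterD. Qed.

Lemma onesS a b t n : ones a b t n.+1 = (ones a b t n + digit a b t n)%N.
Proof. by rewrite /ones big_ord_recr. Qed.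

Lemma ones_le a b t n : (ones a b t n <= n)%N.
Proof.
rewrite /ones -[leqRHS]card_ord -sum1_card leq_sum// => i _.
exact: leq_b1.
Qed.

Lemma weightE a b u v t n :
  weight a b u v t n = u ^+ ones a b t n * v ^+ (n - ones a b t n).
Proof.
elim: n => [|n ih]; first by rewrite /weight /ones !big_ord0 subn0 !expr0 mulr1.
rewrite /weight big_ord_recr/= -/(weight a b u v t n) ih onesS.
case: ifP => _ /=; first by rewrite addn1 subSS exprS; ring.
by rewrite addn0 subSn ?ones_le// exprS; ring.
Qed.

Lemma weightS a b u v t n : weight a b u v t n.+1 =
  (if digit a b t 0 then u else v) * weight a b u v (unbranch a b t) n.
Proof.
rewrite /weight big_ord_recl; congr (_ * _).
by apply: eq_bigr => i _; rewrite -digitS.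
Qed.

Lemma weight_gt0 a b u v t n : 0 < u -> 0 < v -> 0 < weight a b u v t n.
Proof. by move=> u0 v0; apply: prodr_gt0 => i _; case: ifP. Qed.

Lemma same_digitsS a b n t t' : same_digits a b n.+1 t t' <->
  digit a b t 0 = digit a b t' 0 /\
  same_digits a b n (unbranch a b t) (unbranch a b t').
Proof.
split=> [h|[h0 h] [|i] ilt //].
  by split=> [|i ilt]; [exact: h|rewrite -!digitS h].
by rewrite !digitS h.
Qed.

Lemma same_digits_trans a b n t t' t'' : same_digits a b n t t' ->
  same_digits a b n t' t'' -> same_digits a b n t t''.
Proof. by move=> h h' i ilt; rewrite h// h'. Qed.

Lemma same_digits_le a b m n t t' : (m <= n)%N ->
  same_digits a b n t t' -> same_digits a b m t t'.
Proof. by move=> mn h i im; apply: h; exact: leq_trans mn. Qed.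

Lemma same_digitsD a b m n t t' : same_digits a b (m + n) t t' <->
  same_digits a b m t t' /\
  same_digits a b n (iter m (unbranch a b) t) (iter m (unbranch a b) t').
Proof.
split=> [h|[h1 h2] i ilt].
  split=> i ilt; first by apply: h; rewrite ltn_addr.
  by rewrite -!digitD h// ltn_add2l.
have [im|mi] := ltnP i m; first exact: h1.
by rewrite -(subnKC mi) !digitD h2// ltn_subLR.
Qed.

Section Params.
Context {a b : R} (a0 : 0 < a) (b0 : 0 < b) (ab1 : a + b < 1).

Ltac plra := move: a0 b0 ab1 => ? ? ?; lra.

Lemma ifs_domP t : ifs_dom a b t <-> (0 <= t <= a) \/ (1 - b <= t <= 1).
Proof. by rewrite /ifs_dom/= !in_itv/=. Qed.

Lemma ifs_dom_itv t : ifs_dom a b t -> 0 <= t <= 1.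
Proof. by move=> /ifs_domP[] /andP[? ?]; apply/andP; split; plra. Qed.

Lemma repeller_itv t : repeller a b t -> 0 <= t <= 1.
Proof. by move=> /(_ 0%N)/ifs_dom_itv. Qed.

Lemma repeller_unbranch t : repeller a b t -> repeller a b (unbranch a b t).
Proof. by move=> Kt n; rewrite -iterSr. Qed.

Lemma repeller_iter n t : repeller a b t -> repeller a b (iter n (unbranch a b) t).
Proof. by move=> Kt; elim: n => //= n; exact: repeller_unbranch. Qed.

Lemma branch_dom s t : 0 <= t <= 1 -> ifs_dom a b (branch a b s t).
Proof.
move=> /andP[t0 t1]; apply/ifs_domP.
have at0 : 0 <= a * t by apply: mulr_ge0 => //; exact: ltW.
have bt0 : 0 <= b * t by apply: mulr_ge0 => //; exact: ltW.
have at1 : a * t <= a by rewrite ler_piMr// ltW.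
have bt1 : b * t <= b by rewrite ler_piMr// ltW.
by case: s => /=; [left|right]; apply/andP; split; plra.
Qed.

Lemma branch_digit s t : 0 <= t <= 1 -> (branch a b s t <= a) = s.
Proof.
move=> /andP[t0 t1]; case: s => /=; first by rewrite ler_piMr// ltW.
have bt : 0 <= b * t by apply: mulr_ge0 => //; exact: ltW.
by apply/negbTE; rewrite -ltNge; plra.
Qed.

Lemma branchK s t : 0 <= t <= 1 -> unbranch a b (branch a b s t) = t.
Proof.
move=> t01; rewrite /unbranch branch_digit//; case: s => /=.
  by rewrite mulKf// gt_eqF.
by rewrite (_ : _ - _ + _ = b * t) ?mulKf ?gt_eqF//; ring.
Qed.

Lemma unbranchK t : branch a b (t <= a) (unbranch a b t) = t.
Proof.
rewrite /branch /unbranch; case: (t <= a) => /=; first by rewrite mulVKf// gt_eqF.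
by rewrite mulVKf ?gt_eqF//; ring.
Qed.

Lemma repeller_branch s t : repeller a b t -> repeller a b (branch a b s t).
Proof.
move=> Kt [|n]; first exact/branch_dom/repeller_itv.
by rewrite iterSr branchK//; exact: repeller_itv.
Qed.

Lemma dist_unbranch t t' : (t <= a) = (t' <= a) ->
  `|t - t'| = (if t <= a then a else b) * `|unbranch a b t - unbranch a b t'|.
Proof.
move=> tt'; rewrite -[in LHS](unbranchK t) -[in LHS](unbranchK t') -tt' /branch.
case: ifP => _; last rewrite opprD addrACA subrr add0r.
  by rewrite -mulrBr normrM (gtr0_norm a0).
by rewrite -mulrBr normrM (gtr0_norm b0).
Qed.

(** Points with the same digit are moved by the same affine branch, so each step expands their
    distance by exactly [a^-1] or [b^-1]. *)
Lemma dist_same_digits n t t' : same_digits a b n t t' ->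
  `|t - t'| = weight a b a b t n *
              `|iter n (unbranch a b) t - iter n (unbranch a b) t'|.
Proof.
elim: n t t' => [|n ih] t t'; first by rewrite /weight big_ord0 mul1r.
move=> /same_digitsS[h0 h]; rewrite (dist_unbranch _ _ h0) (ih _ _ h) weightS.
by rewrite !iterSr mulrA.
Qed.

Lemma same_digits_dist_le n t t' : repeller a b t -> repeller a b t' ->
  same_digits a b n t t' -> `|t - t'| <= weight a b a b t n.
Proof.
move=> Kt Kt' /dist_same_digits->; rewrite ler_piMr//.
  exact/ltW/weight_gt0.
move: (repeller_itv _ (repeller_iter n _ Kt)) => /andP[? ?].
move: (repeller_itv _ (repeller_iter n _ Kt')) => /andP[? ?].
by rewrite ler_norml; apply/andP; split; plra.
Qed.

(** Different first digits put the points on opposite sides of the gap between [a] and [1 - b]. *)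
Lemma gap_dist t t' : ifs_dom a b t -> ifs_dom a b t' -> (t <= a) != (t' <= a) ->
  1 - a - b <= `|t - t'|.
Proof.
wlog ta : t t' / t <= a => [hw Dt Dt' tt'|].
  have [ta|at_] := boolP (t <= a); first exact: hw.
  rewrite distrC; apply: hw => //; last by rewrite eq_sym.
  by apply: contraNT tt' => /negbTE ->; rewrite (negbTE at_).
rewrite ta => _ /ifs_domP[] /andP[t'0 t'a]; first by rewrite t'a.
by move=> _; rewrite ler_normr; apply/orP; right; plra.
Qed.

(** A first disagreement at a step [i < n] would leave the two images at least one gap apart; pulled
    back, this is a gap times the weight of [i] digits, which is no less than a gap times the weight
    of [n] digits. *)
Lemma dist_same_digits_lt n t t' : repeller a b t -> repeller a b t' ->
  `|t - t'| < (1 - a - b) * weight a b a b t n -> same_digits a b n t t'.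
Proof.
have g0 : 0 < 1 - a - b by plra.
elim: n t t' => [|n ih] t t' Kt Kt' lt_tt'; first by move=> i.
have w1 : weight a b a b t n.+1 <= 1.
  by apply: prodr_ile1 => i; case: ifP => _; rewrite ltW//=; plra.
have tt' : (t <= a) = (t' <= a).
  apply/eqP/negP => /negP /(gap_dist _ _ (Kt 0%N) (Kt' 0%N)).
  apply/negP; rewrite -ltNge (lt_le_trans lt_tt')//.
  by rewrite ler_piMr// ltW.
apply/same_digitsS; split=> //; apply: ih; try exact: repeller_unbranch.
move: lt_tt'; rewrite (dist_unbranch _ _ tt') weightS mulrCA /digit /=.
by case: (t <= a); rewrite ltr_pM2l.
Qed.

Lemma weight_le_expn t n :
  weight a b a b t n <= Num.max a b ^+ n.
Proof.
rewrite -[n in X in _ <= X]card_ord -prodr_const ler_prod// => i _.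
by case: ifP => _; rewrite ltW//= le_max lexx ?orbT.
Qed.

End Params.
End Expanding.

(** * The horseshoe as a product of two repellers *)

Section Measurability.
Context {R : realType}.

Lemma measurable_ifs_dom (a b : R) : measurable (ifs_dom a b).
Proof. exact: measurableU. Qed.

Lemma measurable_le_digit (a : R) : measurable [set t : R | t <= a].
Proof.
rewrite (_ : [set _ | _] = `]-oo, a]%classic); first exact: measurable_itv.
by apply/seteqP; split=> t /=; rewrite in_itv.
Qed.

Lemma measurable_unbranch (a b : R) : measurable_fun setT (unbranch a b).
Proof.
apply: measurable_fun_ifT => /=.
- by apply: measurable_fun_ler.
- exact: measurable_funM.
- apply: measurable_funM => //; apply: measurable_funD => //.
  exact: measurable_funB.
Qed.

Lemma measurable_branch (a b : R) s : measurable_fun setT (branch a b s).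
Proof.
case: s; rewrite /branch; first exact: measurable_funM.
by apply: measurable_funD => //; exact: measurable_funM.
Qed.

Lemma measurable_iter d (T : measurableType d) (f : T -> T) n :
  measurable_fun setT f -> measurable_fun setT (iter n f).
Proof.
move=> mf; elim: n => [|n ih]; first exact: measurable_id.
exact: (measurableT_comp mf ih).
Qed.

Lemma measurable_repeller (a b : R) : measurable (repeller a b).
Proof.
rewrite (_ : repeller a b =
  \bigcap_n (setT `&` iter n (unbranch a b) @^-1` ifs_dom a b)).
  apply: bigcapT_measurable => n.
  by apply: measurable_iter => //; [exact: measurable_unbranch|
     exact: measurable_ifs_dom].
apply/seteqP; split=> t /= h; first by move=> n _; split=> //; exact: h.
by move=> n; have [] := h n I.
Qed.

Lemma measurable_digit (a b : R) n : measurable [set t | digit a b t n].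
Proof.
rewrite -[X in measurable X]setTI.
exact: (measurable_iter _ _ _ n (measurable_unbranch a b) measurableT _
  (measurable_le_digit a)).
Qed.

End Measurability.

Section Horseshoe.
Context {R : realType} (e1 e2 : R).
Hypotheses (e10 : 0 < e1) (e20 : 0 < e2) (e12 : e1 + e2 < 1).

Let f := hs_map e1 e2.
Let L := horseshoe e1 e2.

(** The images of the two branches are the bottom and the top strip, so comparing [p.2] with [e2]
    tells which branch to invert. *)
Definition hs_inv (p : R * R) : R * R :=
  (branch e1 e2 (p.2 <= e2) p.1, unbranch e2 e1 p.2).

Let e21 : e2 + e1 < 1. Proof. by rewrite addrC. Qed.

Lemma hs_dom1P (p : R * R) :
  hs_dom1 e1 p <-> 0 <= p.1 <= e1 /\ 0 <= p.2 <= 1.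
Proof. by rewrite /hs_dom1/= !in_itv/=. Qed.

Lemma hs_dom2P (p : R * R) :
  hs_dom2 e2 p <-> 1 - e2 <= p.1 <= 1 /\ 0 <= p.2 <= 1.
Proof. by rewrite /hs_dom2/= !in_itv/=. Qed.

Lemma hs_domP (p : R * R) :
  hs_dom e1 e2 p <-> ifs_dom e1 e2 p.1 /\ 0 <= p.2 <= 1.
Proof.
rewrite ifs_domP; split.
  by move=> [/hs_dom1P[]|/hs_dom2P[]]; tauto.
by move=> [[] ? ?]; [left; apply/hs_dom1P|right; apply/hs_dom2P].
Qed.

Lemma hs_map_dom (p : R * R) : hs_dom e1 e2 p ->
  f p = (unbranch e1 e2 p.1, branch e2 e1 (p.1 <= e1) p.2).
Proof.
move=> /hs_domP[/ifs_domP Dp p2]; rewrite /f /hs_map /unbranch /branch.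
have -> : (p \in hs_dom1 e1) = (p.1 <= e1).
  apply/idP/idP => [|pe]; first by rewrite inE => /hs_dom1P[/andP[]].
  rewrite inE; apply/hs_dom1P; split=> //; rewrite pe andbT.
  by move: e12 e20 => ? ?; case: Dp => /andP[? ?] //; lra.
by case: ifP.
Qed.

Lemma iter_hs_map_dom n p : hs_iter_dom e1 e2 n p ->
  (iter n f p).1 = iter n (unbranch e1 e2) p.1.
Proof.
elim: n => // n ih h; rewrite !iterS hs_map_dom ?ih//=; last exact: h.
by move=> i ilt; apply: h; rewrite ltnS ltnW.
Qed.

(** Each step of [f] prepends one digit to the y-coordinate and [unbranch] deletes it, so [i]
    deletions take the y-coordinate back [i] steps in time. *)
Lemma iter_hs_map_unbranch n p : hs_iter_dom e1 e2 n p ->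
  forall i, (i <= n)%N ->
  iter i (unbranch e2 e1) (iter n f p).2 = (iter (n - i) f p).2.
Proof.
move=> hp; elim=> [|i ih] ilt; first by rewrite subn0.
rewrite iterS ih 1?ltnW// -(subnSK ilt) iterS hs_map_dom/=; last first.
  by apply: hp; rewrite ltn_subrL (leq_ltn_trans _ ilt).
have /hs_domP[] := hp (n - i.+1)%N ltac:(by rewrite ltn_subrL (leq_ltn_trans _ ilt)).
by move=> _ ?; rewrite branchK.
Qed.

Lemma horseshoe_map p : repeller e1 e2 p.1 -> repeller e2 e1 p.2 ->
  f p = (unbranch e1 e2 p.1, branch e2 e1 (p.1 <= e1) p.2).
Proof.
move=> Kp1 Kp2; apply: hs_map_dom; apply/hs_domP.
by split; [exact: (Kp1 0%N)|exact: repeller_itv Kp2].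
Qed.

Lemma horseshoe_mapK p : repeller e1 e2 p.1 -> repeller e2 e1 p.2 ->
  [/\ repeller e1 e2 (f p).1, repeller e2 e1 (f p).2 & hs_inv (f p) = p].
Proof.
move=> Kp1 Kp2; rewrite horseshoe_map//=; split.
- exact: repeller_unbranch.
- exact: repeller_branch.
have p2 := repeller_itv e20 e10 e21 _ Kp2.
rewrite /hs_inv/= branch_digit// branchK// unbranchK//.
by case: p {Kp1 Kp2 p2}.
Qed.

Lemma horseshoe_invK p : repeller e1 e2 p.1 -> repeller e2 e1 p.2 ->
  [/\ repeller e1 e2 (hs_inv p).1, repeller e2 e1 (hs_inv p).2 &
      f (hs_inv p) = p].
Proof.
move=> Kp1 Kp2.
have Kq1 : repeller e1 e2 (hs_inv p).1 by exact: repeller_branch.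
have Kq2 : repeller e2 e1 (hs_inv p).2 by exact: repeller_unbranch.
split=> //; have p1 := repeller_itv e10 e20 e12 _ Kp1.
rewrite horseshoe_map// /hs_inv/= branch_digit// branchK// unbranchK//.
by case: p {Kp1 Kp2 p1 Kq1 Kq2}.
Qed.

(** Inside the square, the forward iterates being defined constrains x only, and the backward
    iterates y only. *)
Lemma horseshoeE : L = repeller e1 e2 `*` repeller e2 e1.
Proof.
apply/seteqP; split=> [p [Sp Lp]|p [Kp1 Kp2]].
  split=> n /=.
    have [h _] := Lp n.+1; have := h n (leqnn _) => /hs_domP[+ _].
    rewrite iter_hs_map_dom// => i ilt.
    by apply: h; rewrite ltnS ltnW.
  (* One step more than [n]: after [n] deletions the y-coordinate is still that of [f q], hence in
     the image of a branch. *)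
  have [_ [q Dq <-]] := Lp n.+1.
  rewrite iter_hs_map_unbranch// subSnn [iter 1 _ _]/= hs_map_dom/=; last exact: (Dq 0%N).
  apply: branch_dom => //; have /hs_domP[_] := Dq 0%N isT; exact.
have fK n q : repeller e1 e2 q.1 -> repeller e2 e1 q.2 ->
    repeller e1 e2 (iter n f q).1 /\ repeller e2 e1 (iter n f q).2.
  move=> Kq1 Kq2; elim: n => // n [ih1 ih2].
  by rewrite iterS; have [? ? _] := horseshoe_mapK _ ih1 ih2.
have domK q n : repeller e1 e2 q.1 -> repeller e2 e1 q.2 -> hs_iter_dom e1 e2 n q.
  move=> Kq1 Kq2 i _; have [Ki1 Ki2] := fK i _ Kq1 Kq2.
  by apply/hs_domP; split; [exact: (Ki1 0%N)|exact: repeller_itv Ki2].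
split.
  by split; rewrite /= in_itv/=; [exact: repeller_itv Kp1|exact: repeller_itv Kp2].
move=> n; split; first exact: domK.
have [q [Kq1 Kq2 <-]] : exists q, [/\ repeller e1 e2 q.1, repeller e2 e1 q.2 &
    iter n f q = p].
  elim: n => [|n [q [Kq1 Kq2 qp]]]; first by exists p.
  have [? ? fq] := horseshoe_invK _ Kq1 Kq2.
  by exists (hs_inv q); split=> //; rewrite iterSr fq.
by exists q => //; exact: domK.
Qed.

Lemma horseshoe_mapP p : L p -> [/\ L (f p), hs_inv (f p) = p &
  f p = (unbranch e1 e2 p.1, branch e2 e1 (p.1 <= e1) p.2)].
Proof.
rewrite horseshoeE => -[Kp1 Kp2]; have [? ? ?] := horseshoe_mapK _ Kp1 Kp2.
by split=> //; exact: horseshoe_map.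
Qed.

Lemma horseshoe_invP p : L p -> L (hs_inv p) /\ f (hs_inv p) = p.
Proof.
by rewrite horseshoeE => -[Kp1 Kp2]; have [? ? ?] := horseshoe_invK _ Kp1 Kp2.
Qed.

Lemma horseshoe_iter n p : L p -> L (iter n f p).
Proof. by move=> Lp; elim: n => //= n /horseshoe_mapP[]. Qed.

Lemma iter_hs_map1 n p : L p -> (iter n f p).1 = iter n (unbranch e1 e2) p.1.
Proof.
move=> Lp; elim: n => //= n <-.
by have [_ _ ->] := horseshoe_mapP _ (horseshoe_iter n _ Lp).
Qed.

Lemma iter_hs_inv2 n p : (iter n hs_inv p).2 = iter n (unbranch e2 e1) p.2.
Proof. by elim: n => //= n <-. Qed.

Lemma measurable_horseshoe : measurable (L : set (plane R)).
Proof.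
by rewrite horseshoeE; apply: measurableX; exact: measurable_repeller.
Qed.

Lemma measurable_hs_map : measurable_fun setT (f : plane R -> plane R).
Proof.
rewrite /f /hs_map; apply: measurable_fun_ifT => /=.
- apply: (measurable_fun_bool true) => /=.
  rewrite setTI (_ : _ @^-1` _ = (hs_dom1 e1 : set (plane R))).
    exact: measurableX.
  by apply/seteqP; split=> p /=; [move=> /set_mem|move=> /mem_set].
- by apply/measurable_fun_pairP; split; apply: measurable_funM.
- apply/measurable_fun_pairP; split; rewrite /comp /=.
  + apply: measurable_funM => //; apply: measurable_funD => //.
    exact: measurable_funB.
  + by apply: measurable_funD => //; exact: measurable_funM.
Qed.

Lemma measurable_hs_inv : measurable_fun setT (hs_inv : plane R -> plane R).
Proof.
apply/measurable_fun_pairP; split; rewrite /comp /=; last first.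
  exact: (measurableT_comp (measurable_unbranch e2 e1)).
rewrite /branch; apply: measurable_fun_ifT => /=.
- exact: measurable_fun_ler.
- exact: measurable_funM.
- by apply: measurable_funD => //; exact: measurable_funM.
Qed.

End Horseshoe.

(** * The maximal ergodic inequality *)

Section BoundedIntegral.
Context {R : realType} {d : measure_display} {T : measurableType d}.
Context (mu : probability T R).
Implicit Types (h k : T -> R) (A : set T).

(** All functions fed to the ergodic inequality are bounded, so [mean] can be real-valued and
    linear, with boundedness as the only side condition. *)
Definition bounded_mfun h :=
  measurable_fun setT h /\ exists M, forall x, `|h x| <= M.

Definition mean h : R := Rintegral mu setT h.

Lemma bounded_mfun_integrable h : bounded_mfun h ->
  mu.-integrable setT (EFin \o h).
Proof.
move=> [mh [M hM]]; apply: measurable_bounded_integrable => //.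
  by rewrite fin_num_fun_lty// => ?; exact: fin_num_measure.
exists M; split; first exact: num_real.
by move=> M' MM' x _ /=; exact: le_trans (hM x) (ltW MM').
Qed.

Lemma bounded_mfun_cst c : bounded_mfun (fun=> c).
Proof. by split; [exact: measurable_cst|exists `|c|]. Qed.

Lemma bounded_mfun_indic A : measurable A -> bounded_mfun \1_A.
Proof.
move=> mA; split; first exact: measurable_indic.
by exists 1 => x; rewrite indicE normr_nat lern1 leq_b1.
Qed.

Lemma bounded_mfunD h k : bounded_mfun h -> bounded_mfun k ->
  bounded_mfun (fun x => h x + k x).
Proof.
move=> [mh [M hM]] [mk [N kN]]; split; first exact: measurable_funD.
by exists (M + N) => x; rewrite (le_trans (ler_normD _ _))// lerD.
Qed.

Lemma bounded_mfunM h k : bounded_mfun h -> bounded_mfun k ->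
  bounded_mfun (fun x => h x * k x).
Proof.
move=> [mh [M hM]] [mk [N kN]]; split; first exact: measurable_funM.
by exists (M * N) => x; rewrite normrM ler_pM.
Qed.

Lemma bounded_mfunZ c h : bounded_mfun h -> bounded_mfun (fun x => c * h x).
Proof. exact/bounded_mfunM/bounded_mfun_cst. Qed.

Lemma bounded_mfunB h k : bounded_mfun h -> bounded_mfun k ->
  bounded_mfun (fun x => h x - k x).
Proof.
move=> bh bk; rewrite (_ : (fun _ => _) = fun x => h x + -1 * k x).
  exact/bounded_mfunD/bounded_mfunZ.
by apply/funext => x; rewrite mulN1r.
Qed.

Lemma bounded_mfun_comp h (t : T -> T) : measurable_fun setT t ->
  bounded_mfun h -> bounded_mfun (h \o t).
Proof.
move=> mt [mh [M hM]]; split; first exact: measurableT_comp.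
by exists M => x; exact: hM.
Qed.

Lemma bounded_mfun_sum (I : Type) (s : seq I) (H : I -> T -> R) :
  (forall i, bounded_mfun (H i)) -> bounded_mfun (fun x => \sum_(i <- s) H i x).
Proof.
move=> bH; elim: s => [|i s ih].
  by under eq_fun do rewrite big_nil; exact: bounded_mfun_cst.
by under eq_fun do rewrite big_cons; exact: bounded_mfunD.
Qed.

Lemma bounded_mfun_max h k : bounded_mfun h -> bounded_mfun k ->
  bounded_mfun (fun x => Num.max (h x) (k x)).
Proof.
move=> [mh [M hM]] [mk [N kN]]; split; first exact: measurable_maxr.
exists (Num.max M N) => x; rewrite /Num.max.
by case: ifP => _; rewrite le_max ?hM ?kN ?orbT.
Qed.

Lemma meanD h k : bounded_mfun h -> bounded_mfun k ->
  mean (fun x => h x + k x) = mean h + mean k.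
Proof. by move=> bh bk; rewrite /mean RintegralD//; exact: bounded_mfun_integrable. Qed.

Lemma meanB h k : bounded_mfun h -> bounded_mfun k ->
  mean (fun x => h x - k x) = mean h - mean k.
Proof. by move=> bh bk; rewrite /mean RintegralB//; exact: bounded_mfun_integrable. Qed.

Lemma meanZ c h : bounded_mfun h -> mean (fun x => c * h x) = c * mean h.
Proof. by move=> bh; rewrite /mean RintegralZl//; exact: bounded_mfun_integrable. Qed.

Lemma mean_indic A : measurable A -> mean \1_A = fine (mu A).
Proof. by move=> mA; rewrite /mean /Rintegral integral_indic// setIT. Qed.

Lemma mean_le h k : bounded_mfun h -> bounded_mfun k ->
  (forall x, h x <= k x) -> mean h <= mean k.
Proof.
by move=> bh bk hk; apply: le_Rintegral => //; exact: bounded_mfun_integrable.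
Qed.

Lemma mean_ge0 h : (forall x, 0 <= h x) -> 0 <= mean h.
Proof. by move=> h0; exact: Rintegral_ge0. Qed.

Lemma mean_sum (I : Type) (s : seq I) (H : I -> T -> R) :
  (forall i, bounded_mfun (H i)) ->
  mean (fun x => \sum_(i <- s) H i x) = \sum_(i <- s) mean (H i).
Proof.
move=> bH; elim: s => [|i s ih].
  rewrite big_nil -[RHS](mul0r (mean (fun=> 0))) -meanZ; last exact: bounded_mfun_cst.
  by congr mean; apply/funext => x; rewrite big_nil mul0r.
rewrite big_cons -ih -meanD//; last exact: bounded_mfun_sum.
by congr mean; apply/funext => x; rewrite big_cons.
Qed.

Lemma mean_comp h (t : T -> T) : measurable_fun setT t ->
  (forall A, measurable A -> mu (t @^-1` A) = mu A) -> bounded_mfun h ->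
  mean (h \o t) = mean h.
Proof.
move=> mt invt bh; congr fine.
rewrite -[LHS](@integral_pushforward _ _ _ _ R t mt mu setT (EFin \o h))//.
- apply: eq_measure_integral => A mA _; exact: invt.
- by apply/measurable_EFinP; case: bh.
- by rewrite preimage_setT; apply: bounded_mfun_integrable; exact: bounded_mfun_comp.
Qed.

(* Garsia's proof: with [M n] the maximum of the first [n] Birkhoff sums of
   [h * \1_E], one has [h * \1_E >= M n - M n \o t] where [M n > 0]. *)
Lemma maximal_ergodic (t : T -> T) (E : set T) h :
  measurable_fun setT t -> (forall A, measurable A -> mu (t @^-1` A) = mu A) ->
  measurable E -> (forall x, E x -> E (t x)) -> bounded_mfun h ->
  (forall x, E x -> exists n, 0 < \sum_(i < n) h (iter i t x)) ->
  0 <= mean (fun x => h x * \1_E x).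
Proof.
move=> mt invt mE tE bh hE.
pose phi x := h x * \1_E x.
have bphi : bounded_mfun phi by apply: bounded_mfunM => //; exact: bounded_mfun_indic.
pose S n x := \sum_(i < n) phi (iter i t x).
pose M := fix M n x := if n is m.+1 then Num.max (S m.+1 x) (M m x) else 0.
have bS n : bounded_mfun (S n).
  by apply: bounded_mfun_sum => i; apply: bounded_mfun_comp => //;
    elim: (nat_of_ord i) => [|j ih]; [exact: measurable_id|exact: (measurableT_comp mt ih)].
have bM n : bounded_mfun (M n).
  by elim: n => [|n ih] /=; [exact: bounded_mfun_cst|exact: bounded_mfun_max].
have SM n m x : (m <= n)%N -> S m x <= M n x.
  elim: n => [|n ih]; first by rewrite leqn0 => /eqP->; rewrite /S big_ord0.
  rewrite leq_eqVlt ltnS => /orP[/eqP->|/ih mn] /=; rewrite le_max ?lexx//.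
  by rewrite mn orbT.
have M0 n x : 0 <= M n x by have := SM n 0%N x isT; rewrite /S big_ord0.
have SS m x : S m.+1 x = phi x + S m (t x).
  rewrite /S big_ord_recl; congr (_ + _).
  by apply: eq_bigr => i _; rewrite -iterSr.
have M_le n x : 0 < M n x -> M n x <= phi x + M n (t x).
  suff h' (m : nat) : (m <= n)%N -> 0 < M m x -> M m x <= phi x + M n (t x).
    exact: h'.
  elim: m => [|m ih] mn /=; first by rewrite ltxx.
  rewrite /Num.max; case: ifP => _; first exact/ih/ltnW.
  by move=> _; rewrite SS lerD2l SM// ltnW.
pose P n := [set x | 0 < M n x].
have mP n : measurable (P n).
  rewrite (_ : P n = M n @^-1` `]0, +oo[%classic); last first.
    by apply/seteqP; split => x; rewrite /P/= in_itv/= andbT.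
  by rewrite -[X in measurable X]setTI; apply: (bM n).1 => //; exact: measurable_itv.
have bphiP n : bounded_mfun (fun x => phi x * \1_(P n) x).
  by apply: bounded_mfunM => //; exact: bounded_mfun_indic.
(* The integrand is at least [M n - M n \o t] everywhere, and this difference has mean zero by
   invariance. *)
have phiP0 n : 0 <= mean (fun x => phi x * \1_(P n) x).
  have := mean_comp _ _ mt invt (bM n) => /eqP; rewrite eq_sym -subr_eq0 => /eqP <-.
  rewrite -meanB//; last exact: bounded_mfun_comp.
  apply: mean_le => //; first by apply: bounded_mfunB => //; exact: bounded_mfun_comp.
  move=> x /=; rewrite indicE; case: (boolP (x \in P n)) => [/set_mem Px|].
    by rewrite mulr1 lerBlDr M_le.
  move/negP => nPx; rewrite mulr0.
  have -> : M n x = 0.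
    by apply/eqP; rewrite eq_le M0 andbT leNgt; apply/negP => ?; apply/nPx/mem_set.
  by rewrite sub0r oppr_le0.
have iterE x i : E x -> E (iter i t x) by move=> Ex; elim: i => //= i; exact: tE.
(* On [E] the point lies in [P n] for all large [n], by the assumption on the sums; off [E] the
   function [phi] is zero. *)
have P_cvg x : (phi x * \1_(P n) x) @[n --> \oo] --> phi x.
  have [Ex|nEx] := pselect (E x); last first.
    have -> : phi x = 0 by rewrite /phi indicE memNset// mulr0.
    by under eq_fun do rewrite mul0r; exact: cvg_cst.
  have [n Sn] := hE x Ex.
  apply: (@cvg_near_cst _ _ _ _ \oo); exists n => // m /= nm.
  rewrite indicE mem_set ?mulr1// /P /=; apply: lt_le_trans (SM m n x nm).
  rewrite (lt_le_trans Sn)// le_eqVlt; apply/orP; left; apply/eqP.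
  by apply: eq_bigr => i _; rewrite /phi indicE mem_set ?mulr1//; exact: iterE.
have [_ [K phiK]] := bphi.
have cvg_mean : (\int[mu]_x (phi x * \1_(P n) x)%:E)%E @[n --> \oo] -->
    (\int[mu]_x (phi x)%:E)%E.
  apply: (dominated_cvg measurableT (g := cst K%:E)) => //.
  - by move=> n; apply/measurable_EFinP; case: (bphiP n).
  - by move=> x _; apply: cvg_EFin; [exact: nearW|exact: P_cvg].
  - by apply: (bounded_mfun_integrable (fun=> K)); exact: bounded_mfun_cst.
  - move=> n x _; rewrite lee_fin normrM (le_trans _ (phiK x))//.
    by rewrite ler_piMr// indicE normr_nat lern1 leq_b1.
rewrite /mean /Rintegral fine_ge0// -(cvg_lim _ cvg_mean)//.
apply: lime_ge; first by apply/cvg_ex; eexists; exact: cvg_mean.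
apply: nearW => n.
have := phiP0 n; rewrite /mean /Rintegral -lee_fin fineK//.
exact/integrable_fin_num/bounded_mfun_integrable/bphiP.
Qed.

End BoundedIntegral.

(** * Two-sided frequencies *)

Section Frequencies.
Context {R : realType}.
Implicit Types (c : nat -> nat) (q al be : R).

Definition freq c q := (c n)%:R / n%:R @[n --> \oo] --> q.

(* Unlike "limsup c n / n > al", these two conditions do not change when [c n]
   changes by a bounded amount, so that for orbit counts they define exactly
   invariant sets. *)
Definition exceeds c al := forall C : nat, exists n, C%:R < (c n)%:R - al * n%:R :> R.
Definition falls_below c be :=
  forall C : nat, exists n, C%:R < be * n%:R - (c n)%:R :> R.

Lemma freq_bounds c q :
  (forall e : R, 0 < e -> exists C : nat, forall n, (c n)%:R <= (q + e) * n%:R + C%:R) ->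
  (forall e : R, 0 < e -> exists C : nat, forall n, (q - e) * n%:R - C%:R <= (c n)%:R) ->
  freq c q.
Proof.
move=> up lo; apply/cvgrPdist_le => e e0.
have e20 : 0 < e / 2 by rewrite divr_gt0.
have [C hC] := up _ e20; have [C' hC'] := lo _ e20.
near=> n.
have n0 : 0 < n%:R :> R by rewrite ltr0n; near: n; exists 1%N.
have Cn : C%:R + C'%:R <= e / 2 * n%:R.
  rewrite mulrC -ler_pdivrMr//; near: n; exact: nbhs_infty_ger.
rewrite (_ : q - _ = (q * n%:R - (c n)%:R) / n%:R); last by field; rewrite gt_eqF.
rewrite normrM normfV (gtr0_norm n0) ler_pdivrMr//.
have := hC n; have := hC' n; have : 0 <= C%:R :> R by [].
have : 0 <= C'%:R :> R by [].
move=> *; rewrite ler_norml; apply/andP; split; lra.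
Unshelve. all: by end_near. Qed.

Lemma not_exceeds c al : ~ exceeds c al ->
  exists C : nat, forall n, (c n)%:R <= al * n%:R + C%:R.
Proof.
move=> /existsNP[C hC]; exists C => n; rewrite leNgt; apply/negP => h.
by apply: hC; exists n; lra.
Qed.

Lemma not_falls_below c be : ~ falls_below c be ->
  exists C : nat, forall n, be * n%:R - C%:R <= (c n)%:R.
Proof.
move=> /existsNP[C hC]; exists C => n; rewrite leNgt; apply/negP => h.
by apply: hC; exists n; lra.
Qed.

(** [q] is the supremum of the rationals that [c] exceeds. A rational below [q] lies under one that
    is exceeded, so neither count falls below it. A rational above [q] is not exceeded by [c]; nor
    is it by [c'], since [c] falls below a rational in between. *)
Lemma common_frequency c c' : (forall n, (c n <= n)%N) ->
  (forall al be : rat, be < al ->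
    [/\ ~ (exceeds c (ratr al) /\ falls_below c (ratr be)),
        ~ (exceeds c (ratr al) /\ falls_below c' (ratr be)) &
        ~ (exceeds c' (ratr al) /\ falls_below c (ratr be))]) ->
  exists q, [/\ 0 <= q <= 1, freq c q & freq c' q].
Proof.
move=> cn conf.
pose A : set R := [set x | exists2 al : rat, x = ratr al & exceeds c x].
(* Negative levels are exceeded for free; this makes the set nonempty and gives [0 <= q]. *)
have exceeds_neg al : al < 0 -> exceeds c al.
  move=> al0 C.
  have C0 : 0 <= C%:R / - al by rewrite divr_ge0// oppr_ge0 ltW.
  exists (Num.truncn (C%:R / - al)).+1.
  have /(_ (C%:R / - al)) := @truncnS_gt R.
  rewrite ltr_pdivrMr ?oppr_gt0// mulrN mulrC => h.
  by rewrite (lt_le_trans h)// lerDr.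
have A1 : ubound A 1.
  move=> _ [al -> h]; rewrite leNgt; apply/negP => al1.
  have [n] := h 0%N; apply/negP; rewrite -leNgt subr_le0.
  rewrite (@le_trans _ _ n%:R)// ?ler_nat//.
  by rewrite ler_peMl// ltW.
have A_neg (al : rat) : al < 0 -> A (ratr al).
  by move=> al0; exists al => //; apply: exceeds_neg; rewrite ltrq0.
have A0 : A !=set0 by exists (ratr (-1)); exact: A_neg.
have supA : has_sup A by split=> //; exists 1.
have q0 : 0 <= sup A.
  rewrite leNgt; apply/negP => /rat_in_itvoo[al].
  rewrite in_itv/= => /andP[+ al0]; apply/negP; rewrite -leNgt.
  by apply: ub_le_sup; [exists 1|apply: A_neg; rewrite -(@ltrq0 R)].
have q1 : sup A <= 1 by exact: ge_sup.
set q := sup A in q0 q1 *.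
have above (al : rat) : q < ratr al -> ~ exceeds c (ratr al).
  move=> qal h; move: qal; apply/negP; rewrite -leNgt.
  by apply: ub_le_sup; [exists 1|exists al].
have below (be : rat) : ratr be < q -> exists2 al : rat, be < al & exceeds c (ratr al).
  move=> beq; have e0 : 0 < q - ratr be by rewrite subr_gt0.
  have [_ [al -> h]] := sup_adherent e0 supA.
  by rewrite -/q subKr ltr_rat; exists al.
have falls (be : rat) : q < ratr be -> falls_below c (ratr be).
  move=> /rat_in_itvoo[ga]; rewrite in_itv/= => /andP[qga gabe].
  have [C hC] := not_exceeds _ _ (above _ qga) => D.
  have d0 : 0 < ratr be - ratr ga :> R by rewrite subr_gt0.
  exists (Num.truncn ((C%:R + D%:R) / (ratr be - ratr ga) : R)).+1.
  have := @truncnS_gt R ((C%:R + D%:R) / (ratr be - ratr ga)).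
  rewrite ltr_pdivrMr//; set n := _.+1 => h; have := hC n.
  lra.
have above' (al : rat) : q < ratr al -> ~ exceeds c' (ratr al).
  move=> /rat_in_itvoo[be]; rewrite in_itv/= => /andP[qbe]; rewrite ltr_rat => beal.
  by move=> h; have [_ _] := conf _ _ beal; apply; split=> //; exact: falls.
exists q; split; first by rewrite q0.
- apply: freq_bounds => e e0.
    have /rat_in_itvoo[al] : q < q + e by rewrite ltrDl.
    rewrite in_itv/= => /andP[qal ale].
    have [C hC] := not_exceeds _ _ (above _ qal); exists C => n.
    by rewrite (le_trans (hC n))// lerD2r ler_wpM2r// ltW.
  have /rat_in_itvoo[be] : q - e < q by rewrite ltrBlDr ltrDl.
  rewrite in_itv/= => /andP[ebe beq]; have [al beal h] := below _ beq.
  have [nc _ _] := conf _ _ beal.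
  have [C hC] := not_falls_below _ _ (fun h' => nc (conj h h')); exists C => n.
  by rewrite (le_trans _ (hC n))// lerD2r ler_wpM2r// ltW.
- apply: freq_bounds => e e0.
    have /rat_in_itvoo[al] : q < q + e by rewrite ltrDl.
    rewrite in_itv/= => /andP[qal ale].
    have [C hC] := not_exceeds _ _ (above' _ qal); exists C => n.
    by rewrite (le_trans (hC n))// lerD2r ler_wpM2r// ltW.
  have /rat_in_itvoo[be] : q - e < q by rewrite ltrBlDr ltrDl.
  rewrite in_itv/= => /andP[ebe beq]; have [al beal h] := below _ beq.
  have [_ nc _] := conf _ _ beal.
  have [C hC] := not_falls_below _ _ (fun h' => nc (conj h h')); exists C => n.
  by rewrite (le_trans _ (hC n))// lerD2r ler_wpM2r// ltW.
Qed.

End Frequencies.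

(** * Frequencies for an invertible measure-preserving map *)

Section FullMeasure.
Context {R : realType} {d : measure_display} {T : measurableType d}.
Context (mu : probability T R) (L : set T) (mL : measurable L) (muL : mu L = 1%E).

Lemma full_measure_setI A : measurable A -> mu (A `&` L) = mu A.
Proof.
move=> mA; have muLC : mu (~` L) = 0%E by rewrite probability_setC// muL subee.
rewrite [RHS](measureDI mu mA mL) [X in (X + _)%E](_ : _ = 0%E) ?add0e//.
apply: (subset_measure0 _ _ _ muLC); first exact: measurableD.
  exact: measurableC.
by move=> x [].
Qed.

(** This disposes of the junk values of the horseshoe map and of its inverse: preimages need only be
    computed on [L]. *)
Lemma eq_full_measure A B : measurable A -> measurable B ->
  A `&` L = B `&` L -> mu A = mu B.
Proof.
by move=> mA mB AB; rewrite -full_measure_setI// AB full_measure_setI.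
Qed.

End FullMeasure.

Lemma negligible_countable_bigcup {R : realType} {d : measure_display}
    {T : measurableType d} (mu : {measure set T -> \bar R}) (I : countType)
    (F : I -> set T) :
  (forall i, mu.-negligible (F i)) -> mu.-negligible (\bigcup_i F i).
Proof.
move=> F0; pose G k := if unpickle k is Some i then F i else set0.
apply: (@negligibleS _ _ _ _ (\bigcup_k G k)).
  by move=> x [i _ Fix]; exists (pickle i) => //; rewrite /G pickleK.
apply: negligible_bigcup => k; rewrite /G.
by case: unpickle => [i|]; [exact: F0|exact: negligible_set0].
Qed.

Section Recurrence.
Context {R : realType} {d : measure_display} {T : measurableType d}.
Context (mu : probability T R).
Implicit Types (t : T -> T) (h : T -> R) (L A : set T).

Definition visits t A x n : nat := \sum_(i < n) (iter i t x \in A).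

Definition divergent L t h : set T :=
  [set x | L x /\ forall C : nat, exists n, C%:R < \sum_(i < n) h (iter i t x)].

Lemma birkhoff_sumS t h x n : \sum_(i < n.+1) h (iter i t x) =
  h x + \sum_(i < n) h (iter i t (t x)).
Proof.
rewrite big_ord_recl; congr (_ + _).
by apply: eq_bigr => i _; rewrite -iterSr.
Qed.

(** Dropping the first term changes the sums by at most [|h x|], which a higher threshold absorbs;
    here the choice of unboundedness over mere positivity pays off. *)
Lemma divergent_fwd L t h x : (forall x, L x -> L (t x)) ->
  divergent L t h x -> divergent L t h (t x).
Proof.
move=> tL [Lx hx]; split; first exact: tL.
move=> C; have [[|n]] := hx (C + Num.truncn `|h x|).+1%N.
  by rewrite big_ord0 ltNge ler0n.
rewrite birkhoff_sumS -natr1 natrD => hn; exists n.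
have := @truncnS_gt R `|h x|; have := ler_norm (h x); rewrite -natr1.
move: hn; lra.
Qed.

Lemma divergent_bwd L t h x : L x ->
  divergent L t h (t x) -> divergent L t h x.
Proof.
move=> Lx [_ hx]; split=> // C.
have [n hn] := hx (C + Num.truncn `|h x|).+1%N.
exists n.+1; move: hn; rewrite birkhoff_sumS -natr1 natrD.
have := @truncnS_gt R `|h x|; have := ler_norm (- h x); rewrite normrN -natr1.
lra.
Qed.

Lemma measurable_divergent L t h : measurable L -> measurable_fun setT t ->
  measurable_fun setT h -> measurable (divergent L t h).
Proof.
move=> mL mt mh.
have mS n : measurable_fun setT (fun x => \sum_(i < n) h (iter i t x)).
  apply: measurable_sum => i; apply: measurableT_comp => //.
  elim: (nat_of_ord i) => [|j ih]; first exact: measurable_id.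
  exact: (measurableT_comp mt ih).
rewrite (_ : divergent L t h = L `&` \bigcap_(C : nat) \bigcup_n
    (setT `&` (fun x => \sum_(i < n) h (iter i t x)) @^-1` `]C%:R, +oo[%classic)).
  apply: measurableI => //; apply: bigcapT_measurable => C.
  by apply: bigcupT_measurable => n; apply: mS => //; exact: measurable_itv.
apply/seteqP; split=> x [Lx hx]; split=> // C.
  by move=> _; have [n hn] := hx C; exists n => //; split=> //=; rewrite in_itv/= andbT.
by have [n _ [_ /=]] := hx C I; rewrite in_itv/= andbT; exists n.
Qed.

Context {L : set T} {f g : T -> T} {A A' : set T}.
Hypotheses (mL : measurable L) (mf : measurable_fun setT f)
  (mg : measurable_fun setT g) (mA : measurable A) (mA' : measurable A').
Hypotheses (fL : forall x, L x -> L (f x)) (gL : forall x, L x -> L (g x)).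
Hypotheses (fgK : forall x, L x -> f (g x) = x) (gfK : forall x, L x -> g (f x) = x).
Hypotheses (muL : mu L = 1%E)
  (muf : forall B, measurable B -> mu (f @^-1` B) = mu B)
  (mug : forall B, measurable B -> mu (g @^-1` B) = mu B).
(** On [L] the set [A'] is the image of [A]. For the horseshoe these are the bottom and the left
    strip, so visits of [g] to [A'] read the past digits as visits of [f] to [A] read the future
    ones. *)
Hypothesis AA' : forall x, L x -> (f x \in A') = (x \in A).

Let invariant E := [/\ measurable E, E `<=` L, (forall x, E x -> E (f x)) &
  (forall x, E x -> E (g x))].

Let divergent_inv t h : t = f \/ t = g -> measurable_fun setT h ->
  invariant (divergent L t h).
Proof.
move=> tfg mh; split.
- by apply: measurable_divergent => //; case: tfg => ->.
- by move=> x [].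
- move=> x Ex; case: tfg Ex => -> Ex; first exact: divergent_fwd.
  by have [Lx _] := Ex; apply: divergent_bwd; [exact: fL|rewrite gfK].
- move=> x Ex; case: tfg Ex => -> Ex; last exact: divergent_fwd.
  by have [Lx _] := Ex; apply: divergent_bwd; [exact: gL|rewrite fgK].
Qed.

Let invariantI E F : invariant E -> invariant F -> invariant (E `&` F).
Proof.
move=> [mE EL fE gE] [mF FL fF gF]; split.
- exact: measurableI.
- by move=> x [/EL].
- by move=> x [/fE ? /fF].
- by move=> x [/gE ? /gF].
Qed.

Let mu_AA' E : invariant E -> mu (A' `&` E) = mu (A `&` E).
Proof.
move=> [mE EL fE gE]; rewrite -muf; last exact: measurableI.
apply: (eq_full_measure mu L) => //.
- by rewrite -[X in measurable X]setTI; apply: mf => //; exact: measurableI.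
- exact: measurableI.
apply/seteqP; split=> [x /= [[fA' Efx] Lx]|x /= [[Ax Ex] Lx]]; split=> //.
  split; last by rewrite -(gfK _ Lx); exact: gE.
  by apply/set_mem; rewrite -AA'//; exact/mem_set.
by split; [apply/set_mem; rewrite AA'//; exact/mem_set|exact: fE].
Qed.

(** The maximal inequality for [\1_B - al] on [E]. It holds in both directions of time, since [f]
    and [g] both preserve [mu] and [E]. *)
Let lower t B al : t = f \/ t = g -> measurable B ->
  forall E, invariant E -> E `<=` divergent L t (fun x => \1_B x - al) ->
  al * fine (mu E) <= fine (mu (B `&` E)).
Proof.
move=> tfg mB E [mE EL fE gE] Ediv.
have b1 X : measurable X -> bounded_mfun (\1_X : T -> R) by exact: bounded_mfun_indic.
have := @maximal_ergodic _ _ _ mu t E (fun x => \1_B x - al).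
have -> : (fun x => (\1_B x - al) * \1_E x) =
    (fun x => \1_(B `&` E) x - al * \1_E x).
  by apply/funext => x; rewrite mulrBl indicI.
rewrite meanB; [|exact/b1/measurableI|exact/bounded_mfunZ/b1].
rewrite meanZ ?mean_indic//; [|exact: measurableI|exact: b1].
rewrite subr_ge0; apply=> //.
- by case: tfg => ->.
- by case: tfg => ->.
- by case: tfg => ->.
- by apply: bounded_mfunB; [exact: b1|exact: bounded_mfun_cst].
- by move=> x /Ediv[_ /(_ 0%N)].
Qed.

Let upper t B be : t = f \/ t = g -> measurable B ->
  forall E, invariant E -> E `<=` divergent L t (fun x => be - \1_B x) ->
  fine (mu (B `&` E)) <= be * fine (mu E).
Proof.
move=> tfg mB E [mE EL fE gE] Ediv.
have b1 X : measurable X -> bounded_mfun (\1_X : T -> R) by exact: bounded_mfun_indic.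
have := @maximal_ergodic _ _ _ mu t E (fun x => be - \1_B x).
have -> : (fun x => (be - \1_B x) * \1_E x) =
    (fun x => be * \1_E x - \1_(B `&` E) x).
  by apply/funext => x; rewrite mulrBl indicI.
rewrite meanB; [|exact/bounded_mfunZ/b1|exact/b1/measurableI].
rewrite meanZ ?mean_indic//; [|exact: measurableI|exact: b1].
rewrite subr_ge0; apply=> //.
- by case: tfg => ->.
- by case: tfg => ->.
- by case: tfg => ->.
- by apply: bounded_mfunB; [exact: bounded_mfun_cst|exact: b1].
- by move=> x /Ediv[_ /(_ 0%N)].
Qed.

(** On the invariant set [E] one bound gives [mu (B & E) >= al mu E], the other
    [mu (B' & E) <= be mu E]. Both left sides equal the measure of [A] in [E], whichever direction
    of time is used, so [E] is null. This is what ties the past frequency to the future one. *)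
Let conflict t t' B B' (al be : R) : t = f /\ B = A \/ t = g /\ B = A' ->
  t' = f /\ B' = A \/ t' = g /\ B' = A' -> be < al ->
  mu (divergent L t (fun x => \1_B x - al) `&`
      divergent L t' (fun x => be - \1_B' x)) = 0%E.
Proof.
move=> tB tB' beal; set E := _ `&` _.
have tfg : t = f \/ t = g by tauto.
have tfg' : t' = f \/ t' = g by tauto.
have mB : measurable B by case: tB => -[_ ->].
have mB' : measurable B' by case: tB' => -[_ ->].
have mh (X : set T) (c : R) : measurable X -> measurable_fun setT (fun x => \1_X x - c).
  by move=> mX; apply: measurable_funB => //; exact: measurable_indic.
have mh' (X : set T) (c : R) : measurable X -> measurable_fun setT (fun x => c - \1_X x).
  by move=> mX; apply: measurable_funB => //; exact: measurable_indic.
have iE : invariant E.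
  by apply: invariantI; apply: divergent_inv => //; [exact: mh|exact: mh'].
have muB : mu (B `&` E) = mu (A `&` E).
  by case: tB => -[_ ->] //; exact: mu_AA'.
have muB' : mu (B' `&` E) = mu (A `&` E).
  by case: tB' => -[_ ->] //; exact: mu_AA'.
have := lower _ _ al tfg mB _ iE (@subIsetl _ _ _).
have := upper _ _ be tfg' mB' _ iE (@subIsetr _ _ _).
rewrite muB muB' => h1 h2.
have mE : measurable E by case: iE.
have : (al - be) * fine (mu E) <= 0.
  by rewrite mulrBl subr_le0 (le_trans h2).
rewrite pmulr_rle0 ?subr_gt0// => h3.
apply/eqP; rewrite eq_le measure_ge0 andbT -[mu E]fineK ?lee_fin//.
exact: fin_num_measure.
Qed.

Lemma sum_indic_visits t B x n :
  \sum_(i < n) \1_B (iter i t x) = (visits t B x n)%:R :> R.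
Proof. by rewrite natr_sum; apply: eq_bigr => i _; rewrite indicE. Qed.

Lemma exceeds_divergent t B x al : L x -> exceeds (visits t B x) al ->
  divergent L t (fun x => \1_B x - al) x.
Proof.
move=> Lx h; split=> // C; have [n hn] := h C; exists n.
by rewrite sumrB sum_indic_visits sumr_const card_ord -[al *+ n]mulr_natr.
Qed.

Lemma falls_below_divergent t B x be : L x -> falls_below (visits t B x) be ->
  divergent L t (fun x => be - \1_B x) x.
Proof.
move=> Lx h; split=> // C; have [n hn] := h C; exists n.
by rewrite sumrB sum_indic_visits sumr_const card_ord -[be *+ n]mulr_natr.
Qed.

(** Off the countable union, over rational [be < al], of three null conflict sets, the hypotheses of
    [common_frequency] hold. *)
Theorem two_sided_frequency : mu.-negligible [set x | L x /\
  ~ exists q : R, [/\ 0 <= q <= 1, freq (visits f A x) q &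
                     freq (visits g A' x) q]].
Proof.
pose C t t' B B' (ab : rat * rat) : set T :=
  divergent L t (fun x => \1_B x - ratr ab.1) `&`
  divergent L t' (fun x => ratr ab.2 - \1_B' x).
pose NN (ab : rat * rat) : set T := if ab.2 < ab.1 then
  C f f A A ab `|` C f g A A' ab `|` C g f A' A ab else set0.
have mC t t' B B' ab : measurable_fun setT t -> measurable_fun setT t' ->
    measurable B -> measurable B' -> measurable (C t t' B B' ab).
  move=> mt mt' mB mB'; apply: measurableI; apply: measurable_divergent => //;
    by apply: measurable_funB => //; exact: measurable_indic.
apply: (@negligibleS _ _ _ _ (\bigcup_ab NN ab)); last first.
  apply: negligible_countable_bigcup => ab; rewrite /NN.
  case: ifP => [ab12|_]; last exact: negligible_set0.
  have ab12' : ratr ab.2 < ratr ab.1 :> R by rewrite ltr_rat.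
  by apply: negligibleU; [apply: negligibleU|]; apply/negligibleP;
    try exact: mC; apply: conflict => //; tauto.
move=> x [Lx]; apply: contra_notP => nNx; apply: common_frequency.
  move=> n; rewrite /visits -[leqRHS]card_ord -sum1_card leq_sum// => i _.
  exact: leq_b1.
move=> al be beal; have nN (P : Prop) : NN (al, be) x -> P.
  by move=> Nx; exfalso; apply: nNx; exists (al, be).
by split=> -[h1 h2]; apply: nN; rewrite /NN /= beal;
  [left; left|left; right|right]; split;
  [exact: exceeds_divergent|exact: falls_below_divergent|
   exact: exceeds_divergent|exact: falls_below_divergent|
   exact: exceeds_divergent|exact: falls_below_divergent].
Qed.

End Recurrence.

(** * Measure of cylinders *)

Lemma measure_bigsetU_le {R : realType} {d : measure_display}
    {T : measurableType d} (mu : {measure set T -> \bar R})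
    (I : Type) (s : seq I) (P : pred I) (F : I -> set T) :
  (forall i, P i -> measurable (F i)) ->
  (mu (\big[setU/set0]_(i <- s | P i) F i) <= \sum_(i <- s | P i) mu (F i))%E.
Proof.
move=> mF; suff [] : measurable (\big[setU/set0]_(i <- s | P i) F i) /\
  (mu (\big[setU/set0]_(i <- s | P i) F i) <= \sum_(i <- s | P i) mu (F i))%E by [].
apply: (big_ind2 (fun A x => measurable A /\ (mu A <= x)%E)).
- by rewrite measure0.
- move=> A x B y [mA Ax] [mB By]; split; first exact: measurableU.
  by rewrite (le_trans (measureU2 _ mA mB))// leeD.
- by move=> i Pi; split=> //; exact: mF.
Qed.

Section Fibers.
Context {R : realType} {d : measure_display} {T : measurableType d}.
Context (mu : probability T R).

Definition small_fiber {W : finType} (X : T -> W) (om : W -> R) : set T :=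
  [set x | (mu (X @^-1` [set X x]) < (om (X x))%:E)%E].

Lemma small_fiberE (W : finType) (X : T -> W) (om : W -> R) :
  small_fiber X om =
  \big[setU/set0]_(w | (mu (X @^-1` [set w]) < (om w)%:E)%E) X @^-1` [set w].
Proof.
rewrite -bigcup_seq_cond; apply/seteqP; split=> [x Bx|x [w /= /andP[_ Bw] Xw]].
  by exists (X x) => //=; rewrite mem_index_enum.
by rewrite /small_fiber/= Xw.
Qed.

Lemma small_fiber_measurable (W : finType) (X : T -> W) (om : W -> R) :
  (forall w, measurable (X @^-1` [set w])) -> measurable (small_fiber X om).
Proof.
by move=> mX; rewrite small_fiberE; apply: bigsetU_measurable => w _; exact: mX.
Qed.

(** The set is the union of those fibres whose measure is less than [om w], so its measure is at
    most the sum of [om], however many words there are. *)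
Lemma small_fiber_le (W : finType) (X : T -> W) (om : W -> R) (th : R) :
  (forall w, measurable (X @^-1` [set w])) -> (forall w, 0 <= om w) ->
  \sum_w om w <= th -> (mu (small_fiber X om) <= th%:E)%E.
Proof.
move=> mX om0 om1; rewrite small_fiberE.
apply: (le_trans (measure_bigsetU_le mu _ _ _ _ (fun w _ => mX w))).
apply: (@le_trans _ _ (\sum_w om w)%:E); last by rewrite lee_fin.
rewrite -sumEFin [leLHS]big_mkcond/=; apply: lee_sum => w _.
by case: ifPn => [/ltW//|_]; rewrite lee_fin.
Qed.

Lemma sum_inv_sqr_le (n : nat) : \sum_(i < n) (i.+1%:R ^- 2 : R) <= 2.
Proof.
case: n => [|n]; first by rewrite big_ord0.
(* The induction carries a sharper bound, because [1 / (n + 2)^2] is at most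
   [1 / (n + 1) - 1 / (n + 2)]. *)
suff : \sum_(i < n.+1) (i.+1%:R ^- 2 : R) <= 2 - n.+1%:R^-1.
  by move=> /le_trans; apply; rewrite gerBl invr_ge0.
elim: n => [|n ih]; first by rewrite big_ord1 invr1 expr1n invr1; lra.
rewrite big_ord_recr/= (le_trans (lerD ih (lexx _)))//.
have : 0 < n.+1%:R :> R by rewrite ltr0n.
rewrite -[n.+2%:R]natr1; set x : R := n.+1%:R => x0.
have x1 : 0 < x + 1 by rewrite addr_gt0.
rewrite -subr_ge0 (_ : _ - _ = (x * (x + 1) ^+ 2)^-1); last first.
  by field; rewrite !gt_eqF.
by rewrite invr_ge0 mulr_ge0 ?exprn_ge0 ?ltW.
Qed.

(** For fixed [(N, m)] the words violating the bound have total measure at most [(M + 1)^-4]. There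
    are [(M + 1)^2] pairs, so the bad event at level [M] has measure at most [(M + 1)^-2], and
    Borel-Cantelli applies. Uniformity in [N, m <= M] allows window lengths that depend on the
    point. *)
Lemma negligible_frequently_small (W : nat -> nat -> finType)
    (X : forall N m, T -> W N m) (om : forall N m, W N m -> R) :
  (forall N m w, measurable (X N m @^-1` [set w])) ->
  (forall N m w, 0 <= om N m w) -> (forall N m, \sum_w om N m w <= 1) ->
  mu.-negligible [set x | ~ exists M0, forall M, (M0 <= M)%N ->
    forall N m, (N <= M)%N -> (m <= M)%N ->
    ((om N m (X N m x) / M.+1%:R ^+ 4)%:E <= mu (X N m @^-1` [set X N m x]))%E].
Proof.
move=> mX om0 om1.
pose B M N m := small_fiber (X N m) (fun w => om N m w / M.+1%:R ^+ 4).
pose BB M := \big[setU/set0]_(p : 'I_M.+1 * 'I_M.+1) B M p.1 p.2.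
have mB M N m : measurable (B M N m) by exact: small_fiber_measurable.
have mBB M : measurable (BB M) by apply: bigsetU_measurable => p _; exact: mB.
have muB M N m : (mu (B M N m) <= (M.+1%:R ^- 4)%:E)%E.
  apply: small_fiber_le => [w||]; first exact: mX.
    by move=> w; rewrite divr_ge0.
  by rewrite -mulr_suml ler_piMl.
have muBB M : (mu (BB M) <= (M.+1%:R ^- 2)%:E)%E.
  apply: (@le_trans _ _ (\sum_(p : 'I_M.+1 * 'I_M.+1) mu (B M p.1 p.2))%E).
    by apply: measure_bigsetU_le => p _; exact: mB.
  apply: (@le_trans _ _ (\sum_(p : 'I_M.+1 * 'I_M.+1) (M.+1%:R ^- 4)%:E)%E).
    by apply: lee_sum => p _; exact: muB.
  rewrite sumEFin lee_fin sumr_const card_prod card_ord -[_ *+ (_ * _)%N]mulr_natr natrM.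
  rewrite le_eqVlt; apply/orP; left; apply/eqP; field.
  by rewrite addrC natr1 pnatr_eq0.
have BC0 : mu (lim_sup_set BB) = 0%E.
  apply: lim_sup_set_cvg0 => //; apply: (@le_lt_trans _ _ 2%:E); last exact: ltry.
  apply: lime_le; first exact: is_cvg_nneseries.
  apply: nearW => n; rewrite big_mkord.
  apply: (@le_trans _ _ (\sum_(i < n) (i.+1%:R ^- 2)%:E)%E).
    by apply: lee_sum => i _; exact: muBB.
  by rewrite sumEFin lee_fin sum_inv_sqr_le.
exists (lim_sup_set BB); split=> //.
  by apply: bigcapT_measurable => k; exact: bigcup_measurable.
move=> x /= nx M0 _; apply: contra_notP nx => nB; exists M0 => M M0M N m NM mM.
rewrite leNgt; apply/negP => small; apply: nB; exists M => //=.
rewrite /BB -bigcup_seq; exists (inord N, inord m) => /=.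
  by rewrite mem_index_enum.
by rewrite !inordK.
Qed.

End Fibers.

Section Cylinders.
Context {R : realType} (e1 e2 : R).
Implicit Types (p q : plane R).

Definition cylinder N m p : set (plane R) :=
  [set q | same_digits e1 e2 N p.1 q.1 /\ same_digits e2 e1 m p.2 q.2].

Let word N m p : {ffun 'I_N -> bool} * {ffun 'I_m -> bool} :=
  ([ffun i : 'I_N => digit e1 e2 p.1 i], [ffun i : 'I_m => digit e2 e1 p.2 i]).

Let word_cylinder N m p : word N m @^-1` [set word N m p] = cylinder N m p.
Proof.
apply/seteqP; split=> q /=.
  move=> [/ffunP h1 /ffunP h2]; split=> i ilt.
    by have := h1 (Ordinal ilt); rewrite !ffunE.
  by have := h2 (Ordinal ilt); rewrite !ffunE.
by move=> [h1 h2]; congr pair; apply/ffunP => i; rewrite !ffunE ?h1 ?h2.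
Qed.

Lemma measurable_same_digits (a b : R) N t : measurable [set t' | same_digits a b N t t'].
Proof.
rewrite (_ : [set _ | _] = \bigcap_i
    (if (i < N)%N then [set t' | digit a b t' i = digit a b t i] else setT)).
  apply: bigcapT_measurable => i; case: ifP => // _.
  case: (digit a b t i) => /=; first exact: measurable_digit.
  rewrite (_ : [set _ | _] = ~` [set t' | digit a b t' i]); last first.
    by apply/seteqP; split=> t' /=; case: digit.
  by apply: measurableC; exact: measurable_digit.
apply/seteqP; split=> t' /= h i; first by move=> _; case: ifP => //= /h.
by move=> iN; have := h i I; rewrite iN.
Qed.

Lemma measurable_cylinder N m p : measurable (cylinder N m p).
Proof.
rewrite (_ : cylinder N m p = [set t | same_digits e1 e2 N p.1 t] `*`
   [set t | same_digits e2 e1 m p.2 t]).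
  by apply: measurableX; exact: measurable_same_digits.
by apply/seteqP; split=> q.
Qed.

Lemma sum_bernoulli_weights N (t : R) :
  \sum_(w : {ffun 'I_N -> bool}) \prod_i (if w i then t else 1 - t) = 1.
Proof.
rewrite -(bigA_distr_bigA (fun (_ : 'I_N) (s : bool) => if s then t else 1 - t)).
by rewrite big1// => i _; rewrite big_bool/= addrC subrK.
Qed.

(** The reference law is Bernoulli(t) on pairs of words, whose weights sum to one; [nu] is
    arbitrary. *)
Lemma coding_lower_bound (nu : probability (plane R) R) (t : R) : 0 < t < 1 ->
  nu.-negligible [set p | ~ exists M0, forall M, (M0 <= M)%N ->
    forall N m, (N <= M)%N -> (m <= M)%N ->
    ((weight e1 e2 t (1 - t) p.1 N * weight e2 e1 t (1 - t) p.2 m /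
       M.+1%:R ^+ 4)%:E <= nu (cylinder N m p))%E].
Proof.
move=> /andP[t0 t1].
pose om N m (w : {ffun 'I_N -> bool} * {ffun 'I_m -> bool}) : R :=
  (\prod_i (if w.1 i then t else 1 - t)) * (\prod_i (if w.2 i then t else 1 - t)).
have t'0 : 0 <= 1 - t by rewrite subr_ge0 ltW.
have om0 N m w : 0 <= om N m w.
  by apply: mulr_ge0; apply: prodr_ge0 => i _; case: ifP => _ //; exact: ltW.
have om1 N m : \sum_w om N m w <= 1.
  rewrite -(pair_bigA _ (fun u v => om N m (u, v)))/=.
  rewrite (eq_bigr (fun u : {ffun 'I_N -> bool} =>
    \prod_i (if u i then t else 1 - t))) ?sum_bernoulli_weights// => u _.
  by rewrite /om/= -mulr_sumr sum_bernoulli_weights mulr1.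
have mword N m w : measurable (word N m @^-1` [set w]).
  have [[p <-]|nw] := pselect (exists p, word N m p = w).
    by rewrite word_cylinder; exact: measurable_cylinder.
  rewrite (_ : _ @^-1` _ = set0)//; apply/seteqP; split=> // p pw.
  by apply: nw; exists p.
have := negligible_frequently_small nu _ word om mword om0 om1.
apply: negligibleS => p /=; apply: contra_not => -[M0 hM0]; exists M0 => M MM0 N m NM mM.
rewrite -word_cylinder; have := hM0 M MM0 N m NM mM.
have wE a b x k : \prod_(i < k) (if [ffun i : 'I_k => digit a b x i] i
    then t else 1 - t) = weight a b t (1 - t) x k.
  by apply: eq_bigr => i _; rewrite ffunE.
by rewrite /om/= !wE.
Qed.

End Cylinders.

(** * Exponential rates along windows of linear length *)

Section Rates.
Context {R : realType}.
Implicit Types (x l q u v : R) (k N : nat -> nat).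

Definition rate k l := (k n)%:R / n%:R @[n --> \oo] --> l.

Lemma near_nat_gt0 : \forall n \near \oo, 0 < n%:R :> R.
Proof. by exists 1%N => // n /=; rewrite ltr0n. Qed.

Lemma cvg_div_nat (c : R) : c / n%:R @[n --> \oo] --> 0.
Proof.
rewrite -[X in _ --> X](mulr0 c); apply: cvgM; first exact: cvg_cst.
by apply/gtr0_cvgV0; [exact: near_nat_gt0|exact: cvgr_idn].
Qed.

Lemma rate_id : rate id 1.
Proof.
apply: (@cvg_near_cst _ _ _ _ \oo); near=> n.
by rewrite divff// gt_eqF//; near: n; exact: near_nat_gt0.
Unshelve. all: by end_near. Qed.

Lemma rateD k k' l l' : rate k l -> rate k' l' -> rate (fun n => k n + k' n)%N (l + l').
Proof.
move=> kl kl'; rewrite /rate; under eq_fun do rewrite natrD mulrDl.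
exact: cvgD.
Qed.

Lemma rate_pred : rate predn 1.
Proof.
have h : (n%:R / n%:R - 1 / n%:R : R) @[n --> \oo] --> (1 - 0 : R).
  by apply: cvgB; [exact: rate_id|exact: cvg_div_nat].
rewrite subr0 in h; apply: cvg_trans h; apply: near_eq_cvg; near=> n.
have n0 : (0 < n)%N by near: n; exists 1%N.
by rewrite /= -mulrBl -subn1 natrB.
Unshelve. all: by end_near. Qed.

Lemma rate_truncn x : 0 <= x -> rate (fun n => Num.truncn (x * n%:R)) x.
Proof.
move=> x0; apply: (@squeeze_cvgr _ _ _ _ (fun n => x - 1 / n%:R) (fun=> x)).
- near=> n; have n0 : 0 < n%:R :> R by near: n; exact: near_nat_gt0.
  have xn0 : 0 <= x * n%:R by rewrite mulr_ge0.
  have /andP[h1 h2] := truncn_itv xn0.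
  rewrite ler_pdivrMr// h1 andbT ler_pdivlMr// mulrBl divfK ?gt_eqF//.
  by move: h2; rewrite -natr1; lra.
- have h : (x - 1 / n%:R) @[n --> \oo] --> x - 0.
    by apply: cvgB; [exact: cvg_cst|exact: cvg_div_nat].
  by rewrite subr0 in h.
- exact: cvg_cst.
Unshelve. all: by end_near. Qed.

Lemma rate_cvgny k l : 0 < l -> rate k l -> k n @[n --> \oo] --> \oo.
Proof.
move=> l0 kl; apply/(@cvgrnyP R)/cvgryPge => M.
have l20 : 0 < l / 2 by rewrite divr_gt0.
near=> n.
have n0 : 0 < n%:R :> R by near: n; exact: near_nat_gt0.
have h1 : l / 2 <= (k n)%:R / n%:R.
  near: n; move/cvgr_ge: kl; apply; rewrite ltr_pdivrMr// ltr_pMr// ltr1n//.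
have h2 : M / (l / 2) <= n%:R by near: n; exact: nbhs_infty_ger.
rewrite ler_pdivrMr// in h2; rewrite ler_pdivlMr// in h1.
by rewrite (le_trans h2)// mulrC.
Unshelve. all: by end_near. Qed.

Lemma rate_freq (c : nat -> nat) q k l : 0 < l -> freq c q -> rate k l ->
  rate (fun n => c (k n)) (q * l).
Proof.
move=> l0 cq kl; have kn := rate_cvgny _ _ l0 kl.
apply: (@cvg_trans _ (((c (k n))%:R / (k n)%:R * ((k n)%:R / n%:R) : R) @[n --> \oo])).
  apply: near_eq_cvg; near=> n; rewrite mulrA divfK// pnatr_eq0 -lt0n.
  near: n; move/cvgnyPgt : kn; exact.
by apply: cvgM => //; exact: (cvg_comp _ _ kn cq).
Unshelve. all: by end_near. Qed.

Lemma ln_weight a b u v t n : 0 < u -> 0 < v ->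
  ln (weight a b u v t n) =
  (ones a b t n)%:R * ln u + (n%:R - (ones a b t n)%:R) * ln v.
Proof.
move=> u0 v0; rewrite weightE lnM ?posrE ?exprn_gt0// !lnXn// -natrB ?ones_le//.
by rewrite -[ln u *+ _]mulr_natl -[ln v *+ _]mulr_natl.
Qed.

Lemma cvg_ln_weight a b t q u v N l : 0 < u -> 0 < v -> 0 < l ->
  freq (ones a b t) q -> rate N l ->
  ln (weight a b u v t (N n)) / n%:R @[n --> \oo] -->
    l * (q * ln u + (1 - q) * ln v).
Proof.
move=> u0 v0 l0 tq Nl; have oq := rate_freq _ _ _ _ l0 tq Nl.
rewrite (_ : l * _ = q * l * ln u + (l - q * l) * ln v); last by ring.
apply: (@cvg_trans _ (((ones a b t (N n))%:R / n%:R * ln u +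
    ((N n)%:R / n%:R - (ones a b t (N n))%:R / n%:R) * ln v : R) @[n --> \oo])).
  apply: near_eq_cvg; near=> n; rewrite ln_weight//; ring.
apply: cvgD; apply: cvgM => //; try exact: cvg_cst.
exact: cvgB.
Unshelve. all: by end_near. Qed.

Lemma weightD a b u v t n m : weight a b u v t (n + m) =
  weight a b u v t n * weight a b u v (iter n (unbranch a b) t) m.
Proof.
rewrite /weight big_split_ord; congr (_ * _).
by apply: eq_bigr => i _; rewrite digitD.
Qed.

(** A frequency only controls prefixes, so the window from [N n] to [N n + k n] is treated as a
    difference of two prefixes. *)
Lemma cvg_ln_weight_window a b t q u v N k l : 0 < u -> 0 < v -> 0 < l ->
  freq (ones a b t) q -> rate N 1 -> rate k l ->
  ln (weight a b u v (iter (N n) (unbranch a b) t) (k n)) / n%:R @[n --> \oo] -->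
    l * (q * ln u + (1 - q) * ln v).
Proof.
move=> u0 v0 l0 tq N1 kl.
rewrite (_ : l * _ = (1 + l) * (q * ln u + (1 - q) * ln v) -
  1 * (q * ln u + (1 - q) * ln v)); last by ring.
apply: (@cvg_trans _ ((ln (weight a b u v t (N n + k n)) / n%:R -
  ln (weight a b u v t (N n)) / n%:R : R) @[n --> \oo])).
  apply: near_eq_cvg; near=> n; rewrite weightD lnM ?posrE ?weight_gt0//; ring.
apply: cvgB; last exact: cvg_ln_weight.
by apply: cvg_ln_weight => //; [rewrite addr_gt0|exact: rateD].
Unshelve. all: by end_near. Qed.

(** From [ln y < y] at [y = e' (N n + 1)] one gets [ln (N n + 1) <= e' (N n + 1) - ln e']. The
    choice of [e'] makes the first term at most half of [e n] once [N n + 1 <= (l + 1) n]. *)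
Lemma cvg_ln_succ_div N l : 0 < l -> rate N l ->
  ln (N n).+1%:R / n%:R @[n --> \oo] --> (0 : R).
Proof.
move=> l0 Nl; apply/cvgr0Pnorm_le => e e0.
have N1l : rate (fun n => N n + 1)%N (l + 0).
  by apply: rateD => //; exact: cvg_div_nat.
pose e' := e / (l + 1) / 2; have l1 : 0 < l + 1 by rewrite addr_gt0.
have e'0 : 0 < e' by rewrite !divr_gt0.
near=> n; have n0 : 0 < n%:R :> R by near: n; exact: near_nat_gt0.
rewrite ger0_norm ?divr_ge0 ?ln_ge0 ?ler1n//.
have Nn0 : 0 < (N n).+1%:R :> R by rewrite ltr0n.
have h1 : (N n).+1%:R / n%:R <= l + 1.
  rewrite -addn1; near: n; move/cvgr_le : N1l; apply; rewrite addr0; lra.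
have h2 : - ln e' / n%:R <= e / 2.
  near: n; move/cvgr_le : (cvg_div_nat (- ln e')); apply; exact: divr_gt0.
have h3 : ln (N n).+1%:R <= e' * (N n).+1%:R - ln e'.
  rewrite lerBrDl -lnM ?posrE// ltW// ln_sublinear//; exact: mulr_gt0.
have h4 : (e' * (N n).+1%:R - ln e') / n%:R =
  e' * ((N n).+1%:R / n%:R) + - ln e' / n%:R by ring.
apply: (@le_trans _ _ ((e' * (N n).+1%:R - ln e') / n%:R)).
  by rewrite ler_pM2r ?invr_gt0.
rewrite h4 (le_trans (lerD (ler_wpM2l (ltW e'0) h1) h2))//.
rewrite /e' le_eqVlt; apply/orP; left; apply/eqP; field.
by rewrite gt_eqF.
Unshelve. all: by end_near. Qed.

End Rates.

(** * Comparison of neutralized balls with cylinders *)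

Section Euclid.
Context {R : realType}.
Implicit Types p q : R * R.

Lemma euclid_ge1 p q : `|p.1 - q.1| <= euclid p q.
Proof. by rewrite -sqrtr_sqr ler_wsqrtr// lerDl sqr_ge0. Qed.

Lemma euclid_ge2 p q : `|p.2 - q.2| <= euclid p q.
Proof. by rewrite -sqrtr_sqr ler_wsqrtr// lerDr sqr_ge0. Qed.

Lemma euclid_lt p q (e : R) : 0 < e ->
  `|p.1 - q.1| <= e / 2 -> `|p.2 - q.2| <= e / 2 -> euclid p q < e.
Proof.
move=> e0 h1 h2; rewrite /euclid -[ltRHS]gtr0_norm// -sqrtr_sqr ltr_sqrt ?exprn_gt0//.
have e20 : 0 <= e / 2 by rewrite divr_ge0// ltW.
have sqle (x : R) : `|x| <= e / 2 -> x ^+ 2 <= (e / 2) ^+ 2.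
  by move=> xe; rewrite -[x ^+ 2]real_normK ?num_real// lerXn2r ?nnegrE.
rewrite (le_lt_trans (lerD (sqle _ h1) (sqle _ h2)))//.
by rewrite -subr_gt0 (_ : _ - _ = e ^+ 2 / 2) ?divr_gt0 ?exprn_gt0//; field.
Qed.

Lemma measurable_euclid (c : plane R) :
  measurable_fun setT (fun p : plane R => euclid p c).
Proof.
apply: measurableT_comp.
  exact: (continuous_measurable_fun (@sqrt_continuous R)).
by apply: measurable_funD; apply: measurable_funX; apply: measurable_funB.
Qed.

End Euclid.

Section NeutralBalls.
Context {R : realType} (e1 e2 : R).
Hypotheses (e10 : 0 < e1) (e20 : 0 < e2) (e12 : e1 + e2 < 1).

Let f : plane R -> plane R := hs_map e1 e2.
Let L : set (plane R) := horseshoe e1 e2.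
Let e21 : e2 + e1 < 1. Proof. by rewrite addrC. Qed.

Let L1 p : L p -> repeller e1 e2 p.1.
Proof. by rewrite /L horseshoeE => // -[]. Qed.

Let L2 p : L p -> repeller e2 e1 p.2.
Proof. by rewrite /L horseshoeE => // -[]. Qed.

Lemma measurable_neutral_ball (r : R) (p : plane R) n :
  measurable (neutral_ball f L (@euclid R) r p n).
Proof.
rewrite (_ : neutral_ball _ _ _ _ _ _ = L `&` \bigcap_i
  (if (i < n)%N then [set q : plane R |
     euclid (iter i f q) (iter i f p) < expR (- (n%:R * r))] else setT)).
  apply: measurableI; first exact: measurable_horseshoe.
  apply: bigcapT_measurable => i; case: ifP => // _.
  have me : measurable_fun setT (fun q => euclid (iter i f q) (iter i f p)).
    apply: (measurableT_comp (measurable_euclid _)).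
    by apply: measurable_iter; exact: measurable_hs_map.
  rewrite (_ : [set _ | _] = setT `&` (fun q => euclid (iter i f q) (iter i f p))
    @^-1` `]-oo, expR (- (n%:R * r))[%classic); first exact: me.
  by rewrite setTI; apply/seteqP; split=> q /=; rewrite in_itv.
apply/seteqP; split=> q /= -[Lq h]; split=> // i.
  by case: ifP => // + _; exact: h.
by move=> ilt; have := h i I; rewrite ilt.
Qed.

Lemma weight_le1 (a b t : R) n : 0 < a -> 0 < b -> a + b < 1 ->
  weight a b a b t n <= 1.
Proof.
move=> a0 b0 ab; apply: prodr_ile1 => i.
by case: ifP => _; rewrite ltW//=; lra.
Qed.

(** Horizontal distances grow up to time [n], when [k] common digits are still left, so [wk] bounds
    them all. Vertical distances shrink, since both points follow the same branch; the worst time is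
    0, where [m] common past digits bound them by [wm]. *)
Lemma cylinder_sub_ball (p q : plane R) n k m (e : R) : L p -> L q -> 0 < e ->
  weight e1 e2 e1 e2 (iter n (unbranch e1 e2) p.1) k <= e / 2 ->
  weight e2 e1 e2 e1 p.2 m <= e / 2 ->
  cylinder e1 e2 (n + k) m p q ->
  forall i, (i < n)%N -> euclid (iter i f q) (iter i f p) < e.
Proof.
move=> Lp Lq e0 wk wm [/= same1 same2] i ilt.
apply: euclid_lt => //.
  rewrite !iter_hs_map1// distrC (le_trans _ wk)//.
  rewrite -(subnKC (ltnW ilt)) -addnA in same1.
  have [_ /same_digitsD[same_in same_k]] := (same_digitsD _ _ _ _ _ _).1 same1.
  rewrite (dist_same_digits e10 e20 _ _ _ same_in) -!iterD subnK// 1?ltnW//.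
  rewrite -!iterD subnK// 1?ltnW// in same_k.
  apply: (@le_trans _ _ `|iter n (unbranch e1 e2) p.1 - iter n (unbranch e1 e2) q.1|).
    by rewrite ler_piMl// weight_le1.
  by apply: same_digits_dist_le => //; apply: repeller_iter => //; exact: L1.
have le2 j : (j <= n)%N -> `|(iter j f q).2 - (iter j f p).2| <= `|q.2 - p.2|.
  elim: j => // j ih jn; apply: le_trans (ih (ltnW jn)); rewrite !iterS.
  have Lj := horseshoe_iter _ _ e10 e20 e12 j _ Lp.
  have Lj' := horseshoe_iter _ _ e10 e20 e12 j _ Lq.
  have [_ _ E] := horseshoe_mapP _ _ e10 e20 e12 _ Lj.
  have [_ _ E'] := horseshoe_mapP _ _ e10 e20 e12 _ Lj'.
  rewrite -/f in E E'; rewrite {}E {}E' /= !iter_hs_map1//.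
  have := same1 j (leq_trans jn (leq_addr _ _)); rewrite /digit => ->.
  rewrite /branch; case: ifP => _.
    by rewrite -mulrBr normrM (gtr0_norm e20) ler_piMl//; move: e10 e12 => ? ?; lra.
  rewrite opprD addrACA subrr add0r -mulrBr normrM (gtr0_norm e10) ler_piMl//.
  by move: e20 e12 => ? ?; lra.
rewrite (le_trans (le2 i (ltnW ilt)))// distrC (le_trans _ wm)//.
by apply: same_digits_dist_le => //; exact: L2.
Qed.

(** Closeness below the gap forces equal digits at each time before [n]; closeness at time [n]
    yields [k] further digits of x, and closeness at time 0 yields [m] digits of y. *)
Lemma ball_sub_cylinder (p q : plane R) n k m (e : R) : L p -> L q ->
  e <= (1 - e1 - e2) * weight e1 e2 e1 e2 (iter n (unbranch e1 e2) p.1) k ->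
  e <= (1 - e1 - e2) * weight e2 e1 e2 e1 p.2 m ->
  (forall i, (i < n.+1)%N -> euclid (iter i f q) (iter i f p) < e) ->
  cylinder e1 e2 (n + k) m p q.
Proof.
move=> Lp Lq ek em close.
have g0 : 0 < 1 - e1 - e2 by move: e12 => ?; lra.
have close1 i : (i < n.+1)%N ->
    `|iter i (unbranch e1 e2) p.1 - iter i (unbranch e1 e2) q.1| < e.
  move=> ilt; rewrite -!iter_hs_map1// distrC.
  exact: le_lt_trans (euclid_ge1 _ _) (close i ilt).
split; last first.
  apply: dist_same_digits_lt => //; try exact: L2.
  rewrite addrAC distrC; apply: lt_le_trans em.
  exact: le_lt_trans (euclid_ge2 _ _) (close 0%N isT).
apply/same_digitsD; split; last first.
  apply: dist_same_digits_lt => //; try by apply: repeller_iter; exact: L1.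
  by apply: lt_le_trans ek; exact: close1.
move=> i ilt; apply/eqP/negP => /negP.
move/gap_dist => /(_ _ e10 e20 e12 (L1 _ Lp i) (L1 _ Lq i)); apply/negP; rewrite -ltNge.
apply: lt_le_trans (close1 i (ltnW ilt)) (le_trans ek _).
by rewrite ler_piMr ?weight_le1// ltW.
Qed.

End NeutralBalls.

(** * Local neutralized entropy *)

Section LimSup.
Context {R : realType}.
Implicit Types (u : (\bar R)^nat) (c : \bar R).
Local Open Scope ereal_scope.

Lemma limn_esup_le_near u c : (\forall n \near \oo, u n <= c) -> limn_esup u <= c.
Proof.
move=> uc; apply: (@le_trans _ _ (ereal_sup (u @` [set n | u n <= c]))).
  by apply: ereal_inf_lbound; exists [set n | u n <= c].
by apply: ge_ereal_sup => _ [n /= h <-].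
Qed.

Lemma limn_esup_ge_near u c : (\forall n \near \oo, c <= u n) -> c <= limn_esup u.
Proof.
move=> uc; apply: le_ereal_inf_tmp => _ [V VF <-].
have : \forall n \near \oo, V n /\ c <= u n by exact: (filterI (F := \oo)).
move=> /(filter_ex (F := \oo))[n [Vn cn]].
by rewrite (le_trans cn)// ereal_sup_ubound//; exists n.
Qed.

Lemma neg_lne_le (n : nat) (z : \bar R) (W : R) : (0 < n)%N -> (0 < W)%R ->
  W%:E <= z -> z <= 1 -> - (n%:R^-1)%:E * lne z <= (- ln W / n%:R)%:E.
Proof.
move=> n0 W0; case: z => [z| _|]; [|by rewrite leye_eq|by rewrite leeNy_eq].
rewrite !lee_fin => Wz z1; have z0 := lt_le_trans W0 Wz.
rewrite lne_EFin// -EFinN -EFinM lee_fin mulNr mulrC -mulNr ler_pM2r ?invr_gt0 ?ltr0n//.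
by rewrite lerN2 ler_ln.
Qed.

Lemma neg_lne_ge (n : nat) (z : \bar R) (W : R) : (0 < n)%N -> (0 < W)%R ->
  0 <= z -> z <= W%:E -> (- ln W / n%:R)%:E <= - (n%:R^-1)%:E * lne z.
Proof.
move=> n0 W0; case: z => [z| _|]; [|by rewrite leye_eq|by rewrite leeNy_eq].
(* A null ball contributes [+oo], and the bound is trivial. *)
rewrite !lee_fin => z0 zW; have [z00|z_gt0] := eqVneq z 0%R.
  by rewrite z00 le0_lneNy// mulNe gt0_muleNy ?lte_fin ?invr_gt0 ?ltr0n// leey.
have {z_gt0}z_gt0 : (0 < z)%R by rewrite lt_neqAle eq_sym z_gt0.
rewrite lne_EFin// -EFinN -EFinM lee_fin [leRHS]mulNr [(_^-1 * _)%R]mulrC -mulNr.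
rewrite ler_pM2r ?invr_gt0 ?ltr0n//.
by rewrite lerN2 ler_ln.
Qed.

End LimSup.

Section LocalEntropy.
Context {R : realType}.

(** The mean of [- ln] of the weight per digit at frequency [q]. For [(e1, e2)] and [(e2, e1)] it is
    the unstable and the stable exponent, for [(t, 1 - t)] the cross entropy of [q] against [t], and
    for [(q, 1 - q)] the binary entropy. *)
Definition lyap (u v q : R) : R := - (q * ln u + (1 - q) * ln v).

Lemma lyap_gt0 u v q : 0 < u < 1 -> 0 < v < 1 -> 0 <= q <= 1 -> 0 < lyap u v q.
Proof.
move=> /ln_lt0 u0 /ln_lt0 v0 /andP[q0 q1]; rewrite /lyap oppr_gt0.
have [->|qn0] := eqVneq q 0; first by rewrite mul0r add0r subr0 mul1r.
have q_gt0 : 0 < q by rewrite lt_neqAle eq_sym qn0.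
rewrite (@lt_le_trans _ _ (0 + (1 - q) * ln v))// ?ltrD2r ?pmulr_rlt0//.
by rewrite add0r mulr_ge0_le0 ?subr_ge0// ltW.
Qed.

Variables (e1 e2 : R).
Hypotheses (e10 : 0 < e1) (e20 : 0 < e2) (e12 : e1 + e2 < 1).

Let f : plane R -> plane R := hs_map e1 e2.
Let L : set (plane R) := horseshoe e1 e2.

Let e1_01 : 0 < e1 < 1. Proof. by rewrite e10/=; move: e10 e20 e12 => *; lra. Qed.
Let e2_01 : 0 < e2 < 1. Proof. by rewrite e20/=; move: e10 e20 e12 => *; lra. Qed.

(** The function F of the overview. *)
Definition neutral_rate (r q : R) : R :=
  lyap q (1 - q) q * (1 + r / lyap e1 e2 q + r / lyap e2 e1 q).

Definition has_freq (p : plane R) (q : R) :=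
  freq (ones e1 e2 p.1) q /\ freq (ones e2 e1 p.2) q.

Definition code_bound (nu : probability (plane R) R) (t : R) (p : plane R) :=
  exists M0, forall M, (M0 <= M)%N -> forall N m, (N <= M)%N -> (m <= M)%N ->
    ((weight e1 e2 t (1 - t) p.1 N * weight e2 e1 t (1 - t) p.2 m /
       M.+1%:R ^+ 4)%:E <= nu (cylinder e1 e2 N m p))%E.

Lemma near_weight_le (s r : R) (w : nat -> R) : (forall n, 0 < w n) ->
  ln (w n) / n%:R @[n --> \oo] --> - s -> r < s ->
  \forall n \near \oo, w n <= expR (- (n%:R * r)) / 2 :> R.
Proof.
move=> w0 ws rs.
have h : (ln (w n) / n%:R + ln 2 / n%:R) @[n --> \oo] --> - s + 0.
  by apply: cvgD => //; exact: cvg_div_nat.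
near=> n; have n0 : 0 < n%:R :> R by near: n; exact: near_nat_gt0.
have : ln (w n) / n%:R + ln 2 / n%:R <= - r.
  by near: n; move/cvgr_le : h; apply; rewrite addr0 ltrN2.
rewrite -mulrDl ler_pdivrMr// => h'.
rewrite ler_pdivlMr// -[w n]lnK ?posrE// -[2 in leLHS]lnK ?posrE//.
by rewrite -expRD ler_expR (le_trans h')// mulNr mulrC.
Unshelve. all: by end_near. Qed.

Lemma near_weight_ge (g s r : R) (w : nat -> R) : 0 < g -> (forall n, 0 < w n) ->
  ln (w n) / n%:R @[n --> \oo] --> - s -> s < r ->
  \forall n \near \oo, expR (- (n%:R * r)) <= g * w n :> R.
Proof.
move=> g0 w0 ws rs.
have h : (ln (w n) / n%:R + ln g / n%:R) @[n --> \oo] --> - s + 0.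
  by apply: cvgD => //; exact: cvg_div_nat.
near=> n; have n0 : 0 < n%:R :> R by near: n; exact: near_nat_gt0.
have : - r <= ln (w n) / n%:R + ln g / n%:R.
  by near: n; move/cvgr_ge : h; apply; rewrite addr0 ltrN2.
rewrite -mulrDl ler_pdivlMr// => h'.
rewrite -[w n]lnK ?posrE// -[g]lnK ?posrE// -expRD ler_expR addrC.
by rewrite (le_trans _ h')// mulNr mulrC.
Unshelve. all: by end_near. Qed.

(** Since [x] and [x'] exceed the critical ratios, [x n] further future digits and [x' n] past
    digits make the cylinder thinner than half the radius. It lies in the ball, and its Bernoulli(t)
    weight bounds the measure of the ball from below. *)
Lemma local_entropy_le (nu : probability (plane R) R) (r t q x x' : R) (p : plane R) :
  nu L = 1%E -> 0 < r -> 0 < t < 1 -> 0 <= q <= 1 -> L p -> has_freq p q ->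
  code_bound nu t p -> r / lyap e1 e2 q < x -> r / lyap e2 e1 q < x' ->
  (local_neutral_entropy f L (@euclid R) r nu p <=
   ((1 + x + x') * lyap t (1 - t) q)%:E)%E.
Proof.
move=> nuL r0 /andP[t0 t1] q01 Lp [fq1 fq2] [M0 hM0] xr xr'.
have lu0 := lyap_gt0 _ _ _ e1_01 e2_01 q01.
have ls0 := lyap_gt0 _ _ _ e2_01 e1_01 q01.
have x0 : 0 < x by rewrite (lt_trans _ xr)// divr_gt0.
have x'0 : 0 < x' by rewrite (lt_trans _ xr')// divr_gt0.
have t'0 : 0 < 1 - t by rewrite subr_gt0.
pose k n := Num.truncn (x * n%:R); pose m n := Num.truncn (x' * n%:R).
have kx : rate k x by apply: rate_truncn; exact: ltW.
have mx : rate m x' by apply: rate_truncn; exact: ltW.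
apply/lee_addgt0Pr => ka ka0; rewrite -EFinD.
pose wk n := weight e1 e2 e1 e2 (iter n (unbranch e1 e2) p.1) (k n).
pose wm n := weight e2 e1 e2 e1 p.2 (m n).
have near_wk : \forall n \near \oo, wk n <= expR (- (n%:R * r)) / 2.
  apply: (near_weight_le (x * lyap e1 e2 q)).
  - by move=> n; exact: weight_gt0.
  - rewrite /lyap mulrN opprK.
    exact: (cvg_ln_weight_window _ _ _ _ _ _ _ _ _ e10 e20 x0 fq1 rate_id kx).
  - by rewrite -ltr_pdivrMr.
have near_wm : \forall n \near \oo, wm n <= expR (- (n%:R * r)) / 2.
  apply: (near_weight_le (x' * lyap e2 e1 q)).
  - by move=> n; exact: weight_gt0.
  - rewrite /lyap mulrN opprK.
    exact: (cvg_ln_weight _ _ _ _ _ _ _ _ e20 e10 x'0 fq2 mx).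
  - by rewrite -ltr_pdivrMr.
(* A common bound of both window lengths. It grows linearly, so the factor [(M n + 1)^4] is lost at
   exponential scale. *)
pose M n := (n + k n + m n)%N.
pose w1 n := weight e1 e2 t (1 - t) p.1 (n + k n).
pose w2 n := weight e2 e1 t (1 - t) p.2 (m n).
have w10 n : 0 < w1 n by exact: weight_gt0.
have w20 n : 0 < w2 n by exact: weight_gt0.
have Mrate : rate M (1 + x + x').
  by apply: rateD => //; apply: rateD => //; exact: rate_id.
have cvgW : (- (ln (w1 n) / n%:R + ln (w2 n) / n%:R) + 4 * (ln (M n).+1%:R / n%:R))
    @[n --> \oo] --> - ((1 + x) * - lyap t (1 - t) q + x' * - lyap t (1 - t) q) + 4 * 0.
  apply: cvgD; [apply: cvgN; apply: cvgD|apply: cvgM].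
  - rewrite /lyap opprK; apply: cvg_ln_weight => //; first by rewrite addr_gt0.
    by apply: rateD => //; exact: rate_id.
  - by rewrite /lyap opprK; exact: cvg_ln_weight.
  - exact: cvg_cst.
  - by apply: cvg_ln_succ_div Mrate; rewrite !addr_gt0.
apply: limn_esup_le_near; near=> n.
have n0 : (0 < n)%N by near: n; exists 1%N.
have W0 : 0 < w1 n * w2 n / (M n).+1%:R ^+ 4 by rewrite !mulr_gt0 ?invr_gt0 ?exprn_gt0.
have mball := measurable_neutral_ball _ _ e10 e20 e12 r p n.
have mcyl := measurable_cylinder e1 e2 (n + k n) (m n) p.
have mL := measurable_horseshoe _ _ e10 e20 e12.
apply: (@le_trans _ _ (- ln (w1 n * w2 n / (M n).+1%:R ^+ 4) / n%:R)%:E).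
  apply: neg_lne_le => //; last exact: probability_le1.
  apply: (@le_trans _ _ (nu (cylinder e1 e2 (n + k n) (m n) p))).
    apply: hM0; [|exact: leq_addr|exact: leq_addl].
    rewrite (@leq_trans n)// /M -?addnA ?leq_addr//; near: n; exact: nbhs_infty_ge.
  rewrite -(full_measure_setI nu L)//; apply: le_measure; rewrite ?inE//.
    exact: measurableI.
  move=> y [cy Ly]; split=> //.
  apply: (cylinder_sub_ball _ _ e10 e20 e12 _ _ _ (k n) (m n)) => //.
  - exact: expR_gt0.
  - by near: n; exact: near_wk.
  - by near: n; exact: near_wm.
rewrite lee_fin lnM ?posrE ?mulr_gt0 ?invr_gt0 ?exprn_gt0//.
rewrite lnV ?posrE ?exprn_gt0// lnXn// lnM ?posrE//.
rewrite (_ : _ / _ = - (ln (w1 n) / n%:R + ln (w2 n) / n%:R) +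
  4 * (ln (M n).+1%:R / n%:R)); last by ring.
near: n; move/cvgr_le : cvgW; apply.
by rewrite -subr_gt0 (_ : _ - _ = ka)//; ring.
Unshelve. all: by end_near. Qed.

(** With [x] and [x'] below the critical ratios the cylinder is wider than the radius even after
    multiplication by the gap, so it contains the ball. *)
Lemma local_entropy_ge (mu : probability (plane R) R) (r q x x' : R) (p : plane R) :
  mu L = 1%E -> 0 < r -> 0 < q < 1 -> L p -> has_freq p q ->
  (forall N m, (mu (cylinder e1 e2 N m p) <=
     (weight e1 e2 q (1 - q) p.1 N * weight e2 e1 q (1 - q) p.2 m)%:E)%E) ->
  0 < x < r / lyap e1 e2 q -> 0 < x' < r / lyap e2 e1 q ->
  (((1 + x + x') * lyap q (1 - q) q)%:E <=
   local_neutral_entropy f L (@euclid R) r mu p)%E.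
Proof.
move=> muL r0 /andP[q0 q1] Lp [fq1 fq2] hcyl /andP[x0 xr] /andP[x'0 xr'].
have q01 : 0 <= q <= 1 by rewrite !ltW.
have lu0 := lyap_gt0 _ _ _ e1_01 e2_01 q01.
have ls0 := lyap_gt0 _ _ _ e2_01 e1_01 q01.
have q'0 : 0 < 1 - q by rewrite subr_gt0.
have g0 : 0 < 1 - e1 - e2 by move: e12 => ?; lra.
pose k n := Num.truncn (x * n%:R); pose m n := Num.truncn (x' * n%:R).
have kx : rate k x by apply: rate_truncn; exact: ltW.
have mx : rate m x' by apply: rate_truncn; exact: ltW.
apply/lee_subgt0Pr => ka ka0; rewrite -EFinB.
(* The ball tests the times 0 to [n - 1], and the last of these gives the [k n] extra digits; hence
   the predecessor, which does not change the rate. *)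
pose wk n := weight e1 e2 e1 e2 (iter n.-1 (unbranch e1 e2) p.1) (k n).
pose wm n := weight e2 e1 e2 e1 p.2 (m n).
have near_wk : \forall n \near \oo, expR (- (n%:R * r)) <= (1 - e1 - e2) * wk n.
  apply: (near_weight_ge _ (x * lyap e1 e2 q)) => //.
  - by move=> n; exact: weight_gt0.
  - rewrite /lyap mulrN opprK.
    exact: (cvg_ln_weight_window _ _ _ _ _ _ _ _ _ e10 e20 x0 fq1 rate_pred kx).
  - by rewrite -ltr_pdivlMr.
have near_wm : \forall n \near \oo, expR (- (n%:R * r)) <= (1 - e1 - e2) * wm n.
  apply: (near_weight_ge _ (x' * lyap e2 e1 q)) => //.
  - by move=> n; exact: weight_gt0.
  - rewrite /lyap mulrN opprK.
    exact: (cvg_ln_weight _ _ _ _ _ _ _ _ e20 e10 x'0 fq2 mx).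
  - by rewrite -ltr_pdivlMr.
pose w1 n := weight e1 e2 q (1 - q) p.1 (n.-1 + k n).
pose w2 n := weight e2 e1 q (1 - q) p.2 (m n).
have w10 n : 0 < w1 n by exact: weight_gt0.
have w20 n : 0 < w2 n by exact: weight_gt0.
have cvgW : (- (ln (w1 n) / n%:R + ln (w2 n) / n%:R))
    @[n --> \oo] --> - ((1 + x) * - lyap q (1 - q) q + x' * - lyap q (1 - q) q).
  apply: cvgN; apply: cvgD.
  - rewrite /lyap opprK; apply: cvg_ln_weight => //; first by rewrite addr_gt0.
    by apply: rateD => //; exact: rate_pred.
  - by rewrite /lyap opprK; exact: cvg_ln_weight.
apply: limn_esup_ge_near; near=> n.
have n0 : (0 < n)%N by near: n; exists 1%N.
have mball := measurable_neutral_ball _ _ e10 e20 e12 r p n.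
have mcyl := measurable_cylinder e1 e2 (n.-1 + k n) (m n) p.
apply: (@le_trans _ _ (- ln (w1 n * w2 n) / n%:R)%:E); last first.
  apply: neg_lne_ge => //; first by rewrite mulr_gt0.
  apply: le_trans (hcyl _ _); apply: le_measure; rewrite ?inE//.
  move=> y [Ly by_]; apply: (ball_sub_cylinder _ _ e10 e20 e12 _ _ _ _ _ (expR (- (n%:R * r)))) => //.
  - by near: n; exact: near_wk.
  - by near: n; exact: near_wm.
  - by rewrite prednK.
rewrite lee_fin lnM ?posrE// (_ : _ / _ =
  - (ln (w1 n) / n%:R + ln (w2 n) / n%:R)); last by ring.
near: n; move/cvgr_ge : cvgW; apply.
by rewrite -subr_gt0 (_ : _ - _ = ka)//; ring.
Unshelve. all: by end_near. Qed.

End LocalEntropy.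

(** * Integral bounds for functions not known to be measurable *)

Section NonmeasurableIntegral.
Context {R : realType} {d : measure_display} {T : measurableType d}.
Context (mu : probability T R).
Implicit Types (D : set T) (g h : T -> \bar R).
Local Open Scope ereal_scope.

(* The integral of a nonnegative function is a supremum over simple functions;
   stated without measurability, so that nothing need be proved about the
   measurability of the local entropy. *)
Lemma ge0_le_integral_nonmeasurable D g h :
  (forall x, D x -> 0 <= g x) -> (forall x, D x -> g x <= h x) ->
  \int[mu]_(x in D) g x <= \int[mu]_(x in D) h x.
Proof.
move=> g0 gh; rewrite !ge0_integralE//; last first.
  by move=> x Dx; exact: le_trans (g0 _ Dx) (gh _ Dx).
apply: ge_ereal_sup => _ [s /= sg <-]; apply: ereal_sup_ubound; exists s => //= x.
apply: le_trans (sg x) _; rewrite /patch; case: ifPn => [/set_mem|] //.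
exact: gh.
Qed.

Let integral_cst_full D (M : R) : measurable D -> mu D = 1 ->
  \int[mu]_(x in D) cst M%:E x = M%:E.
Proof.
move=> mD D1; rewrite integral_cst// -[RHS]mule1; congr (_ * _); exact: D1.
Qed.

Lemma integral_le_ae_bound D g (M : R) : measurable D -> mu D = 1 ->
  (forall x, D x -> 0 <= g x) -> (0 <= M)%R ->
  mu.-negligible [set x | D x /\ ~ (g x <= M%:E)] ->
  \int[mu]_(x in D) g x <= M%:E.
Proof.
move=> mD D1 g0 M0 [N [mN N0 hN]].
(* A measurable majorant of [g] on [D]: infinite on the null set, constant elsewhere. *)
pose h x : \bar R := if x \in N then +oo else M%:E.
apply: (@le_trans _ _ (\int[mu]_(x in D) h x)).
  apply: ge0_le_integral_nonmeasurable => // x Dx; rewrite /h.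
  case: (boolP (x \in N)) => [_|]; first by rewrite leey.
  rewrite leNgt => nN; apply/negP => Mg; move/negP : nN; apply.
  by apply/mem_set/hN; split=> // gM; move: Mg; rewrite ltNge gM.
apply: (@le_trans _ _ (\int[mu]_(x in D) cst M%:E x)); last first.
  by rewrite integral_cst_full.
apply: ae_ge0_le_integral => //.
- by move=> x _; rewrite /h; case: ifP => _; rewrite ?leey// lee_fin.
- apply: measurable_fun_if => //; apply: (measurable_fun_bool true).
  rewrite (_ : _ @^-1` _ = N); first exact: measurableI.
  by apply/seteqP; split=> x /=; [move/set_mem|move/mem_set].
- exists N; split=> // x /= nx; apply: contra_notP nx => nN _.
  by rewrite /h memNset.
Qed.

Lemma integral_ge_ae_bound D g (M : R) : measurable D -> mu D = 1 ->
  (forall x, D x -> 0 <= g x) -> (0 <= M)%R ->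
  mu.-negligible [set x | D x /\ ~ (M%:E <= g x)] ->
  M%:E <= \int[mu]_(x in D) g x.
Proof.
move=> mD D1 g0 M0 [N [mN N0 hN]].
apply: (@le_trans _ _ (\int[mu]_(x in D) (if x \in N then 0 else M%:E))).
  apply: (@le_trans _ _ (\int[mu]_(x in D) cst M%:E x)).
    by rewrite integral_cst_full.
  apply: ae_ge0_le_integral => //.
  - by move=> x _; case: ifP => _; rewrite ?lee_fin.
  - apply: measurable_fun_if => //; apply: (measurable_fun_bool true).
    rewrite (_ : _ @^-1` _ = N); first exact: measurableI.
    by apply/seteqP; split=> x /=; [move/set_mem|move/mem_set].
  - exists N; split=> // x /= nx; apply: contra_notP nx => nN _.
    by rewrite memNset.
apply: ge0_le_integral_nonmeasurable => x Dx.
  by case: ifP => _; rewrite ?lee_fin.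
case: (boolP (x \in N)) => [_|]; first exact: g0.
move=> nN; rewrite leNgt; apply/negP => Mg; move/negP : nN; apply.
by apply/mem_set/hN; split=> // gM; move: Mg; rewrite ltNge gM.
Qed.

End NonmeasurableIntegral.

(** * Bounds on the neutralized entropy *)

Section Bounds.
Context {R : realType} (e1 e2 : R).
Hypotheses (e10 : 0 < e1) (e20 : 0 < e2) (e12 : e1 + e2 < 1).

Let f : plane R -> plane R := hs_map e1 e2.
Let L : set (plane R) := horseshoe e1 e2.

Let mL : measurable L := measurable_horseshoe _ _ e10 e20 e12.

(** Invariance is only given for preimages cut down to [L]. Full measure of [L] upgrades it to plain
    preimages, and applying it to a preimage under [hs_inv] gives invariance under the inverse. *)
Lemma invariant_full (nu : probability (plane R) R) :
  invariant_measures f L nu ->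
  (forall A, measurable A -> nu (f @^-1` A) = nu A) /\
  (forall A, measurable A -> nu (hs_inv e1 e2 @^-1` A) = nu A).
Proof.
move=> [nuL inv].
have mpre (t : plane R -> plane R) A : measurable_fun setT t -> measurable A ->
    measurable (t @^-1` A).
  by move=> mt mA; rewrite -[X in measurable X]setTI; exact: mt.
have mf : measurable_fun setT f by exact: measurable_hs_map.
have mg : measurable_fun setT (hs_inv e1 e2 : plane R -> plane R).
  exact: measurable_hs_inv.
have finv A : measurable A -> nu (f @^-1` A) = nu A.
  move=> mA; rewrite -(inv A mA); apply: (eq_full_measure nu L) => //.
  - exact: mpre.
  - by apply: measurableI => //; exact: mpre.
  - by rewrite [L `&` _]setIC setIAC -setIA setIid.
split=> // A mA; rewrite -finv; last exact: mpre.
apply: (eq_full_measure nu L) => //; first by apply: (mpre) => //; exact: mpre.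
apply/seteqP; split=> p /= [Ap Lp]; split=> //.
  by have [_ <- _] := horseshoe_mapP _ _ e10 e20 e12 _ Lp.
by have [_ -> _] := horseshoe_mapP _ _ e10 e20 e12 _ Lp.
Qed.

Lemma visits_ones1 n p : L p ->
  visits f [set p : plane R | p.1 <= e1] p n = ones e1 e2 p.1 n.
Proof.
move=> Lp; apply: eq_bigr => i _; congr nat_of_bool.
by apply/idP/idP => [/set_mem|h]; [|apply/mem_set]; rewrite /= /digit iter_hs_map1.
Qed.

Lemma visits_ones2 n p :
  visits (hs_inv e1 e2) [set p : plane R | p.2 <= e2] p n = ones e2 e1 p.2 n.
Proof.
apply: eq_bigr => i _; congr nat_of_bool.
by apply/idP/idP => [/set_mem|h]; [|apply/mem_set]; rewrite /= /digit iter_hs_inv2.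
Qed.

Lemma ae_has_freq (nu : probability (plane R) R) : invariant_measures f L nu ->
  nu.-negligible [set p | L p /\ ~ exists q : R, 0 <= q <= 1 /\ has_freq e1 e2 p q].
Proof.
move=> inv; have [finv ginv] := invariant_full _ inv.
have mhalf (pr : plane R -> R) (a : R) : measurable_fun setT pr ->
    measurable [set p | pr p <= a].
  move=> mpr; rewrite -[X in measurable X]setTI.
  exact: (mpr measurableT _ (measurable_le_digit a)).
have [nuL _] := inv.
have AA' p : L p -> (f p \in [set q | q.2 <= e2]) = (p \in [set q | q.1 <= e1]).
  move=> Lp; have [_ _ E] := horseshoe_mapP _ _ e10 e20 e12 _ Lp.
  have p2 : 0 <= p.2 <= 1.
    move: Lp; rewrite /L horseshoeE// => -[_ /=]; apply: repeller_itv => //.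
    by rewrite addrC.
  have := branch_digit e20 e10 ltac:(by rewrite addrC) (p.1 <= e1) p.2 p2.
  rewrite -/f in E => h.
  by apply/idP/idP => /set_mem /= H; apply/mem_set => /=; move: H; rewrite E/= h.
have [] := @two_sided_frequency _ _ _ nu L f (hs_inv e1 e2)
  [set p | p.1 <= e1] [set p | p.2 <= e2] mL
  (measurable_hs_map _ _) (measurable_hs_inv _ _)
  (mhalf fst _ measurable_fst) (mhalf snd _ measurable_snd)
  (fun p Lp => let: And3 h _ _ := horseshoe_mapP _ _ e10 e20 e12 _ Lp in h)
  (fun p Lp => proj1 (horseshoe_invP _ _ e10 e20 e12 _ Lp))
  (fun p Lp => proj2 (horseshoe_invP _ _ e10 e20 e12 _ Lp))
  (fun p Lp => let: And3 _ h _ := horseshoe_mapP _ _ e10 e20 e12 _ Lp in h)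
  nuL finv ginv AA'.
move=> N [mN N0 hN]; exists N; split=> // p /= [Lp np]; apply: hN; split=> //.
apply: contra_not np => -[q [q01 fq gq]]; exists q; split=> //.
have E1 : visits f [set p | p.1 <= e1] p = ones e1 e2 p.1.
  by apply/funext => n; exact: visits_ones1.
have E2 : visits (hs_inv e1 e2) [set p | p.2 <= e2] p = ones e2 e1 p.2.
  by apply/funext => n; exact: visits_ones2.
by split; [rewrite -E1|rewrite -E2].
Qed.

Lemma ae_code_bound (nu : probability (plane R) R) :
  nu.-negligible [set p | ~ forall s : rat, 0 < (ratr s : R) < 1 ->
    code_bound e1 e2 nu (ratr s) p].
Proof.
pose N (s : rat) := if 0 < (ratr s : R) < 1 then
  [set p | ~ code_bound e1 e2 nu (ratr s) p] else set0.
apply: (@negligibleS _ _ _ _ (\bigcup_s N s)).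
  move=> p /= /existsNP[s /not_implyP[s01 ns]]; exists s => //.
  by rewrite /N s01.
apply: negligible_countable_bigcup => s; rewrite /N.
by case: ifP => [s01|_]; [exact: coding_lower_bound|exact: negligible_set0].
Qed.

(** The cross entropy is continuous in [t] at [t = q], also for [q = 0] and [q = 1], where the
    singular logarithm has coefficient zero. So a rational [t] strictly inside the unit interval
    suffices. *)
Lemma cross_entropy_approx (q ka : R) : 0 <= q <= 1 -> 0 < ka ->
  exists2 s : rat, 0 < (ratr s : R) < 1 &
    lyap (ratr s) (1 - ratr s) q <= lyap q (1 - q) q + ka.
Proof.
move=> /andP[q0 q1] ka0.
have c1 : (q * ln t) @[t --> q] --> q * ln q.
  have [->|qn0] := eqVneq q 0.
    by rewrite mul0r; under eq_fun do rewrite mul0r; exact: cvg_cst.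
  apply: cvgM; first exact: cvg_cst.
  by apply: continuous_ln; rewrite lt_neqAle eq_sym qn0.
have c2 : ((1 - q) * ln (1 - t)) @[t --> q] --> (1 - q) * ln (1 - q).
  have [qn1|q1'] := ltP q 1; last first.
    have -> : q = 1 by apply/eqP; rewrite eq_le q1 q1'.
    by rewrite subrr mul0r; under eq_fun do rewrite mul0r; exact: cvg_cst.
  apply: cvgM; first exact: cvg_cst.
  apply: continuous_cvg; first by apply: continuous_ln; rewrite subr_gt0.
  by apply: cvgB; [exact: cvg_cst|exact: cvg_id].
have c : lyap t (1 - t) q @[t --> q] --> lyap q (1 - q) q by apply: cvgN; exact: cvgD.
have /nbhs_ballP[d /= d0 hd] : \forall t \near q, lyap t (1 - t) q <= lyap q (1 - q) q + ka.
  by move/cvgr_le : c; apply; rewrite ltrDl.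
have /rat_in_itvoo[s] : Num.max 0 (q - d) < Num.min 1 (q + d).
  rewrite lt_min !gt_max; apply/andP; split; apply/andP; split => //; lra.
rewrite in_itv/= lt_min gt_max => /andP[/andP[s0 sd] /andP[s1 sd']].
exists s; first by rewrite s0.
by apply: hd; rewrite /ball/= ltr_norml; apply/andP; split; lra.
Qed.

Lemma local_neutral_entropy_ge0 (r : R) (nu : probability (plane R) R) p :
  (0 <= local_neutral_entropy f L (@euclid R) r nu p)%E.
Proof.
apply: limn_esup_ge_near; apply: nearW => n.
rewrite mule_le0// ?lne_le0 ?probability_le1//; last exact: measurable_neutral_ball.
Qed.

Let e1_01 : 0 < e1 < 1. Proof. by rewrite e10/=; move: e10 e20 e12 => *; lra. Qed.
Let e2_01 : 0 < e2 < 1. Proof. by rewrite e20/=; move: e10 e20 e12 => *; lra. Qed.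

Lemma entropy_ge0 (q : R) : 0 <= q <= 1 -> 0 <= lyap q (1 - q) q.
Proof.
move=> /andP[q0 q1].
have h1 : q * ln q <= 0 by rewrite mulr_ge0_le0// ln_le0.
have h2 : (1 - q) * ln (1 - q) <= 0.
  by rewrite mulr_ge0_le0 ?subr_ge0// ln_le0// gerBl.
by rewrite /lyap; lra.
Qed.

Lemma local_entropy_le_rate (nu : probability (plane R) R) (r q : R) p :
  nu L = 1%E -> 0 < r -> 0 <= q <= 1 -> L p -> has_freq e1 e2 p q ->
  (forall s : rat, 0 < (ratr s : R) < 1 -> code_bound e1 e2 nu (ratr s) p) ->
  (local_neutral_entropy f L (@euclid R) r nu p <= (neutral_rate e1 e2 r q)%:E)%E.
Proof.
move=> nuL r0 q01 Lp fq cb; apply/lee_addgt0Pr => ka ka0.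
have H0 := entropy_ge0 _ q01; rewrite /neutral_rate.
have lu0 := lyap_gt0 _ _ _ e1_01 e2_01 q01; have ls0 := lyap_gt0 _ _ _ e2_01 e1_01 q01.
set H := lyap q (1 - q) q in H0 *.
have x0 : 0 < r / lyap e1 e2 q by exact: divr_gt0.
have x'0 : 0 < r / lyap e2 e1 q by exact: divr_gt0.
set x := r / lyap e1 e2 q in x0 *; set x' := r / lyap e2 e1 q in x'0 *.
have D0 : 0 < (1 + x + x') + 2 * H + 2 by move: x0 x'0 H0; lra.
(* Raising both ratios and the entropy [H] by [k1] adds [k1 ((1 + x + x') + 2 H) + 2 k1^2], which is
   at most [ka] because [k1 <= 1]. *)
pose k1 := Num.min 1 (ka / ((1 + x + x') + 2 * H + 2)).
have k10 : 0 < k1 by rewrite lt_min ltr01 divr_gt0.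
have k11 : k1 <= 1 by rewrite ge_min lexx.
have k1D : k1 * ((1 + x + x') + 2 * H + 2) <= ka.
  by rewrite -ler_pdivlMr// ge_min lexx orbT.
have [s s01 hs] := cross_entropy_approx _ _ q01 k10.
apply: (@le_trans _ _ ((1 + (x + k1) + (x' + k1)) * lyap (ratr s) (1 - ratr s) q)%:E).
  apply: local_entropy_le => //; [exact: cb|by rewrite -/x; lra|by rewrite -/x'; lra].
rewrite -EFinD lee_fin -/H in hs *.
apply: (@le_trans _ _ ((1 + (x + k1) + (x' + k1)) * (H + k1))).
  by rewrite ler_pM2l//; move: x0 x'0 k10; lra.
have k1k : k1 * k1 <= k1 by rewrite ler_piMr// ltW.
apply: (@le_trans _ _ (H * (1 + x + x') + k1 * ((1 + x + x') + 2 * H + 2))).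
  rewrite -subr_ge0 (_ : _ - _ = 2 * (k1 - k1 * k1)); last by ring.
  by rewrite mulr_ge0// subr_ge0.
by rewrite lerD2l.
Qed.

Lemma local_entropy_ge_rate (mu : probability (plane R) R) (r q : R) p :
  mu L = 1%E -> 0 < r -> 0 < q < 1 -> L p -> has_freq e1 e2 p q ->
  (forall N m, (mu (cylinder e1 e2 N m p) <=
     (weight e1 e2 q (1 - q) p.1 N * weight e2 e1 q (1 - q) p.2 m)%:E)%E) ->
  ((neutral_rate e1 e2 r q)%:E <= local_neutral_entropy f L (@euclid R) r mu p)%E.
Proof.
move=> muL r0 q01 Lp fq hcyl; apply/lee_subgt0Pr => ka ka0.
have q01' : 0 <= q <= 1 by move: q01 => /andP[/ltW-> /ltW->].
have H0 := entropy_ge0 _ q01'; rewrite /neutral_rate.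
have lu0 := lyap_gt0 _ _ _ e1_01 e2_01 q01'; have ls0 := lyap_gt0 _ _ _ e2_01 e1_01 q01'.
set H := lyap q (1 - q) q in H0 *.
have x0 : 0 < r / lyap e1 e2 q by exact: divr_gt0.
have x'0 : 0 < r / lyap e2 e1 q by exact: divr_gt0.
set x := r / lyap e1 e2 q in x0 *; set x' := r / lyap e2 e1 q in x'0 *.
have D0 : 0 < 2 * H + 1 by move: H0; lra.
(* Lowering both ratios by [k1] costs [2 k1 H]; the other two bounds keep the lowered ratios
   positive. *)
pose k1 := Num.min (ka / (2 * H + 1)) (Num.min (x / 2) (x' / 2)).
have k10 : 0 < k1 by rewrite !lt_min !divr_gt0.
have k1x : k1 < x.
  by rewrite (@le_lt_trans _ _ (x / 2)) ?ge_min ?lexx ?orbT//; move: x0; lra.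
have k1x' : k1 < x'.
  by rewrite (@le_lt_trans _ _ (x' / 2)) ?ge_min ?lexx ?orbT//; move: x'0; lra.
have k1D : k1 * (2 * H + 1) <= ka.
  by rewrite -ler_pdivlMr// ge_min lexx.
apply: (@le_trans _ _ ((1 + (x - k1) + (x' - k1)) * H)%:E); last first.
  by apply: local_entropy_ge => //; rewrite -/x -/x'; apply/andP; split; lra.
rewrite -EFinB lee_fin lerBlDr.
rewrite -subr_ge0 (_ : _ - _ = ka - k1 * (2 * H)); last by ring.
by rewrite subr_ge0 (le_trans _ k1D)// ler_wpM2l ?ltW// ltrDl.
Qed.

Lemma neutral_entropy_le (nu : probability (plane R) R) (r M : R) :
  invariant_measures f L nu -> 0 < r ->
  (forall q, 0 <= q <= 1 -> neutral_rate e1 e2 r q <= M) ->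
  (neutral_entropy f L (@euclid R) r nu <= M%:E)%E.
Proof.
move=> inv r0 hM; have [nuL _] := inv.
apply: integral_le_ae_bound => //.
- by move=> p _; exact: local_neutral_entropy_ge0.
(* The rate vanishes at frequency 0, so [M] is nonnegative. *)
- have := hM 0; rewrite lexx ler01 => /(_ isT).
  by rewrite /neutral_rate /lyap subr0 mul0r mul1r ln1 addr0 oppr0 mul0r.
- apply: negligibleS (negligibleU (ae_has_freq _ inv) (ae_code_bound nu)).
  move=> p /= [Lp nle].
  have [cb|] := pselect (forall s : rat, 0 < (ratr s : R) < 1 ->
    code_bound e1 e2 nu (ratr s) p); last by right.
  left; split=> // -[q [q01 fq]]; apply: nle.
  apply: le_trans (local_entropy_le_rate _ _ _ _ nuL r0 q01 Lp fq cb) _.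
  by rewrite lee_fin hM.
Qed.

Lemma neutral_entropy_ge (mu : probability (plane R) R) (r q : R) :
  mu L = 1%E -> 0 < r -> 0 < q < 1 ->
  mu.-negligible [set p | L p /\ ~ has_freq e1 e2 p q] ->
  (forall p N m, L p -> (mu (cylinder e1 e2 N m p) <=
     (weight e1 e2 q (1 - q) p.1 N * weight e2 e1 q (1 - q) p.2 m)%:E)%E) ->
  ((neutral_rate e1 e2 r q)%:E <= neutral_entropy f L (@euclid R) r mu)%E.
Proof.
move=> muL r0 q01 aeq hcyl.
have q01' : 0 <= q <= 1 by move: q01 => /andP[/ltW-> /ltW->].
have lu0 := lyap_gt0 _ _ _ e1_01 e2_01 q01'; have ls0 := lyap_gt0 _ _ _ e2_01 e1_01 q01'.
apply: integral_ge_ae_bound => //.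
- by move=> p _; exact: local_neutral_entropy_ge0.
- by rewrite mulr_ge0 ?entropy_ge0// !addr_ge0// divr_ge0// ltW.
- apply: negligibleS aeq => p /= [Lp nle]; split=> // fq; apply: nle.
  by apply: local_entropy_ge_rate => // N m; exact: hcyl.
Qed.

End Bounds.

(** * Bernoulli measures *)

Section CodeMap.
Context {R : realType} (a b w : R).

(* Lebesgue measure on [0, 1[ is Bernoulli for [unit_shift], and [code], the
   increasing limit of [code_approx], conjugates [unit_shift] to [unbranch]. *)
Definition unit_shift (u : R) : R := if u < w then u / w else (u - w) / (1 - w).

(* Outside [0, 1[ the value is the junk 0. *)
Fixpoint code_approx (n : nat) (u : R) : R :=
  if n is m.+1 then
    if 0 <= u < 1 then branch a b (u < w) (code_approx m (unit_shift u)) else 0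
  else 0.

Definition code (u : R) : R := limn (code_approx ^~ u).

Hypotheses (a0 : 0 < a) (b0 : 0 < b) (ab1 : a + b < 1) (w01 : 0 < w < 1).

Let w0 : 0 < w. Proof. by case/andP: w01. Qed.
Let w1 : w < 1. Proof. by case/andP: w01. Qed.

Lemma unit_shift_itv u : 0 <= u < 1 -> 0 <= unit_shift u < 1.
Proof.
have w'0 : 0 < 1 - w by rewrite subr_gt0.
move=> /andP[u0 u1]; rewrite /unit_shift; case: ltP => uw.
  apply/andP; split; first by apply: divr_ge0 => //; exact: ltW.
  by rewrite ltr_pdivrMr// mul1r.
apply/andP; split; first by apply: divr_ge0; [rewrite subr_ge0|exact: ltW].
by rewrite ltr_pdivrMr// mul1r ltrD2r.
Qed.

Lemma code_approx_itv n u : 0 <= code_approx n u <= 1.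
Proof.
elim: n u => [|n ih] u /=; first by rewrite lexx ler01.
case: ifP => _; last by rewrite lexx ler01.
by have := branch_dom a0 b0 ab1 (u < w) _ (ih (unit_shift u)) => /(ifs_dom_itv a0 b0 ab1).
Qed.

(** The iteration starts from the least possible value, 0, and both branches are increasing. *)
Lemma code_approx_leS n u : code_approx n u <= code_approx n.+1 u.
Proof.
elim: n u => [|n ih] u; first by have /andP[] := code_approx_itv 1 u.
rewrite [leRHS]/=; rewrite [leLHS]/=; case: ifP => // _.
by rewrite /branch; case: ifP => _; rewrite ?lerD2l ler_pM2l.
Qed.

Lemma code_cvg u : code_approx n u @[n --> \oo] --> code u.
Proof.
apply: nondecreasing_is_cvgn.
  by apply/nondecreasing_seqP => n; exact: code_approx_leS.
by exists 1 => _ [n _ <-]; have /andP[] := code_approx_itv n u.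
Qed.

Lemma code_itv u : 0 <= code u <= 1.
Proof.
apply/andP; split.
  by apply: (limr_ge (code_cvg u)); apply: nearW => n; have /andP[] := code_approx_itv n u.
by apply: (limr_le (code_cvg u)); apply: nearW => n; have /andP[] := code_approx_itv n u.
Qed.

Lemma codeE u : 0 <= u < 1 -> code u = branch a b (u < w) (code (unit_shift u)).
Proof.
move=> u01; have h := code_cvg u; rewrite -(cvg_shiftS (code_approx ^~ u)) in h.
apply: cvg_unique h _ => //.
have /= -> : (fun n => code_approx n.+1 u) =
  fun n => branch a b (u < w) (code_approx n (unit_shift u)).
  by apply/funext => n /=; rewrite u01.
rewrite /branch; case: ifP => _; last apply: cvgD; try exact: cvg_cst.
- by apply: cvgM; [exact: cvg_cst|exact: code_cvg].
- by apply: cvgM; [exact: cvg_cst|exact: code_cvg].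
Qed.

Lemma code_digit u : 0 <= u < 1 -> (code u <= a) = (u < w).
Proof. by move=> u01; rewrite codeE// branch_digit// code_itv. Qed.

Lemma unbranch_code u : 0 <= u < 1 -> unbranch a b (code u) = code (unit_shift u).
Proof. by move=> u01; rewrite codeE// branchK// code_itv. Qed.

Lemma repeller_code u : 0 <= u < 1 -> repeller a b (code u).
Proof.
move=> u01 n; elim: n u u01 => [|n ih] u u01.
  by rewrite /= codeE//; apply: branch_dom => //; exact: code_itv.
by rewrite iterSr unbranch_code//; apply: ih; exact: unit_shift_itv.
Qed.

Lemma measurable_unit_shift : measurable_fun setT unit_shift.
Proof.
apply: measurable_fun_ifT; first exact: measurable_fun_ltr.
  exact: measurable_funM.
by apply: measurable_funM => //; exact: measurable_funB.
Qed.

Lemma measurable_code_approx n : measurable_fun setT (code_approx n).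
Proof.
elim: n => [|n ih] /=; first exact: measurable_cst.
apply: measurable_fun_ifT => //.
  by apply: measurable_and; [exact: measurable_fun_ler|exact: measurable_fun_ltr].
have mc : measurable_fun setT (fun u => code_approx n (unit_shift u)).
  exact: (measurableT_comp ih measurable_unit_shift).
apply: measurable_fun_ifT; first exact: measurable_fun_ltr.
  exact: measurable_funM.
by apply: measurable_funD => //; exact: measurable_funM.
Qed.

Lemma measurable_code : measurable_fun setT code.
Proof.
apply: (measurable_fun_cvg (h := code_approx)) => [n|u _].
  exact: measurable_code_approx.
exact: code_cvg.
Qed.

End CodeMap.

Lemma pushforward_measure {d d' : measure_display} {T : measurableType d}
    {T' : measurableType d'} {R : realType} (mu : {measure set T -> \bar R})
    (f : T -> T') : measurable_fun setT f ->
  exists m : {measure set T' -> \bar R}, forall A, m A = mu (f @^-1` A).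
Proof.
move=> mf; unshelve eexists; first by unshelve refine (pushforward mu f).
by [].
Qed.

Lemma pushforward_probability {d d' : measure_display} {T : measurableType d}
    {T' : measurableType d'} {R : realType} (P : probability T R)
    (f : T -> T') : measurable_fun setT f ->
  exists P' : probability T' R, forall A, P' A = P (f @^-1` A).
Proof.
move=> mf; pose X : {mfun T >-> T'} := HB.pack f (isMeasurableFun.Build _ _ _ _ f mf).
by exists (distribution P X).
Qed.

Section UnitLebesgue.
Context {R : realType}.

(** The right-hand side is a measure in [A] that agrees with Lebesgue measure on half-open
    intervals, so uniqueness applies. *)
Lemma lebesgue_measure_affine (c x : R) (A : set R) : 0 < c -> measurable A ->
  lebesgue_measure A =
  (c%:E * lebesgue_measure ((fun u : R => (c * u + x)%R) @^-1` A))%E.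
Proof.
move=> c0 mA.
have maff : measurable_fun setT (fun u : measurableTypeR R => c * u + x : measurableTypeR R).
  by apply: measurable_funD => //; exact: measurable_funM.
have [m mE] := pushforward_measure lebesgue_measure _ maff.
transitivity (mscale (NngNum (ltW c0)) m A); last by congr (_ * _)%E; exact: mE.
apply: lebesgue_measure_unique mA => {A} _ [[y z]] _ <-.
transitivity (c%:E * lebesgue_measure ((fun u : R => (c * u + x)%R) @^-1` `]y, z]%classic))%E;
  last by congr (_ * _)%E; exact/esym/mE.
rewrite (_ : _ @^-1` _ = `](y - x) / c, (z - x) / c]%classic); last first.
  apply/seteqP; split=> u /=; rewrite !in_itv/= ltr_pdivrMr// ler_pdivlMr//;
    rewrite ltrBlDr lerBrDr mulrC//.
rewrite !lebesgue_measure_itv/= !lte_fin ltr_pM2r ?invr_gt0// ltrD2r.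
case: ifP => _; last by rewrite mule0.
rewrite -EFinB -EFinB -EFinM; congr EFin; field.
by rewrite gt_eqF.
Qed.

Definition unit_lebesgue : set (measurableTypeR R) -> \bar R :=
  mrestr lebesgue_measure (measurable_itv (`[0, 1[%R : interval R)).

HB.instance Definition _ := Measure.on unit_lebesgue.

Let unit_lebesgueT : unit_lebesgue setT = 1%E.
Proof.
by rewrite /unit_lebesgue /mrestr setTI lebesgue_measure_itv/= lte_fin ltr01 oppr0 adde0.
Qed.

HB.instance Definition _ := Measure_isProbability.Build _ _ _ unit_lebesgue unit_lebesgueT.

End UnitLebesgue.

(** * Self-similar measures on a repeller *)

Section SelfSimilar.
Context {R : realType} (a b w : R).
Hypotheses (a0 : 0 < a) (b0 : 0 < b) (ab1 : a + b < 1) (w01 : 0 < w < 1).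

Let w0 : 0 < w. Proof. by case/andP: w01. Qed.
Let w'0 : 0 < 1 - w. Proof. by case/andP: w01 => _; rewrite subr_gt0. Qed.

Lemma unit_lebesgue_shift (s : bool) (B : set R) : measurable B ->
  (unit_lebesgue ([set u | (u < w)%R = s] `&` unit_shift w @^-1` B) =
   (if s then w else 1 - w)%R%:E * unit_lebesgue B)%E.
Proof.
move=> mB; rewrite /unit_lebesgue /mrestr.
have mw : measurable_fun setT (fun u : R => u < w) by exact: measurable_fun_ltr.
have mE : measurable ([set u | (u < w) = s] `&` unit_shift w @^-1` B `&` `[0, 1[%classic).
  apply: measurableI => //; apply: measurableI.
    by rewrite -[X in measurable X]setTI; exact: (mw measurableT [set s]).
  by rewrite -[X in measurable X]setTI; apply: measurable_unit_shift.
(* [c * u + x] is the inverse branch of the shift on the side [s]; its slope is the mass of the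
   digit. *)
pose c := if s then w else 1 - w; pose x := if s then 0 else w.
have c0 : 0 < c by rewrite /c; case: (s).
rewrite (lebesgue_measure_affine c x)//; congr (_ * lebesgue_measure _)%E.
have E u : 0 <= u < 1 -> (c * u + x < w) = s /\ 0 <= c * u + x < 1.
  move: w0 w'0 => ? ?; rewrite /c /x => /andP[u0 u1]; case: (s) => /=.
    by split; [apply/idP|apply/andP; split]; nra.
  by split; [apply/negbTE; rewrite -leNgt|apply/andP; split]; nra.
have E' u : 0 <= c * u + x < 1 -> (c * u + x < w) = s -> 0 <= u < 1.
  move: w0 w'0 => ? ?; rewrite /c /x => /andP[+ +]; case: (s) => /=.
    by move=> ? ? h; apply/andP; split; nra.
  by move=> ? ? /negbT; rewrite -leNgt => h; apply/andP; split; nra.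
have E2 u : (c * u + x < w) = s -> unit_shift w (c * u + x) = u.
  rewrite /unit_shift /c /x => ->; case: (s).
    by field; rewrite gt_eqF.
  by field; rewrite gt_eqF.
apply/seteqP; split=> u /=.
  by rewrite !in_itv/= => -[[us Bu] u01]; split; [rewrite -(E2 u us)|exact: E' u01 us].
by rewrite !in_itv/= => -[Bu u01]; have [us ?] := E u u01; split=> //; split=> //; rewrite E2.
Qed.

(** The law of independent digits that are [true] with probability [w]: the first digit is
    independent of the tail, and the tail has the same law. *)
Definition is_self_similar (S : probability R R) :=
  [/\ S (repeller a b) = 1%E &
    forall (s : bool) (B : set R), measurable B ->
    (S ([set t | (t <= a)%R = s] `&` unbranch a b @^-1` B) =
     (if s then w else 1 - w)%R%:E * S B)%E].

Lemma self_similar_exists : exists S : probability R R, is_self_similar S.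
Proof.
have mcode := measurable_code a b w a0 b0 ab1 : measurable_fun setT _.
have [S SE] := pushforward_probability unit_lebesgue _ mcode.
exists S; split.
  rewrite SE; transitivity (lebesgue_measure (`[0, 1[%classic : set R)); last first.
    by rewrite lebesgue_measure_itv/= lte_fin ltr01 oppr0 adde0.
  apply: (congr1 lebesgue_measure).
  apply/seteqP; split=> u /=; rewrite in_itv/=; first by case.
  by move=> u01; split=> //; exact: repeller_code.
move=> s B mB; rewrite !SE -unit_lebesgue_shift; last first.
  by rewrite -[X in measurable X]setTI; exact: mcode.
apply: (congr1 lebesgue_measure).
apply/seteqP; split=> u /=; rewrite in_itv/= => -[[us Bu] u01]; split=> //; split.
- by rewrite -(code_digit a b w a0 b0 ab1 u u01).
- by rewrite -(unbranch_code a b w a0 b0 ab1 u u01).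
- by rewrite (code_digit a b w a0 b0 ab1 u u01).
- by rewrite (unbranch_code a b w a0 b0 ab1 u u01).
Qed.

End SelfSimilar.

Lemma measurable_preimage {d d' : measure_display} {T : measurableType d}
    {T' : measurableType d'} (f : T -> T') (A : set T') :
  measurable_fun setT f -> measurable A -> measurable (f @^-1` A).
Proof. by move=> mf mA; rewrite -[X in measurable X]setTI; exact: mf. Qed.

Section Fibers.
Context {R : realType} {d : measure_display} {T : measurableType d}.

Lemma eq_measure_fibers (m1 m2 : {measure set T -> \bar R}) (W : finType)
    (X : T -> W) (P : set W) :
  (forall w, measurable (X @^-1` [set w])) ->
  (forall t, m1 (X @^-1` [set X t]) = m2 (X @^-1` [set X t])) ->
  m1 (X @^-1` P) = m2 (X @^-1` P).
Proof.
move=> mX m12.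
have -> : X @^-1` P = \bigcup_(w in P) X @^-1` [set w].
  by apply/seteqP; split=> [t Pt|t [w Pw Xt]]; [exists (X t)|rewrite /= Xt].
have tX : trivIset P (fun w => X @^-1` [set w]).
  by move=> w w' _ _ [t [<- <-]].
have mP w : P w -> measurable (X @^-1` [set w]) by move=> _; exact: mX.
have fP : finite_set P by exact: finite_finset.
rewrite !measure_fin_bigcup//; apply: eq_fsbigr => w _.
have [[t <-]|nw] := pselect (exists t, X t = w); first exact: m12.
rewrite (_ : _ @^-1` _ = set0) ?measure0//.
by apply/seteqP; split=> // t Xt; apply: nw; exists t.
Qed.

End Fibers.

Section RepellerMeasures.
Context {R : realType} (a b : R).
Hypotheses (a0 : 0 < a) (b0 : 0 < b) (ab1 : a + b < 1).

Let word n t : {ffun 'I_n -> bool} := [ffun i : 'I_n => digit a b t i].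

Let word_fiber n t : word n @^-1` [set word n t] = [set t' | same_digits a b n t t'].
Proof.
apply/seteqP; split=> t' /= => [/ffunP h i ilt|h].
  by have := h (Ordinal ilt); rewrite !ffunE.
by apply/ffunP => i; rewrite !ffunE h.
Qed.

Let measurable_word n w : measurable (word n @^-1` [set w]).
Proof.
have [[p <-]|nw] := pselect (exists p, word n p = w).
  by rewrite word_fiber; exact: measurable_same_digits.
rewrite (_ : _ @^-1` _ = set0)//; apply/seteqP; split=> // p pw.
by apply: nw; exists p.
Qed.

(** Up to null sets, a ray to the left of [s] is the increasing union of the sets [U s n] of points
    whose cylinder of length [n] meets the repeller only to the left of [s], because cylinders
    shrink to points. Each [U s n] is a finite union of cylinders, and rays determine a finite
    measure. *)
Lemma repeller_measure_unique (m1 m2 : {measure set R -> \bar R}) :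
  (m1 setT < +oo)%E ->
  m1 (~` repeller a b) = 0%E -> m2 (~` repeller a b) = 0%E ->
  (forall n t, m1 [set t' | same_digits a b n t t'] =
               m2 [set t' | same_digits a b n t t']) ->
  forall B, measurable B -> m1 B = m2 B.
Proof.
move=> m1T m1K m2K m12.
have mK := measurable_repeller a b.
have onK (m : {measure set R -> \bar R}) X Y : m (~` repeller a b) = 0%E ->
    measurable X -> measurable Y -> X `&` repeller a b = Y `&` repeller a b -> m X = m Y.
  move=> mK0 mX mY XY.
  have mE Z : measurable Z -> m Z = m (Z `&` repeller a b).
    move=> mZ; rewrite (measureDI m mZ mK) [X in (X + _)%E](_ : _ = 0%E) ?add0e//.
    apply: (subset_measure0 _ _ _ mK0); first exact: measurableD.
      exact: measurableC.
    by move=> x [].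
  by rewrite mE// XY -mE.
pose U s n : set R := [set t | forall t', repeller a b t' -> same_digits a b n t t' -> t' < s].
have UW s n : exists P, U s n = word n @^-1` P.
  exists [set w | exists2 t, U s n t & word n t = w].
  apply/seteqP; split=> [t Ut|t [t' Ut' tt'] x Kx sx]; first by exists t.
  apply: Ut' => //; apply: same_digits_trans sx.
  have : (word n @^-1` [set word n t']) t by rewrite /= tt'.
  by rewrite word_fiber.
have mU s n : measurable (U s n).
  have [P ->] := UW s n.
  rewrite (_ : _ @^-1` _ = \bigcup_(w in P) word n @^-1` [set w]).
    by apply: fin_bigcup_measurable => // w _; exact: measurable_word.
  by apply/seteqP; split=> [t Pt|t [w Pw Xt]]; [exists (word n t)|rewrite /= Xt].
have U12 s n : m1 (U s n) = m2 (U s n).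
  have [P ->] := UW s n; apply: eq_measure_fibers => [w|t].
    exact: measurable_word.
  by rewrite word_fiber.
have ndU s : nondecreasing_seq (U s).
  move=> n k nk; apply/subsetPset => t Ut t' Kt' tt'; apply: Ut => //.
  exact: same_digits_le nk tt'.
have UE s : \bigcup_n U s n `&` repeller a b = `]-oo, s[%classic `&` repeller a b.
  apply/seteqP; split=> t.
    by move=> [[n _ Ut] Kt]; split=> //=; rewrite in_itv/=; exact: Ut.
  rewrite /= in_itv/= => -[ts Kt]; split=> //.
  have c0 : 0 <= Num.max a b by rewrite le_max ltW.
  have c1 : `|Num.max a b| < 1.
    by rewrite ger0_norm// gt_max; move: a0 b0 ab1 => *; apply/andP; split; lra.
  have [n _ hn] : \forall n \near \oo, Num.max a b ^+ n < s - t.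
    by move/cvgr_lt : (cvg_expr c1); apply; rewrite subr_gt0.
  exists n => // t' Kt' tt'.
  have := same_digits_dist_le a0 b0 ab1 _ _ _ Kt Kt' tt'.
  move=> /le_trans/(_ (weight_le_expn a0 b0 t n)).
  move=> /le_lt_trans/(_ (hn n (leqnn n))); rewrite ltr_norml => /andP[]; lra.
have ray s : m1 `]-oo, s[%classic = m2 `]-oo, s[%classic.
  have rE (m : {measure set R -> \bar R}) : m (~` repeller a b) = 0%E ->
      m (U s n) @[n --> \oo] --> m `]-oo, s[%classic.
    move=> mK0; rewrite -(onK m (\bigcup_n U s n))//; last exact: bigcup_measurable.
    by apply: nondecreasing_cvg_mu => //; exact: bigcup_measurable.
  have h1 := rE m1 m1K; have h2 := rE m2 m2K.
  rewrite (_ : (fun n => m1 (U s n)) = fun n => m2 (U s n)) in h1; last first.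
    by apply/funext => n.
  exact: cvg_unique h1 h2.
move=> B mB.
apply: (measure_unique (@RGenInftyO.G R) (fun n : nat => `]-oo, n%:R[%classic)) => //.
- exact: RGenInftyO.measurableE.
- move=> _ _ [x ->] [y ->]; exists (Num.min x y).
  by apply/seteqP; split=> t /=; rewrite !in_itv/= lt_min => /andP.
- by move=> n; exists n%:R.
- apply/seteqP; split=> // t _; exists (Num.truncn t).+1 => //=.
  by rewrite in_itv/= truncnS_gt.
- by move=> _ [x ->]; exact: ray.
- move=> n; apply: le_lt_trans m1T; apply: le_measure; rewrite ?inE//.
Qed.

End RepellerMeasures.

Section SelfSimilarMeasure.
Context {R : realType} (a b w : R).
Hypotheses (a0 : 0 < a) (b0 : 0 < b) (ab1 : a + b < 1).
Context (S : probability R R) (SS : is_self_similar a b w S).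

Let S_setU (A B : set R) : measurable A -> measurable B -> A `&` B = set0 ->
  S (A `|` B) = (S A + S B)%E.
Proof. by move=> mA mB AB; rewrite measureU. Qed.

Lemma measurable_first_digit (s : bool) : measurable [set t : R | (t <= a) = s].
Proof.
have mf : measurable_fun setT (fun t : R => t <= a) by exact: measurable_fun_ler.
exact: (measurable_preimage _ [set s] mf).
Qed.

Lemma self_similar_splitE (A : set R) : measurable A ->
  S A = (S ([set t | (t <= a)%R = true] `&` A) + S ([set t | (t <= a)%R = false] `&` A))%E.
Proof.
move=> mA; rewrite -S_setU; last 3 first.
- by apply: measurableI => //; exact: measurable_first_digit.
- by apply: measurableI => //; exact: measurable_first_digit.
- by apply/seteqP; split=> // t [/= [-> _] []].
congr (S _); apply/seteqP; split=> t /=.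
  by case: (t <= a) => ?; [left|right].
by case=> -[].
Qed.

Lemma self_similar_invariant (B : set R) : measurable B ->
  S (unbranch a b @^-1` B) = S B.
Proof.
move=> mB; have [_ h] := SS; rewrite self_similar_splitE; last first.
  by apply: measurable_preimage => //; exact: measurable_unbranch.
rewrite !h//; have /fineK <- : S B \is a fin_num by exact: fin_num_measure.
by rewrite -!EFinM -EFinD -mulrDl addrC subrK mul1r.
Qed.

(** Hutchinson's equation. It serves the second coordinate, on which the horseshoe map acts by
    [branch] rather than [unbranch]. *)
Lemma self_similar_branch (B : set R) : measurable B ->
  S B = (w%:E * S (branch a b true @^-1` B) + (1 - w)%:E * S (branch a b false @^-1` B))%E.
Proof.
move=> mB; have [SK h] := SS; rewrite self_similar_splitE//.
have mbr s : measurable (branch a b s @^-1` B).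
  by apply: measurable_preimage => //; exact: measurable_branch.
have <- := h true _ (mbr true); have <- := h false _ (mbr false).
by congr (_ + _)%E; congr (S _); apply/seteqP; split=> t /= [ts];
  have := unbranchK a0 b0 t; rewrite ts /= => ->.
Qed.

(** The first [n] digits are independent of the tail. [B = setT] gives the mass of a cylinder, and a
    [B] that fixes later digits gives independence of disjoint blocks. *)
Lemma self_similar_same_digits n (t : R) (B : set R) : measurable B ->
  S ([set t' | same_digits a b n t t'] `&` iter n (unbranch a b) @^-1` B) =
  ((weight a b w (1 - w) t n)%:E * S B)%E.
Proof.
move=> mB; have [_ h] := SS; elim: n t => [|n ih] t.
  rewrite /weight big_ord0 mul1e; congr (S _).
  by apply/seteqP; split=> t' // [].
have -> : [set t' | same_digits a b n.+1 t t'] `&` iter n.+1 (unbranch a b) @^-1` B =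
  [set t' | (t' <= a) = (t <= a)] `&` unbranch a b @^-1`
    ([set t' | same_digits a b n (unbranch a b t) t'] `&` iter n (unbranch a b) @^-1` B).
  apply/seteqP; split=> t' /=; rewrite -iterSr.
    by move=> [/same_digitsS[h0 hn] Bt].
  by move=> [h0 [hn Bt]]; split=> //; apply/same_digitsS; split.
rewrite h; last first.
  apply: measurableI; first exact: measurable_same_digits.
  by apply: measurable_preimage => //; apply: measurable_iter; exact: measurable_unbranch.
by rewrite ih weightS EFinM muleA.
Qed.

End SelfSimilarMeasure.

Lemma measure_prod_unique {R : realType} {d1 d2 : measure_display}
    {T1 : measurableType d1} {T2 : measurableType d2}
    (m1 m2 : {measure set (T1 * T2)%type -> \bar R}) : (m1 setT < +oo)%E ->
  (forall A B, measurable A -> measurable B -> m1 (A `*` B) = m2 (A `*` B)) ->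
  forall X, measurable X -> m1 X = m2 X.
Proof.
move=> m1T m12 X mX.
pose C : set (set (T1 * T2)) :=
  [set C | exists A, measurable A /\ exists B, measurable B /\ C = A `*` B].
apply: (measure_unique C (fun _ => setT)) => //.
- rewrite measurable_prod_measurableType //; congr (<<s _ >>).
  rewrite predeqE; split => [[A mA [B mB <-]]|[A [mA [B [mB ->]]]]].
    by exists A; split => //; exists B.
  by exists A => //; exists B.
- move=> _ _ [X1 [mX1 [X2 [mX2 ->]]]] [Y1 [mY1 [Y2 [mY2 ->]]]].
  rewrite -setXI; exists (X1 `&` Y1); split; first exact: measurableI.
  by exists (X2 `&` Y2); split => //; exact: measurableI.
- by move=> _; exists setT; split=> //; exists setT; split=> //; rewrite setXTT.
- by apply/seteqP; split=> // x _; exists 0%N.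
- by move=> _ [A [mA [B [mB ->]]]]; exact: m12.
Qed.

(** * Independence and ergodicity of the Bernoulli measure *)

Section PairwiseIndependence.
Context {R : realType} {d : measure_display} {T : measurableType d}.
Context (mu : probability T R).

(* The variance of the number of [C i] that occur is at most linear, so that
   number, divided by [n], converges to [c] in mean square. *)
Lemma pairwise_independent_trivial (C : nat -> set T) (c be : R) (A : set T) :
  (forall i, measurable (C i)) -> measurable A ->
  (forall i, mu (C i) = c%:E) ->
  (forall i j, (i < j)%N -> mu (C i `&` C j) = (c * c)%:E) ->
  (forall i, mu (A `&` C i) = be%:E) ->
  be = fine (mu A) * c.
Proof.
move=> mC mA muC muCC muAC.
have b1 X : measurable X -> bounded_mfun (\1_X : T -> R) by exact: bounded_mfun_indic.
pose al := fine (mu A).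
have al1 : al <= 1.
  by rewrite -lee_fin fineK ?probability_le1//; exact: fin_num_measure.
pose Y i x := \1_(C i) x - c : R.
have bY i : bounded_mfun (Y i).
  by apply: bounded_mfunB; [exact/b1/mC|exact: bounded_mfun_cst].
have bI : bounded_mfun (\1_A : T -> R) by exact: b1.
have mean_c k : mean mu (fun=> k) = k :> R.
  have := mean_indic mu _ (@measurableT _ T).
  rewrite probability_setT/= => h; rewrite -[RHS]mulr1 -h -meanZ; last exact: b1.
  by congr mean; apply/funext => x; rewrite indicE in_setT mulr1.
have mYY i j : mean mu (fun x => Y i x * Y j x) = if i == j then c - c * c else 0.
  have -> : (fun x => Y i x * Y j x) = (fun x => (\1_(C i `&` C j) x - c * \1_(C i) x)
     - (c * \1_(C j) x - c * c)).
    by apply/funext => x; rewrite /Y indicI/=; ring.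
  rewrite meanB; last 2 first.
  - by apply: bounded_mfunB; [exact/b1/measurableI|exact/bounded_mfunZ/b1].
  - by apply: bounded_mfunB; [exact/bounded_mfunZ/b1|exact: bounded_mfun_cst].
  rewrite meanB; [|exact/b1/measurableI|exact/bounded_mfunZ/b1].
  rewrite meanB; [|exact/bounded_mfunZ/b1|exact: bounded_mfun_cst].
  rewrite !meanZ ?mean_indic ?mean_c ?muC/=; try exact: b1; try exact: measurableI; try exact: mC; try exact: bounded_mfun_cst.
  have [->|ij] := eqVneq i j; first by rewrite setIid muC/=; ring.
  have -> : mu (C i `&` C j) = (c * c)%:E.
    by move: ij; rewrite neq_ltn => /orP[/muCC//|/muCC]; rewrite setIC.
  by rewrite /=; ring.
have mYA i : mean mu (fun x => Y i x * \1_A x) = be - c * al.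
  have -> : (fun x => Y i x * \1_A x) = (fun x => \1_(A `&` C i) x - c * \1_A x).
    by apply/funext => x; rewrite /Y indicI/=; ring.
  rewrite meanB; [|exact/b1/measurableI|exact: bounded_mfunZ].
  by rewrite meanZ// !mean_indic ?muAC//; exact: measurableI.
pose de := be - c * al.
have ineq (n : nat) : n%:R * de ^+ 2 <= c - c * c \/ n = 0%N.
  case: n => [|n]; [by right|left]; set N : R := n.+1%:R.
  have N0 : 0 < N by rewrite ltr0n.
  pose Z x := \sum_(i < n.+1) Y i x.
  have bZ : bounded_mfun Z by apply: bounded_mfun_sum => i.
  have mZZ : mean mu (fun x => Z x * Z x) = N * (c - c * c).
    have -> : (fun x => Z x * Z x) =
        (fun x => \sum_(i < n.+1) \sum_(j < n.+1) Y i x * Y j x).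
      by apply/funext => x; rewrite /Z mulr_suml; apply: eq_bigr => i _; rewrite mulr_sumr.
    rewrite mean_sum; last by move=> i; apply: bounded_mfun_sum => j; exact: bounded_mfunM.
    rewrite (eq_bigr (fun=> c - c * c)) => [|i _]; last first.
      rewrite mean_sum; last by move=> j; exact: bounded_mfunM.
      under eq_bigr do rewrite mYY.
      rewrite (bigD1 i)//= eqxx big1 ?addr0// => j ji.
      by rewrite eq_sym ifN.
    by rewrite sumr_const card_ord /N -[LHS]mulr_natl.
  have mZA : mean mu (fun x => Z x * \1_A x) = N * de.
    have -> : (fun x => Z x * \1_A x) = (fun x => \sum_(i < n.+1) Y i x * \1_A x).
      by apply/funext => x; rewrite /Z mulr_suml.
    rewrite mean_sum; last by move=> i; exact: bounded_mfunM.
    rewrite (eq_bigr (fun=> de)) => [|i _]; last exact: mYA.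
    by rewrite sumr_const card_ord /N -[LHS]mulr_natl.
  (* Cauchy-Schwarz by hand: the mean of this square is [N (c - c^2) - 2 (N de)^2 + (N de)^2 al], so
     with [al <= 1] its nonnegativity bounds [N de^2] independently of [N]. *)
  have := mean_ge0 mu (fun x => (Z x - N * de * \1_A x) ^+ 2) (fun x => sqr_ge0 _).
  have -> : (fun x => (Z x - N * de * \1_A x) ^+ 2) = (fun x =>
      (Z x * Z x - 2 * (N * de) * (Z x * \1_A x)) + (N * de) ^+ 2 * \1_A x).
    apply/funext => x; have -> : \1_A x = \1_A x * \1_A x :> R.
      by rewrite indicE; case: (_ \in _); rewrite ?mulr1 ?mulr0.
    rewrite indicE; case: (_ \in _) => /=; ring.
  rewrite meanD; last 2 first.
  - by apply: bounded_mfunB; [exact: bounded_mfunM|exact/bounded_mfunZ/bounded_mfunM].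
  - exact: bounded_mfunZ.
  rewrite meanB; [|exact: bounded_mfunM|exact/bounded_mfunZ/bounded_mfunM].
  rewrite !meanZ ?mean_indic ?mZZ ?mZA//; last exact: bounded_mfunM.
  rewrite -/al => h.
  rewrite -(ler_pM2l N0); have : (N * de) ^+ 2 * al <= (N * de) ^+ 2.
    by rewrite ler_piMr// sqr_ge0.
  move: h; rewrite !exprMn; lra.
have de0 : de ^+ 2 <= 0.
  rewrite leNgt; apply/negP => de0.
  have := @truncnS_gt R ((c - c * c) / de ^+ 2); rewrite ltr_pdivrMr//.
  by case: (ineq (Num.truncn ((c - c * c) / de ^+ 2)).+1) => //; lra.
have : de = 0 by apply/eqP; rewrite -sqrf_eq0 eq_le de0 sqr_ge0.
by rewrite /de /al => /eqP; rewrite subr_eq0 => /eqP ->; rewrite mulrC.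
Qed.

End PairwiseIndependence.

Section Bernoulli.
Context {R : realType} (e1 e2 w : R).
Hypotheses (e10 : 0 < e1) (e20 : 0 < e2) (e12 : e1 + e2 < 1) (w01 : 0 < w < 1).
Context (S1 S2 : probability R R).
Hypotheses (SS1 : is_self_similar e1 e2 w S1) (SS2 : is_self_similar e2 e1 w S2).

Let f : plane R -> plane R := hs_map e1 e2.
Let L : set (plane R) := horseshoe e1 e2.
Let mu : probability (plane R) R := (S1 \x S2)%E.

Let e21 : e2 + e1 < 1. Proof. by rewrite addrC. Qed.
Let mL : measurable L := measurable_horseshoe _ _ e10 e20 e12.
Let mf : measurable_fun setT f := measurable_hs_map _ _.

Let mu_lty : (mu setT < +oo)%E. Proof. by rewrite probability_setT ltry. Qed.

Let muX (A B : set R) : measurable A -> measurable B ->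
  mu (A `*` B) = (S1 A * S2 B)%E.
Proof. by move=> mA mB; exact: product_measure1E. Qed.

Lemma bernoulli_full : mu L = 1%E.
Proof.
rewrite /L horseshoeE// muX; [|exact: measurable_repeller..].
by have [-> _] := SS1; have [-> _] := SS2; rewrite mule1.
Qed.

Lemma bernoulli_cylinder N m (p : plane R) : mu (cylinder e1 e2 N m p) =
  (weight e1 e2 w (1 - w) p.1 N * weight e2 e1 w (1 - w) p.2 m)%:E.
Proof.
have -> : cylinder e1 e2 N m p = [set t | same_digits e1 e2 N p.1 t] `*`
    [set t | same_digits e2 e1 m p.2 t].
  by apply/seteqP; split=> q.
rewrite muX; [|exact: measurable_same_digits..].
have h1 := self_similar_same_digits e1 e2 w S1 SS1 N p.1 _ measurableT.
have h2 := self_similar_same_digits e2 e1 w S2 SS2 m p.2 _ measurableT.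
by rewrite preimage_setT !setIT !probability_setT !mule1 in h1 h2; rewrite h1 h2.
Qed.

Let full A B : measurable A -> measurable B -> A `&` L = B `&` L -> mu A = mu B.
Proof. by move=> mA mB AB; apply: (eq_full_measure mu L) => //; exact: bernoulli_full. Qed.

Let mpre (t : plane R -> plane R) A : measurable_fun setT t -> measurable A ->
  measurable (t @^-1` A).
Proof. exact: measurable_preimage. Qed.

(** The map moves the first digit of x to the front of y. The preimage of a rectangle is thus a
    disjoint union of two rectangles, one per digit; self-similarity of [S1] produces the factors
    [w] and [1 - w], which Hutchinson's equation for [S2] recombines. *)
Lemma bernoulli_preserved A : measurable A -> mu (f @^-1` A) = mu A.
Proof.
have [m mE] := pushforward_measure mu f mf.
move=> mA; apply: etrans (esym (mE A)) _.
apply: (measure_prod_unique m mu _ _ A mA); first by rewrite mE; exact: mu_lty.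
move=> B1 B2 mB1 mB2; apply: etrans (mE _) _; apply: etrans _ (esym (muX _ _ mB1 mB2)).
change (mu (f @^-1` (B1 `*` B2)) = (S1 B1 * S2 B2)%E).
pose P s := ([set t : R | (t <= e1) = s] `&` unbranch e1 e2 @^-1` B1) `*`
  (branch e2 e1 s @^-1` B2).
have m1 s : measurable ([set t : R | (t <= e1) = s] `&` unbranch e1 e2 @^-1` B1).
  apply: measurableI; first exact: measurable_first_digit.
  by apply: measurable_preimage => //; exact: measurable_unbranch.
have m2 s : measurable (branch e2 e1 s @^-1` B2).
  by apply: measurable_preimage => //; exact: measurable_branch.
have mP s : measurable (P s : set (plane R)) by exact: measurableX.
have -> : mu (f @^-1` (B1 `*` B2)) = mu (P true `|` P false).
  apply: full; [exact: mpre (measurableX mB1 mB2)|exact: measurableU|].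
  apply/seteqP; split=> p /=.
    move=> [[h1 h2] Lp]; split=> //.
    have [_ _ E] := horseshoe_mapP _ _ e10 e20 e12 _ Lp.
    rewrite /f E /= in h1 h2.
    by rewrite /P/=; case: (p.1 <= e1) h1 h2 => h1 h2; [left|right].
  move=> [hP Lp]; split=> //.
  have [_ _ E] := horseshoe_mapP _ _ e10 e20 e12 _ Lp.
  by rewrite /f E /=; case: hP => -[[/= -> ?] ?].
transitivity (mu (P true) + mu (P false))%E.
  apply: measureU => //.
  by apply/seteqP; split=> // p [[[/= h _] _] [[/= h' _] _]]; rewrite h in h'.
have [_ h1] := SS1.
rewrite !muX// !h1// (self_similar_branch e2 e1 w e20 e10 S2 SS2 B2)//=.
have /fineK <- : S1 B1 \is a fin_num by exact: fin_num_measure.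
have /fineK <- : S2 (branch e2 e1 true @^-1` B2) \is a fin_num by exact: fin_num_measure.
have /fineK <- : S2 (branch e2 e1 false @^-1` B2) \is a fin_num by exact: fin_num_measure.
by rewrite -!EFinM; congr EFin; ring.
Qed.

Lemma bernoulli_invariant : invariant_measures f L mu.
Proof.
split; first exact: bernoulli_full.
move=> A mA; rewrite -(bernoulli_preserved _ mA); apply: full.
- by apply: measurableI => //; exact: mpre.
- exact: mpre.
- by rewrite [L `&` _]setIC -setIA setIid.
Qed.

Let iter_preserved n A : measurable A -> mu (iter n f @^-1` A) = mu A.
Proof.
move=> mA; elim: n => [|n ih]; first by congr (mu _).
rewrite -[RHS]ih -(bernoulli_preserved (iter n f @^-1` A)); last first.
  by apply: mpre => //; exact: measurable_iter.
by congr (mu _); apply/seteqP; split=> p /=; rewrite -iterSr.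
Qed.

Section Ergodicity.
Context (A : set (plane R)).
Hypotheses (mA : measurable A) (AL : A `<=` L) (fA : L `&` f @^-1` A = A).

Let al := fine (mu A).

Let muA : mu A = al%:E. Proof. by rewrite fineK//; exact: fin_num_measure. Qed.

Let A_preserved B : measurable B -> mu (A `&` f @^-1` B) = mu (A `&` B).
Proof.
move=> mB; rewrite -(bernoulli_preserved (A `&` B)); last exact: measurableI.
apply: full.
- by apply: measurableI => //; exact: mpre.
- by apply: mpre => //; exact: measurableI.
- by rewrite -[in LHS]fA; apply/seteqP; split=> p /= => [[[[? ?] ?] ?]|[[? ?] ?]].
Qed.

Let A_iter n B : measurable B -> mu (A `&` iter n f @^-1` B) = mu (A `&` B).
Proof.
move=> mB; elim: n => [|n ih]; first by congr (mu _).
rewrite -[RHS]ih -(A_preserved (iter n f @^-1` B)); last first.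
  by apply: mpre => //; exact: measurable_iter.
by congr (mu (_ `&` _)); apply/seteqP; split=> p /=; rewrite -iterSr.
Qed.

(** All preimages of the cylinder under the iterates meet the invariant set [A] in the same measure,
    while preimages that look at disjoint blocks of digits are pairwise independent. So [A] is
    independent of the cylinder. *)
Let vertical_cylinder n (t : R) :
  mu (A `&` ([set t' | same_digits e1 e2 n t t'] `*` setT)) =
  (al * weight e1 e2 w (1 - w) t n)%:E.
Proof.
pose C := [set t' | same_digits e1 e2 n t t'] `*` [set: R].
have mD : measurable [set t' | same_digits e1 e2 n t t'] by exact: measurable_same_digits.
have mC : measurable (C : set (plane R)) by exact: measurableX.
case: n => [|n] in C mD mC *.
  rewrite /weight big_ord0 mulr1 -muA; congr (mu _).
  by apply/seteqP; split=> [p []//|p Ap]; split=> //; split.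
set c := weight e1 e2 w (1 - w) t n.+1.
pose it k := iter k (unbranch e1 e2).
have mit k : measurable_fun setT (it k) by apply: measurable_iter; exact: measurable_unbranch.
have S1it k B : measurable B -> S1 (it k @^-1` B) = S1 B.
  move=> mB; elim: k => [|k ih]; first by congr (S1 _).
  rewrite -[RHS]ih -(self_similar_invariant e1 e2 w S1 SS1 (it k @^-1` B)); last first.
    exact: measurable_preimage.
  by congr (S1 _); apply/seteqP; split=> x /=; rewrite /it -iterSr.
have S1C : S1 [set t' | same_digits e1 e2 n.+1 t t'] = c%:E.
  have := self_similar_same_digits e1 e2 w S1 SS1 n.+1 t _ measurableT.
  by rewrite preimage_setT setIT probability_setT mule1.
have muC : mu C = c%:E by rewrite muX// S1C probability_setT mule1.
have {}muAC : exists be, mu (A `&` C) = be%:E.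
  exists (fine (mu (A `&` C))); rewrite fineK//; apply: fin_num_measure.
  exact: measurableI.
have [be muACE] := muAC; rewrite -/C muACE; congr EFin.
(* Times that are multiples of the length [n.+1] make the blocks of digits disjoint. *)
apply: (pairwise_independent_trivial mu (fun i => iter (i * n.+1) f @^-1` C)) => //.
- by move=> i; apply: mpre => //; exact: measurable_iter.
- by move=> i; rewrite iter_preserved.
- move=> i j ij.
  have -> : mu (iter (i * n.+1) f @^-1` C `&` iter (j * n.+1) f @^-1` C) =
      mu (iter (i * n.+1) f @^-1` (C `&` iter ((j - i) * n.+1) f @^-1` C)).
    congr (mu (_ `&` _)); apply/seteqP; split=> p /=;
    by rewrite -iterD -mulnDl subnK// ltnW.
  rewrite iter_preserved; last first.
    by apply: measurableI => //; apply: mpre => //; exact: measurable_iter.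
  pose D := [set t' | same_digits e1 e2 n.+1 t t'] `&`
    it n.+1 @^-1` (it ((j - i).-1 * n.+1)%N @^-1` [set t' | same_digits e1 e2 n.+1 t t']).
  have mD' : measurable D.
    by apply: measurableI => //; do 2 (apply: measurable_preimage => //).
  have -> : mu (C `&` iter ((j - i) * n.+1) f @^-1` C) = mu (D `*` setT).
    apply: full.
    - by apply: measurableI => //; apply: mpre => //; exact: measurable_iter.
    - exact: measurableX.
    have E p : L p -> (iter ((j - i) * n.+1) f p).1 =
        it ((j - i).-1 * n.+1)%N (it n.+1 p.1).
      move=> Lp; rewrite iter_hs_map1// /it -iterD -mulSnr prednK// subn_gt0//.
    apply/seteqP; split=> p /=.
      by move=> [[[h1 _] [h2 _]] Lp]; split=> //; split=> //; split=> //=; rewrite -E.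
    by move=> [[[h1 h2] _] Lp]; split=> //; split; split=> //=; rewrite E.
  rewrite muX// probability_setT mule1 /D.
  rewrite (self_similar_same_digits e1 e2 w S1 SS1); last exact: measurable_preimage.
  by rewrite S1it// S1C -EFinM.
- by move=> i; rewrite A_iter.
Qed.

Let vertical B1 : measurable B1 -> mu (A `&` (B1 `*` setT)) = (al%:E * S1 B1)%E.
Proof.
have al0 : 0 <= al by exact: fine_ge0.
have [m mE] := pushforward_measure (mrestr mu mA) fst measurable_fst.
have mE' B : m B = mu (A `&` (B `*` setT)).
  rewrite mE setIC; apply: (congr1 mu); rewrite setIC.
  by apply/seteqP; split=> p [] //; case.
move=> mB1; rewrite -mE'.
apply: (repeller_measure_unique e1 e2 e10 e20 e12 m (mscale (NngNum al0) S1)) => //.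
- rewrite mE'; apply: (@le_lt_trans _ _ (mu setT)); last exact: mu_lty.
  by apply: le_measure; rewrite ?inE//; apply: measurableI => //; exact: measurableX.
- rewrite mE' (_ : _ `&` _ = set0) ?measure0//.
  apply/seteqP; split=> // p [/AL Lp [/= nK _]].
  by move: Lp; rewrite /L horseshoeE// => -[].
- have S1K : S1 (~` repeller e1 e2) = 0%E.
    rewrite probability_setC; last exact: measurable_repeller.
    by have [-> _] := SS1; rewrite subee.
  exact: etrans (congr1 (fun x => al%:E * x)%E S1K) (mule0 _).
move=> n t; rewrite mE' vertical_cylinder EFinM.
have := self_similar_same_digits e1 e2 w S1 SS1 n t _ measurableT.
rewrite preimage_setT setIT probability_setT mule1 => h.
exact: (congr1 (fun x => al%:E * x)%E (esym h)).
Qed.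

(** The digits consumed from x are stacked onto y, so the past is read in reverse order. *)
Lemma past_digits m i (p : plane R) : L p -> (i < m)%N ->
  digit e2 e1 (iter m f p).2 i = digit e1 e2 p.1 (m - i.+1).
Proof.
move=> Lp im; rewrite /digit.
have Dm : hs_iter_dom e1 e2 m p by have [_ /(_ m)[]] := Lp.
rewrite iter_hs_map_unbranch// 1?ltnW// -(subnSK im) iterS.
have Lq := horseshoe_iter _ _ e10 e20 e12 (m - i.+1) _ Lp.
have [_ _ ->] := horseshoe_mapP _ _ e10 e20 e12 _ Lq.
rewrite /= branch_digit ?iter_hs_map1//.
by move: Lq; rewrite horseshoeE// => -[_ /=]; apply: repeller_itv.
Qed.

(** Pulling back by [m] steps turns the [m] past digits into future ones. The preimage is then a
    vertical set over [D], to which [vertical] applies, and invariance of [A] keeps the measure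
    unchanged. *)
Let rectangle_cylinder (B1 : set R) m (t : R) : measurable B1 ->
  mu (A `&` (B1 `*` [set t' | same_digits e2 e1 m t t'])) =
  (al%:E * S1 B1 * (weight e2 e1 w (1 - w) t m)%:E)%E.
Proof.
move=> mB1; pose C := [set t' | same_digits e2 e1 m t t'].
have mC : measurable C by exact: measurable_same_digits.
have mBC : measurable (B1 `*` C : set (plane R)) by exact: measurableX.
pose D := iter m (unbranch e1 e2) @^-1` B1 `&`
  \bigcap_i (if (i < m)%N then
    [set t' | digit e1 e2 t' (m - i.+1) = digit e2 e1 t i] else setT).
have mD : measurable D.
  apply: measurableI.
    by apply: measurable_preimage => //; apply: measurable_iter; exact: measurable_unbranch.
  apply: bigcapT_measurable => i; case: ifP => // _.
  case: (digit e2 e1 t i) => /=; first exact: measurable_digit.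
  rewrite (_ : [set _ | _] = ~` [set t' | digit e1 e2 t' (m - i.+1)]); last first.
    by apply/seteqP; split=> t' /=; case: digit.
  by apply: measurableC; exact: measurable_digit.
have DE : (iter m f @^-1` (B1 `*` C)) `&` L = (D `*` setT) `&` L.
  apply/seteqP; split=> p /= [+ Lp]; rewrite iter_hs_map1// => -[h1 h2]; split=> //.
    split=> //; split=> // i _; case: ifP => // im /=.
    by rewrite -past_digits// h2.
  case: h1 => h1 h3; split=> // i im.
  by have := h3 i I; rewrite im /= past_digits.
have mpreBC : measurable (iter m f @^-1` (B1 `*` C)).
  by apply: mpre => //; exact: measurable_iter.
have mDT : measurable (D `*` setT : set (plane R)) by exact: measurableX.
rewrite -(A_iter m)//.
have -> : mu (A `&` iter m f @^-1` (B1 `*` C)) = mu (A `&` (D `*` setT)).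
  apply: full; [exact: measurableI|exact: measurableI|].
  by rewrite -setIA DE setIA.
rewrite vertical// -muleA; congr (_ * _)%E.
rewrite -[LHS]mule1 -(probability_setT S2) -muX// -(full _ _ mpreBC mDT DE).
rewrite iter_preserved// muX//; congr (_ * _)%E.
have := self_similar_same_digits e2 e1 w S2 SS2 m t _ measurableT.
by rewrite preimage_setT setIT probability_setT mule1.
Qed.

Let rectangle (B1 B2 : set R) : measurable B1 -> measurable B2 ->
  mu (A `&` (B1 `*` B2)) = (al%:E * (S1 B1 * S2 B2))%E.
Proof.
move=> mB1; have mB1T : measurable (A `&` (B1 `*` setT) : set (plane R)).
  by apply: measurableI => //; exact: measurableX.
have al0 : 0 <= al * fine (S1 B1) by apply: mulr_ge0; exact: fine_ge0.
have [m mE] := pushforward_measure (mrestr mu mB1T) snd measurable_snd.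
have mE' B : m B = mu (A `&` (B1 `*` B)).
  rewrite mE; apply: (congr1 mu).
  by apply/seteqP; split=> p; [move=> [? [? []]]|move=> [? []]].
have E : (al%:E * S1 B1)%E = (al * fine (S1 B1))%:E.
  by rewrite EFinM; congr (_ * _)%E; rewrite fineK//; exact: fin_num_measure.
move=> mB2; rewrite -mE' muleA E.
apply: (repeller_measure_unique e2 e1 e20 e10 e21 m (mscale (NngNum al0) S2)) => //.
- rewrite mE'; apply: (@le_lt_trans _ _ (mu setT)); last exact: mu_lty.
  by apply: le_measure; rewrite ?inE//; apply: measurableI => //; exact: measurableX.
- rewrite mE' (_ : _ `&` _ = set0) ?measure0//.
  apply/seteqP; split=> // p [/AL Lp [_ /= nK]].
  by move: Lp; rewrite /L horseshoeE// => -[].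
- have S2K : S2 (~` repeller e2 e1) = 0%E.
    rewrite probability_setC; last exact: measurable_repeller.
    by have [-> _] := SS2; rewrite subee.
  exact: etrans (congr1 (fun x => _ * x)%E S2K) (mule0 _).
move=> n t; rewrite mE' rectangle_cylinder// E.
have := self_similar_same_digits e2 e1 w S2 SS2 n t _ measurableT.
rewrite preimage_setT setIT probability_setT mule1 => h.
exact: (congr1 (fun x => (al * fine (S1 B1))%:E * x)%E (esym h)).
Qed.

(** [A] is independent of every rectangle, hence of itself, and its measure equals its own
    square. *)
Lemma invariant_set_trivial : mu A = 0%E \/ mu A = 1%E.
Proof.
have al0 : 0 <= al by exact: fine_ge0.
have h : mu (A `&` A) = (al%:E * mu A)%E.
  apply: (measure_prod_unique (mrestr mu mA) (mscale (NngNum al0) mu) _ _ A mA).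
    have muA1 : (mu (setT `&` A) < +oo)%E.
      by rewrite setTI muA ltry.
    exact: muA1.
  move=> B1 B2 mB1 mB2.
  apply: etrans (congr1 (fun x => al%:E * x)%E (esym (muX _ _ mB1 mB2))).
  apply: etrans (rectangle _ _ mB1 mB2); apply: (congr1 mu); exact: setIC.
move: h; rewrite setIid muA -EFinM => -[] /eqP.
rewrite -subr_eq0 -[X in X - _]mulr1 -mulrBr mulf_eq0 subr_eq0.
by move=> /orP[/eqP ->|/eqP <-]; [left|right].
Qed.

End Ergodicity.

Lemma bernoulli_ergodic : ergodic f L mu.
Proof.
split; first exact: bernoulli_invariant.
by move=> A mA AL fA; exact: invariant_set_trivial.
Qed.

End Bernoulli.

(** * Optimal frequencies *)

Section ErgodicDivergence.
Context {R : realType} {d : measure_display} {T : measurableType d}.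
Context (mu : probability T R) (f : T -> T) (L : set T).
Hypotheses (mL : measurable L) (mf : measurable_fun setT f).
Hypothesis fL : forall x, L x -> L (f x).
Hypothesis muf : forall B, measurable B -> mu (f @^-1` B) = mu B.
Hypothesis erg : ergodic f L mu.

(** The divergence set is invariant. If it had full measure, the maximal inequality on it would make
    the mean of [h] nonnegative. *)
Lemma ergodic_divergent_null (h : T -> R) : bounded_mfun h -> mean mu h < 0 ->
  mu (divergent L f h) = 0%E.
Proof.
move=> bh h0; set E := divergent L f h.
have mE : measurable E by apply: measurable_divergent => //; case: bh.
have fE x : E x -> E (f x) by exact: divergent_fwd.
have [_ /(_ E mE)] := erg; case=> //.
- by move=> x [].
- apply/seteqP; split=> x; first by move=> [Lx hx]; exact: divergent_bwd.
  by move=> Ex; split; [case: Ex|exact: fE].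
move=> E1; exfalso.
have h1 := maximal_ergodic mu f E h mf muf mE fE bh.
have {}h1 : 0 <= mean mu (fun x => h x * \1_E x) by apply: h1 => x [_ /(_ 0%N)].
have bE : bounded_mfun (\1_E : T -> R) by exact: bounded_mfun_indic.
have bE' : bounded_mfun (\1_(~` E) : T -> R) by apply: bounded_mfun_indic; exact: measurableC.
have [_ [M hM]] := bh.
have : - M * mean mu \1_(~` E) <= mean mu (fun x => h x * \1_(~` E) x).
  rewrite -meanZ//; apply: mean_le; [exact: bounded_mfunZ|exact: bounded_mfunM|].
  move=> x; rewrite ler_wpM2r ?indicE// ?ler0n//.
  by have := hM x; rewrite ler_norml => /andP[].
rewrite mean_indic; last exact: measurableC.
rewrite probability_setC// E1 subee//= mulr0 => h2.
move: h0; apply/negP; rewrite -leNgt.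
have -> : h = (fun x => h x * \1_E x + h x * \1_(~` E) x).
  apply/funext => x; rewrite -mulrDr !indicE in_setC.
  by case: (x \in E); rewrite /= ?addr0 ?add0r mulr1.
by rewrite meanD; [exact: addr_ge0|exact: bounded_mfunM|exact: bounded_mfunM].
Qed.

(** This identifies the value of the forward frequency; [ae_has_freq] then carries it over to the
    past. *)
Lemma ergodic_frequency (A : set T) (w : R) : measurable A -> mu A = w%:E ->
  mu.-negligible [set x | L x /\ ~ freq (visits f A x) w].
Proof.
move=> mA muA.
have bA : bounded_mfun (\1_A : T -> R) by exact: bounded_mfun_indic.
have mean_c k : mean mu (fun=> k) = k :> R.
  have := mean_indic mu _ (@measurableT _ T).
  rewrite probability_setT/= => h; rewrite -[RHS]mulr1 -h -meanZ; last first.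
    exact: bounded_mfun_indic.
  by congr mean; apply/funext => x; rewrite indicE in_setT mulr1.
pose N (s : rat) : set T :=
  (if w < ratr s then divergent L f (fun x => \1_A x - ratr s : R) else set0) `|`
  (if ratr s < w then divergent L f (fun x => ratr s - \1_A x : R) else set0).
apply: (@negligibleS _ _ _ _ (\bigcup_s N s)); last first.
  apply: negligible_countable_bigcup => s; apply: negligibleU.
    case: ifP => [ws|_]; last exact: negligible_set0.
    have b : bounded_mfun (fun x => \1_A x - ratr s : R).
      by apply: bounded_mfunB => //; exact: bounded_mfun_cst.
    apply/negligibleP; first by apply: measurable_divergent => //; case: b.
    apply: ergodic_divergent_null => //.
    by rewrite meanB ?mean_indic ?muA ?mean_c ?subr_lt0//; exact: bounded_mfun_cst.
  case: ifP => [ws|_]; last exact: negligible_set0.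
  have b : bounded_mfun (fun x => ratr s - \1_A x : R).
    by apply: bounded_mfunB => //; exact: bounded_mfun_cst.
  apply/negligibleP; first by apply: measurable_divergent => //; case: b.
  apply: ergodic_divergent_null => //.
  by rewrite meanB ?mean_indic ?muA ?mean_c ?subr_lt0//; exact: bounded_mfun_cst.
move=> x [Lx]; apply: contra_notP => nN; apply: freq_bounds => e e0.
  have /rat_in_itvoo[s] : w < w + e by rewrite ltrDl.
  rewrite in_itv/= => /andP[ws se].
  have [|C hC] := not_exceeds (visits f A x) (ratr s : R).
    move=> ex; apply: nN; exists s => //; left; rewrite ws.
    exact: exceeds_divergent.
  by exists C => n; rewrite (le_trans (hC n))// lerD2r ler_wpM2r// ltW.
have /rat_in_itvoo[s] : w - e < w by rewrite ltrBlDr ltrDl.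
rewrite in_itv/= => /andP[es sw].
have [|C hC] := not_falls_below (visits f A x) (ratr s : R).
  move=> ex; apply: nN; exists s => //; right; rewrite sw.
  exact: falls_below_divergent.
by exists C => n; rewrite (le_trans _ (hC n))// lerD2r ler_wpM2r// ltW.
Qed.

End ErgodicDivergence.

(** * Existence of an optimal frequency *)

Section Optimum.
Context {R : realType}.
Implicit Types (q r : R).

(** Near 0 the bound [|y ln y| <= 2 sqrt y] follows from [ln z < z] at [z = 1 / sqrt y]; on the
    nonpositive side [ln] has the default value 0. *)
Lemma xlnx_continuous : continuous (fun x : R => x * ln x).
Proof.
move=> x; have [x0|x0] := ltP 0 x.
  by apply: cvgM; [exact: cvg_id|exact: continuous_ln].
have [->|xn0] := eqVneq x 0; last first.
  have x_lt0 : x < 0 by rewrite lt_neqAle xn0.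
  have xlnx0 : x * ln x = 0 by rewrite ln0 ?mulr0// ltW.
  rewrite /continuous_at xlnx0; apply: (@cvg_near_cst _ _ _ _ (nbhs x)).
  near=> y; rewrite ln0 ?mulr0//.
  by apply: ltW; near: y; exact: lt_nbhsl.
rewrite /continuous_at mul0r; apply/cvgr0Pnorm_le => e e_gt0.
have sq0 : 2 * Num.sqrt y @[y --> (0:R)] --> 2 * Num.sqrt (0:R).
  by apply: cvgM; [exact: cvg_cst|exact: sqrt_continuous].
near=> y; apply: (@le_trans _ _ (2 * Num.sqrt y)); last first.
  by near: y; move/cvgr_le : sq0; apply; rewrite sqrtr0 mulr0.
have [y0|y0] := ltP 0 y; last first.
  by rewrite ln0// mulr0 normr0 mulr_ge0// sqrtr_ge0.
have y1 : y <= 1 by apply: ltW; near: y; apply: lt_nbhsl; exact: ltr01.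
have s0 : 0 < Num.sqrt y by rewrite sqrtr_gt0.
rewrite ler0_norm; last by rewrite mulr_ge0_le0 ?ln_le0// ltW.
have : ln (Num.sqrt y)^-1 < (Num.sqrt y)^-1 by apply: ln_sublinear; rewrite invr_gt0.
rewrite lnV ?posrE// => h.
have -> : ln y = 2 * ln (Num.sqrt y).
  by rewrite -[in LHS](sqr_sqrtr (ltW y0)) lnXn// mulr_natl.
rewrite -{1}(sqr_sqrtr (ltW y0)); set z := Num.sqrt y in s0 h *.
have : z * - ln z <= 1.
  have <- : z * z^-1 = 1 by rewrite divff// gt_eqF.
  by rewrite ler_pM2l// ltW.
nra.
Unshelve. all: by end_near. Qed.

Variables (e1 e2 : R).
Hypotheses (e1_01 : 0 < e1 < 1) (e2_01 : 0 < e2 < 1).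

Lemma neutral_rate_sym r q : neutral_rate e1 e2 r (1 - q) = neutral_rate e1 e2 r q.
Proof.
rewrite /neutral_rate.
have -> : lyap e1 e2 (1 - q) = lyap e2 e1 q by rewrite /lyap; ring.
have -> : lyap e2 e1 (1 - q) = lyap e1 e2 q by rewrite /lyap; ring.
by rewrite /lyap subKr; ring.
Qed.

Lemma neutral_rate_max r : exists2 q, 0 <= q <= 1 &
  forall q', 0 <= q' <= 1 -> neutral_rate e1 e2 r q' <= neutral_rate e1 e2 r q.
Proof.
have cH : continuous (fun q : R => lyap q (1 - q) q).
  move=> q; apply: cvgN; apply: cvgD; first exact: xlnx_continuous.
  apply: (@cvg_comp _ _ _ (fun q => 1 - q) (fun x => x * ln x)); last exact: xlnx_continuous.
  by apply: cvgB; [exact: cvg_cst|exact: cvg_id].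
have cl u v : continuous (fun q : R => lyap u v q).
  move=> q; apply: cvgN; apply: cvgD; (apply: cvgM; last exact: cvg_cst).
    exact: cvg_id.
  by apply: cvgB; [exact: cvg_cst|exact: cvg_id].
have cF : {within `[0, 1], continuous (neutral_rate e1 e2 r)}.
  apply: continuous_in_subspaceT => q /set_mem /=; rewrite in_itv/= => q01.
  have lu0 := lyap_gt0 _ _ _ e1_01 e2_01 q01; have ls0 := lyap_gt0 _ _ _ e2_01 e1_01 q01.
  apply: cvgM; first exact: cH.
  apply: cvgD; first apply: cvgD; first exact: cvg_cst.
    by apply: cvgM; [exact: cvg_cst|apply: cvgV; [rewrite gt_eqF|exact: cl]].
  by apply: cvgM; [exact: cvg_cst|apply: cvgV; [rewrite gt_eqF|exact: cl]].
have [q q01 hq] := EVT_max ler01 cF.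
exists q; first by move: q01; rewrite in_itv.
by move=> q' q'01; apply: hq; rewrite in_itv.
Qed.

End Optimum.

(** * Parameters for which frequency 1/2 is not optimal *)

Section Asymmetric.
Context {R : realType}.

Definition eta_small : R := expR (- 12).
Definition eta_large : R := 1 - 2 * eta_small.

Lemma eta_small_gt0 : 0 < eta_small. Proof. exact: expR_gt0. Qed.

Lemma eta_small_le : eta_small <= 13^-1.
Proof.
rewrite /eta_small expRN lef_pV2 ?posrE ?expR_gt0//.
by have := expR_ge1Dx (12 : R); lra.
Qed.

(** At 1/2 both exponents are at least 6 and the entropy is [ln 2 <= 1], so the rate is at most
    [1 + r / 3]. At [1 - eta_small] the entropy is at least [12 * eta_small] and the stable exponent
    at most [16 * eta_small], so the rate is at least [3 / 4 * r], which is larger once [r >= 3]. *)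
Lemma neutral_rate_asym (r : R) : 3 <= r ->
  neutral_rate eta_small eta_large r 2^-1 <
  neutral_rate eta_small eta_large r (1 - eta_small).
Proof.
move=> r3; have e0 := eta_small_gt0; have e13 := eta_small_le.
have lne : ln eta_small = -12 by rewrite /eta_small expRK.
have l0 : 0 < eta_large by rewrite /eta_large; lra.
have b0 : 0 <= - ln eta_large by rewrite oppr_ge0 ln_le0// /eta_large; lra.
(* From [ln y <= y - 1] at [y = eta_large^-1], where [y - 1 = 2 * eta_small / eta_large] and
   [eta_large >= 1 / 2]. *)
have b4 : - ln eta_large <= 4 * eta_small.
  have := @le_ln1Dx R (eta_large^-1 - 1).
  rewrite (_ : 1 + _ = eta_large^-1); last by ring.
  rewrite lnV ?posrE//.
  have i0 : 0 < eta_large^-1 by rewrite invr_gt0.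
  move=> /(_ _)/le_trans; apply; first lra.
  rewrite lerBlDr -[leLHS]mul1r ler_pdivrMr// /eta_large.
  nra.
rewrite /neutral_rate (_ : lyap 2^-1 (1 - 2^-1) 2^-1 = ln 2); last first.
  have -> : 1 - 2^-1 = 2^-1 :> R by lra.
  by rewrite /lyap lnV ?posrE//; lra.
have ln2 : ln 2 <= 1 :> R.
  by have := @le_ln1Dx R 1; rewrite (_ : 1 + 1 = 2 :> R)//; apply; lra.
have ln2_0 : 0 <= ln 2 :> R by apply: ln_ge0; lra.
have r0 : 0 < r by lra.
have div6 x : 6 <= x -> r / x <= r / 6.
  by move=> x6; rewrite ler_pM2l// lef_pV2 ?posrE//; lra.
have lu : 6 <= lyap eta_small eta_large 2^-1 by rewrite /lyap lne; lra.
have ls : 6 <= lyap eta_large eta_small 2^-1 by rewrite /lyap lne; lra.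
have /le_lt_trans -> // : ln 2 * (1 + r / lyap eta_small eta_large 2^-1 +
    r / lyap eta_large eta_small 2^-1) <= 1 + r / 3.
  apply: (@le_trans _ _ (1 * (1 + r / 6 + r / 6))); last by lra.
  apply: ler_pM => //; first by rewrite !addr_ge0// divr_ge0//; lra.
  by rewrite !lerD// div6.
have w01 : 0 <= 1 - eta_small <= 1 by apply/andP; split; lra.
have es01 : 0 < eta_small < 1 by apply/andP; split; lra.
have el01 : 0 < eta_large < 1 by apply/andP; split; rewrite // /eta_large; lra.
have lu0 := lyap_gt0 _ _ _ es01 el01 w01; have ls0 := lyap_gt0 _ _ _ el01 es01 w01.
(* Only the term of the rare digit is kept; the other one is nonnegative. *)
have H12 : 12 * eta_small <= lyap (1 - eta_small) (1 - (1 - eta_small)) (1 - eta_small).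
  rewrite /lyap subKr lne.
  have : (1 - eta_small) * ln (1 - eta_small) <= 0.
    by rewrite mulr_ge0_le0 ?ln_le0//; lra.
  lra.
(* At most [4 * eta_small] comes from the frequent digit, and [12 * eta_small] from the rare one. *)
have ls16 : lyap eta_large eta_small (1 - eta_small) <= 16 * eta_small.
  rewrite /lyap lne; nra.
apply: (@lt_le_trans _ _ (12 * eta_small * (r / (16 * eta_small)))).
  have -> : 12 * eta_small * (r / (16 * eta_small)) = 3 / 4 * r by field; rewrite gt_eqF.
  lra.
apply: ler_pM => //.
- lra.
- by rewrite divr_ge0//; lra.
apply: (@le_trans _ _ (r / lyap eta_large eta_small (1 - eta_small))).
  by rewrite ler_pM2l// lef_pV2 ?posrE//; lra.
by rewrite lerDr addr_ge0// divr_ge0// ltW.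
Qed.

End Asymmetric.

Section BernoulliEntropy.
Context {R : realType} (e1 e2 : R).
Hypotheses (e10 : 0 < e1) (e20 : 0 < e2) (e12 : e1 + e2 < 1).

(** The mass of the left strip is recorded in order to tell the measures for [q] and [1 - q]
    apart. *)
Lemma bernoulli_measure_exists (w : R) : 0 < w < 1 ->
  exists mu : probability (plane R) R,
    [/\ ergodic (hs_map e1 e2) (horseshoe e1 e2) mu,
        mu [set p | p.1 <= e1] = w%:E &
        forall r, 0 < r -> ((neutral_rate e1 e2 r w)%:E <=
          neutral_entropy (hs_map e1 e2) (horseshoe e1 e2) (@euclid R) r mu)%E].
Proof.
move=> w01; have e21 : e2 + e1 < 1 by rewrite addrC.
have [S1 SS1] := self_similar_exists e1 e2 w e10 e20 e12 w01.
have [S2 SS2] := self_similar_exists e2 e1 w e20 e10 e21 w01.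
pose mu : probability (plane R) R := (S1 \x S2)%E.
have muL : mu (horseshoe e1 e2) = 1%E by apply: (bernoulli_full e1 e2 w).
have muA : mu [set p | p.1 <= e1] = w%:E.
  (* The first digit of 0 is [true], so the left strip is a cylinder of weight [w]. *)
  have -> : [set p : plane R | p.1 <= e1] = cylinder e1 e2 1 0 (0, 0).
    apply/seteqP; split=> p /=; rewrite /cylinder /same_digits /digit/=.
      by move=> pe; split=> -[|i]//= _; rewrite pe ltW.
    by move=> [/(_ 0%N isT)/= <- _]; rewrite ltW.
  rewrite (bernoulli_cylinder e1 e2 w)// /weight big_ord1 big_ord0 mulr1 /digit/=.
  by rewrite ltW.
have erg : ergodic (hs_map e1 e2) (horseshoe e1 e2) mu by apply: (bernoulli_ergodic e1 e2 w).
exists mu; split=> // r r0; apply: neutral_entropy_ge => //; last first.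
  by move=> p N m Lp; rewrite (bernoulli_cylinder e1 e2 w).
have [inv _] := erg.
have mA : measurable [set p : plane R | p.1 <= e1].
  exact: (measurable_preimage fst _ measurable_fst (measurable_le_digit e1)).
have af := ae_has_freq e1 e2 e10 e20 e12 mu inv.
have ef := ergodic_frequency mu _ _ (measurable_horseshoe _ _ e10 e20 e12)
  (measurable_hs_map _ _)
  (fun p Lp => let: And3 h _ _ := horseshoe_mapP _ _ e10 e20 e12 _ Lp in h)
  (invariant_full e1 e2 e10 e20 e12 mu inv).1 erg _ w mA muA.
(* Almost every point has one frequency for past and future, and its forward frequency is [w];
   uniqueness of limits gives [w] on both sides. *)
apply: negligibleS (negligibleU af ef) => p /= [Lp nf].
have [[q [q01 [fq1 fq2]]]|nq] := pselect (exists q : R, 0 <= q <= 1 /\ has_freq e1 e2 p q);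
  last by left.
right; split=> // fw; apply: nf.
have E : visits (hs_map e1 e2) [set p | p.1 <= e1] p = ones e1 e2 p.1.
  by apply/funext => n; exact: visits_ones1.
rewrite E in fw; have qw : q = w by exact: cvg_unique fq1 fw.
by rewrite -qw.
Qed.

End BernoulliEntropy.

(* Distinctness is stated on a Borel set: only the values on measurable sets
   are part of a measure. *)
Theorem theorem3p2 (R : realType) :
  exists eta1 eta2 : R,
    [/\ 0 < eta1, 0 < eta2, eta1 + eta2 < 1 &
      forall r : R, 3 <= r ->
        exists mu1 mu2 : probability (plane R) R,
          [/\ ergodic (hs_map eta1 eta2) (horseshoe eta1 eta2) mu1 /\
              ergodic (hs_map eta1 eta2) (horseshoe eta1 eta2) mu2,
              maximizes_neutral_entropy (hs_map eta1 eta2)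
                (horseshoe eta1 eta2) (@euclid R) r mu1,
              maximizes_neutral_entropy (hs_map eta1 eta2)
                (horseshoe eta1 eta2) (@euclid R) r mu2 &
              exists A : set (plane R), measurable A /\ mu1 A <> mu2 A]].
Proof.
have e0 := @eta_small_gt0 R; have e13 := @eta_small_le R.
have l0 : 0 < eta_large :> R by rewrite /eta_large; lra.
have e12 : eta_small + eta_large < 1 :> R by rewrite /eta_large; lra.
exists eta_small, eta_large; split=> // r r3.
have r0 : 0 < r by lra.
have es01 : 0 < (eta_small : R) < 1 by apply/andP; split; lra.
have el01 : 0 < (eta_large : R) < 1 by apply/andP; split; lra.
(* The maximizer is not computed and may depend on [r]; the competitor [1 - eta_small] only
   certifies that it is not 1/2. *)
have [q q01 qmax] := neutral_rate_max _ _ es01 el01 r.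
have asym := neutral_rate_asym r r3.
have asym_q : neutral_rate eta_small eta_large r 2^-1 < neutral_rate eta_small eta_large r q.
  by apply: lt_le_trans asym (qmax _ _); apply/andP; split; lra.
(* The rate is zero at 0 and 1 and nonnegative at 1/2, so the same strict inequality keeps [q] away
   from both ends, and the Bernoulli measures are available. *)
have half0 : 0 <= neutral_rate eta_small eta_large r 2^-1.
  have h01 : 0 <= (2^-1 : R) <= 1 by apply/andP; split; lra.
  rewrite mulr_ge0 ?entropy_ge0// !addr_ge0// divr_ge0 ?ltW//; exact: lyap_gt0.
have q_half : q != 2^-1 by apply: contraTneq asym_q => ->; rewrite ltxx.
have rate0 : neutral_rate eta_small eta_large r 0 = 0.
  by rewrite /neutral_rate /lyap subr0 mul0r mul1r ln1 addr0 oppr0 mul0r.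
have q0 : q != 0 by apply: contraTneq asym_q => ->; rewrite rate0 -leNgt.
have q1 : q != 1.
  have := neutral_rate_sym eta_small eta_large r 0; rewrite subr0 rate0 => rate1.
  by apply: contraTneq asym_q => ->; rewrite rate1 -leNgt.
have q01' : 0 < q < 1.
  by move: q01 => /andP[? ?]; rewrite !lt_neqAle eq_sym q0 q1; apply/andP.
have q01'' : 0 < 1 - q < 1 by move: q01' => /andP[? ?]; apply/andP; split; lra.
have [mu1 [erg1 mu1A ge1]] := bernoulli_measure_exists _ _ e0 l0 e12 _ q01'.
have [mu2 [erg2 mu2A ge2]] := bernoulli_measure_exists _ _ e0 l0 e12 _ q01''.
have maxi (mu : probability (plane R) R) :
    ergodic (hs_map eta_small eta_large) (horseshoe eta_small eta_large) mu ->
    ((neutral_rate eta_small eta_large r q)%:E <= neutral_entropy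
      (hs_map eta_small eta_large) (horseshoe eta_small eta_large) (@euclid R) r mu)%E ->
    maximizes_neutral_entropy (hs_map eta_small eta_large)
      (horseshoe eta_small eta_large) (@euclid R) r mu.
  move=> [inv _] ge; split=> //; apply/eqP; rewrite eq_le; apply/andP; split.
    by apply: ereal_sup_ubound; exists mu.
  apply: ge_ereal_sup => _ [nu nuinv <-]; apply: le_trans ge.
  exact: neutral_entropy_le.
exists mu1, mu2; split.
- by split.
- exact: maxi erg1 (ge1 r r0).
- by apply: maxi erg2 _; rewrite -neutral_rate_sym; exact: ge2.
- exists [set p | p.1 <= eta_small]; split.
    exact: (measurable_preimage fst _ measurable_fst (measurable_le_digit eta_small)).
  rewrite mu1A mu2A => -[] qq; move: q_half => /eqP; apply; lra.
Qed.
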